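(* Let $\varepsilon>0$ and $a,b,c,d\in\mathbb{R}$. Put $\eta=\frac{\sqrt3+1}{\sqrt3-1}$ and suppose that (i) $a\in[\eta^{-1},\eta]\setminus\{1\}$; (ii) $\left|\tfrac{bd}{c}\right|\le 1$; (iii) $c\ge \tfrac{\pi^2}{8}$; and that, for some $\mu$ with $0<\mu\le\mu^\ast:=\ln\left(\frac{|1+a|}{\sqrt3\,|1-a|}\right)$, (iv) $1+2(\sinh\mu+2\cosh\mu)\,b^2\le c$; (v) $|d|\le 2\sqrt{\mu e^{-\mu}}$. Then for every $(u_0,u_1,p_0)\in H^1(0,1)\times L^2(0,1)\times L^2(0,1)$ with $u_0(0)=0$ there exists a unique mild solution $(u,u_t,p)\in C([0,\infty);H^1(0,1)\times L^2(0,1)\times L^2(0,1))$ of the coupled wave-heat system described in the context. Moreover, if in addition $c\ge\frac{\pi^2}{4}$ and $|d|\le\sqrt{\mu e^{-\mu}}$, then the origin of this system is exponentially stable in the space $H^1(0,1)\times L^2(0,1)\times L^2(0,1)$.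
   Context: The coupled system is $$\begin{cases} u_{tt}=u_{xx}, & (x,t)\in(0,1)\times(0,\infty),\\ u(0,t)=0,\quad u_x(1,t)=-a\,u_t(1,t)+b\,p(0,t), & t>0,\\ u(x,0)=u_0(x),\ u_t(x,0)=u_1(x), & x\in(0,1),\\ \varepsilon p_t=p_{xx}, & (x,t)\in(0,1)\times(0,\infty),\\ p_x(0,t)=c\,p(0,t),\quad p_x(1,t)=d\,u(1,t), & t>0,\\ p(x,0)=p_0(x), & x\in(0,1).\end{cases}$$ All functions are real valued. Let $H^1_L(0,1)=\{u\in H^1(0,1): u(0)=0\}$ and $\mathcal H=H^1_L(0,1)\times L^2(0,1)\times L^2(0,1)$. The system is written as $\dot Y=A_\varepsilon Y$, $Y(0)=Y_0=(u_0,u_1,p_0)$, with $Y=(u,u_t,p)$, $A_\varepsilon(u,v,p)=(v,u_{xx},\varepsilon^{-1}p_{xx})$ and $$D(A_\varepsilon)=\{(u,v,p)\in (H^2(0,1)\cap H^1_L(0,1))\times H^1_L(0,1)\times H^2(0,1):\ u_x(1)=-av(1)+bp(0),\ p_x(0)=cp(0),\ p_x(1)=du(1)\}.$$ A mild solution is a function $Y\in C([0,\infty);\mathcal H)$ with $\int_0^tY(s)\,ds\in D(A_\varepsilon)$ and $Y(t)=Y_0+A_\varepsilon\int_0^tY(s)\,ds$ for all $t\ge0$ (equivalently, $Y$ is the orbit of the $C_0$-semigroup generated by $A_\varepsilon$). The origin is exponentially stable in a space with norm $\|\cdot\|$ if there are constants $C,\omega>0$ (which may depend on $\varepsilon$ and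 the parameters) such that every mild solution satisfies $\|(u(t),u_t(t),p(t))\|\le Ce^{-\omega t}\|(u_0,u_1,p_0)\|$ for all $t\ge0$. *)

(* Defs.v *)
From HB Require Import structures.
From mathcomp Require Import all_boot all_order all_algebra.
From mathcomp Require Import all_classical all_reals all_analysis.

Set Implicit Arguments.
Unset Strict Implicit.
Unset Printing Implicit Defensive.

Import Order.TTheory GRing.Theory Num.Theory.
Import numFieldNormedType.Exports.

Local Open Scope classical_set_scope.
Local Open Scope ring_scope.

Section hyperbolic.
Context {R : realType}.
Implicit Types x : R.

Definition sinh x : R := (expR x - expR (- x)) / 2.
Definition cosh x : R := (expR x + expR (- x)) / 2.

End hyperbolic.

(* Elements of L^2(0,1) and of the Sobolev spaces are represented by functions
   on the whole line that are identified when they agree almost everywhere on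
   ]0, 1[; their values outside of this interval play no role. *)
Section sobolev.
Context {R : realType}.
Implicit Types u w g phi : R -> R.

Definition leb01 : {measure set (measurableTypeR R) -> \bar R} :=
  mrestr (@lebesgue_measure R) (measurable_itv `]0, 1[).

Definition L2 u : Prop := u \in Lfun leb01 2%:E.

Definition L2norm u : R := fine ('N[leb01]_2%:E[EFin \o u])%E.

Definition test_function phi : Prop :=
  [/\ forall x, derivable phi x 1,
      continuous (derive1 phi) &
      exists alpha beta : R, [/\ 0 < alpha, beta < 1 &
        forall x, x \notin `[alpha, beta] -> phi x = 0]].

Definition is_weak_derivative u w : Prop :=
  forall phi, test_function phi ->
    \int[leb01]_x (u x * derive1 phi x) = - \int[leb01]_x (w x * phi x).

(* The square-integrable weak derivative, unique almost everywhere; the null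
   function when there is none. *)
Definition wD u : R -> R :=
  xget (cst 0) [set w : R -> R | L2 w /\ is_weak_derivative u w].

Definition H1 u : Prop := L2 u /\ exists w, L2 w /\ is_weak_derivative u w.

Definition H2 u : Prop := H1 u /\ H1 (wD u).

Definition H1norm u : R := Num.sqrt (L2norm u ^+ 2 + L2norm (wD u) ^+ 2).

(* The representative of u that is continuous up to the boundary, unique on
   [0, 1]. Boundary values of Sobolev functions are values of this
   representative. *)
Definition crep u : R -> R :=
  xget (cst 0)
    [set g : R -> R | {within `[0, 1], continuous g} /\ u = g %[ae leb01]].

Definition H1L u : Prop := H1 u /\ crep u 0 = 0.

End sobolev.

Section wave_heat.
Context {R : realType}.

(* (u, v, p), where v stands for u_t *)
Definition state : Type := ((R -> R^o) * (R -> R^o) * (R -> R^o))%type.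
HB.instance Definition _ := GRing.Lmodule.on state.

Implicit Types (y z w : state) (Y : R -> state) (eps a b c d t : R).

Definition st_u y : R -> R := y.1.1.
Definition st_v y : R -> R := y.1.2.
Definition st_p y : R -> R := y.2.

Definition inH y : Prop := [/\ H1L (st_u y), L2 (st_v y) & L2 (st_p y)].

Definition Hnorm y : R :=
  Num.sqrt (H1norm (st_u y) ^+ 2 + L2norm (st_v y) ^+ 2 + L2norm (st_p y) ^+ 2).

(* equality in H *)
Definition eqH y z : Prop :=
  [/\ st_u y = st_u z %[ae leb01], st_v y = st_v z %[ae leb01] &
      st_p y = st_p z %[ae leb01]].

Definition domA a b c d y : Prop :=
  [/\ H2 (st_u y) /\ H1L (st_u y), H1L (st_v y), H2 (st_p y) &
  [/\ crep (wD (st_u y)) 1 = - a * crep (st_v y) 1 + b * crep (st_p y) 0,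
      crep (wD (st_p y)) 0 = c * crep (st_p y) 0 &
      crep (wD (st_p y)) 1 = d * crep (st_u y) 1]].

Definition opA eps y : state :=
  (st_v y, wD (wD (st_u y)), fun x => eps^-1 * wD (wD (st_p y)) x).

Definition continuousH Y : Prop :=
  (forall t, 0 <= t -> inH (Y t)) /\
  (forall t, 0 <= t ->
     (fun s => Hnorm (Y s - Y t)) @ within `[0, +oo[ (nbhs t) --> (0 : R)).

(* w is the H-valued Riemann integral of Y over [0, t]: the limit in the norm
   of H of the Riemann sums over the tagged subdivisions
   0 = s_0 <= s_1 <= ... <= s_n = t with tags xi_i in [s_i, s_{i+1}]. *)
Definition is_integralH Y t w : Prop :=
  inH w /\
  forall e : R, 0 < e -> exists2 delta : R, 0 < delta &
    forall (n : nat) (s xi : nat -> R),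
      s 0%N = 0 -> s n = t ->
      (forall i, (i < n)%N ->
         [/\ s i <= xi i, xi i <= s i.+1 & s i.+1 - s i < delta]) ->
      Hnorm (\sum_(i < n) (s i.+1 - s i) *: Y (xi i) - w) < e.

Definition mild_solution eps a b c d y0 Y : Prop :=
  continuousH Y /\
  forall t, 0 <= t -> exists w,
    [/\ is_integralH Y t w, domA a b c d w & eqH (Y t) (y0 + opA eps w)].

Definition exponentially_stable eps a b c d : Prop :=
  exists C omega : R, [/\ 0 < C, 0 < omega &
    forall y0 Y, inH y0 -> mild_solution eps a b c d y0 Y ->
      forall t, 0 <= t -> Hnorm (Y t) <= C * expR (- omega * t) * Hnorm y0].

End wave_heat.

Arguments state R : clear implicits.

(* Main.v *)
Require Import Defs.
From HB Require Import structures.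
From mathcomp Require Import all_boot all_order all_algebra.
From mathcomp Require Import all_classical all_reals all_analysis.
From mathcomp Require Import measurable_realfun ring lra.

Import Order.TTheory GRing.Theory Num.Theory.
Import numFieldNormedType.Exports.

Local Open Scope classical_set_scope.
Local Open Scope ring_scope.

Set Implicit Arguments.
Unset Strict Implicit.
Unset Printing Implicit Defensive.

(** The state space carries a Hilbert norm, equivalent to the usual one, for
    which the operator of the system is dissipative.  Its square is the energy
    of (u, v, p), the sum of the integrals over ]0, 1[ of
    e^(mu x) (v + u_x)^2, of e^(- mu x) (v - u_x)^2 and of (eps / 2) p^2.  The
    functions v + u_x and v - u_x are the Riemann invariants of the wave
    equation; each weight decreases in the direction in which its invariant
    travels.  Let W be the sum of the first two integrals.  Integrating by
    parts, twice the inner product of y and A y is the sum of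
    - the bulk damping - mu W of the wave;
    - the boundary terms of the wave,
      e^mu ((1 - a) v(1) + b p(0))^2 - e^(- mu) ((1 + a) v(1) - b p(0))^2;
    - the terms d u(1) p(1) - c p(0)^2 - int p_x^2 of the heat equation.
    The bound mu <= mu* means 3 e^(2 mu) (1 - a)^2 <= (1 + a)^2, which is what
    is needed for the terms in v(1) to compensate.  What remains of the boundary
    terms is (3 e^mu + e^(- mu)) b^2 p(0)^2, where
    3 e^mu + e^(- mu) = 2 (sinh mu + 2 cosh mu); the lower bound on c therefore
    leaves at most - p(0)^2 ([dissipation_estimate]).  The coupling d u(1) p(1) is
    absorbed by the inequality of Young, since 2 e^(- mu) u(1)^2 <= W and
    p(1)^2 <= 2 p(0)^2 + 2 int p_x^2: the bound on d makes the operator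
    dissipative ([energy_dissipative]), and half of that bound leaves enough
    damping for an exponential rate ([energy_strictly_dissipative]).

    The resolvent equation y - h A y = f reduces to two second-order ordinary
    differential equations, coupled through their boundary conditions.
    Solving them from Cauchy data at 0 ([shooting]) leaves a two by two linear
    system, whose determinant is positive because |b d| <= c and
    sinh la / la <= cosh la ([resolvent_solvable]).

    The rest holds for any dissipative operator that satisfies this range
    condition.  Orbits exist because the implicit Euler scheme converges along
    the steps 2^-n for data in the domain of A^2, which is dense
    ([mild_exists]); they decay at the rate of the dissipation because the
    average of an orbit over a short window is a differentiable orbit, for
    which the square of the norm satisfies a differential inequality
    ([mild_decay]); uniqueness is the decay of a difference of orbits.  The
    theory is written for a degenerate inner product, as functions that agree
    almost everywhere are different vectors.

    The calculus behind the integrations by parts is that of primitives of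
    square integrable functions.  Their product rule comes from the theorem of
    Fubini ([primM]), and the lemma of du Bois-Reymond identifies the functions
    that have a square integrable weak derivative with these primitives
    ([H1_ac], [ac_H1]). *)

(** * Square integrable functions on the unit interval *)
Section square_integrable.
Context {R : realType}.
Implicit Types (f g h k : R -> R) (a M : R).
Local Notation lam := (@leb01 R).

(** A name for the measure, to which the structure of finite measure is attached. *)
Definition leb01_fun : set (measurableTypeR R) -> \bar R := lam.

HB.instance Definition _ := Measure.on leb01_fun.

Lemma leb01T : lam setT = 1%E.
Proof.
by rewrite /leb01 /= /mrestr setTI lebesgue_measure_itv /= lte_fin ltr01 sube0.
Qed.

Lemma leb01_fin_num : fin_num_fun leb01_fun.
Proof.
move=> A mA; rewrite ge0_fin_numE// /leb01_fun.
apply: (@le_lt_trans _ _ (lam setT)); last by rewrite leb01T ltry.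
by apply: le_measure; rewrite ?inE.
Qed.

HB.instance Definition _ := Measure_isFinite.Build _ _ _ leb01_fun leb01_fin_num.

Definition mu01 : {finite_measure set (measurableTypeR R) -> \bar R} := leb01_fun.

Lemma leb01_ae : {ae lam, forall x, 0 < x < 1}.
Proof.
exists (~` `]0, 1[%classic); split.
- by apply: measurableC.
- by rewrite /leb01 /= /mrestr setICl measure0.
- by move=> x /= h; rewrite in_itv.
Qed.

Lemma ae01S (P Q : R -> Prop) : {ae lam, forall x, P x} ->
  (forall x, 0 < x < 1 -> P x -> Q x) -> {ae lam, forall x, Q x}.
Proof.
have F := ae_filter_ringOfSetsType lam.
by move=> aP PQ; apply: filterS2 leb01_ae aP => x; exact: PQ.
Qed.

Lemma ae01 (P : R -> Prop) : (forall x, 0 < x < 1 -> P x) ->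
  {ae lam, forall x, P x}.
Proof. by move=> h; apply: (ae01S leb01_ae) => x ? _; exact: h. Qed.

Lemma ae01S2 (P P' Q : R -> Prop) : {ae lam, forall x, P x} ->
  {ae lam, forall x, P' x} ->
  (forall x, 0 < x < 1 -> P x -> P' x -> Q x) -> {ae lam, forall x, Q x}.
Proof.
have F := ae_filter_ringOfSetsType lam.
move=> aP aP' PQ; apply: (ae01S (filterI aP aP')) => x x01 []; exact: PQ.
Qed.

Lemma L2_measurable f : L2 f -> measurable_fun setT f.
Proof. by rewrite /L2 inE => /andP[]; rewrite inE. Qed.

Lemma L2_integrable f : L2 f -> lam.-integrable setT (EFin \o f).
Proof.
move=> /Lfun_subset12 h; apply/Lfun1_integrable; apply: h.
exact: (@fin_num_measure _ _ _ mu01).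
Qed.

Lemma integrableM_L2 f g : L2 f -> L2 g ->
  lam.-integrable setT (EFin \o (fun x => f x * g x)).
Proof. by move=> hf hg; apply/Lfun1_integrable/Lfun2_mul_Lfun1. Qed.

Lemma L2_sqr f : measurable_fun setT f ->
  lam.-integrable setT (EFin \o (fun x => f x ^+ 2)) -> L2 f.
Proof.
move=> mf /integrableP[_ fi]; rewrite /L2 inE; apply/andP; split; rewrite inE//=.
rewrite /finite_norm unlock /Lnorm poweR_lty//.
apply: le_lt_trans fi; apply: ge0_le_integral => //.
- by move=> x _; exact: poweR_ge0.
- apply/measurable_EFinP.
  apply: (@measurableT_comp _ _ _ _ _ _ (@powR R ^~ 2)) => //.
  exact: measurableT_comp.
- by apply: measurableT_comp => //; apply/measurable_EFinP; exact: measurable_funX.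
- by move=> x _; rewrite /= lee_fin normrX powR_mulrn.
Qed.

Lemma L2_bounded f M : measurable_fun setT f ->
  (forall x, 0 < x < 1 -> `|f x| <= M) -> L2 f.
Proof.
move=> mf fM; apply: L2_sqr => //.
have iM : lam.-integrable setT (cst (M ^+ 2)%:E).
  exact: (@finite_measure_integrable_cst _ _ _ mu01).
have mf2 : measurable_fun setT (EFin \o (fun x => f x ^+ 2)).
  by apply/measurable_EFinP; exact: measurable_funX.
apply/integrableP; split => //.
move/integrableP : iM => [_]; apply: le_lt_trans.
apply: ae_ge0_le_integral => //; first exact: measurableT_comp.
apply: ae01 => x x01 _; rewrite /= lee_fin !normrX lerXn2r ?nnegrE//.
exact: le_trans (fM _ x01) (ler_norm _).
Qed.

Lemma L2_dom f g M : measurable_fun setT f -> L2 g ->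
  (forall x, 0 < x < 1 -> f x ^+ 2 <= M * g x ^+ 2) -> L2 f.
Proof.
move=> mf Lg fM; apply: L2_sqr => //.
have iM : lam.-integrable setT (EFin \o (fun x => M * (g x * g x))).
  exact: (integrableZl measurableT M (integrableM_L2 Lg Lg)).
have mf2 : measurable_fun setT (EFin \o (fun x => f x ^+ 2)).
  by apply/measurable_EFinP; exact: measurable_funX.
apply/integrableP; split => //.
move/integrableP : iM => [iM]; apply: le_lt_trans.
apply: ae_ge0_le_integral => //; first exact: measurableT_comp.
  exact: measurableT_comp.
apply: ae01 => x x01 _; rewrite /= lee_fin (ger0_norm (sqr_ge0 _)) -expr2.
exact: le_trans (fM _ x01) (ler_norm _).
Qed.

Lemma L2Mbounded k f M : measurable_fun setT k ->
  (forall x, 0 < x < 1 -> `|k x| <= M) -> L2 f -> L2 (fun x => k x * f x).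
Proof.
move=> mk kM Lf; apply: (@L2_dom _ f (M ^+ 2)) => //.
  by apply: measurable_funM => //; exact: L2_measurable.
move=> x x01; rewrite exprMn ler_wpM2r ?sqr_ge0//.
rewrite -(real_normK (num_real (k x))) lerXn2r ?nnegrE// ?kM//.
exact: le_trans (kM _ x01).
Qed.

Lemma L2_cst a : L2 (cst a).
Proof. by apply: (@L2_bounded _ `|a|). Qed.

Lemma L2Z a f : L2 f -> L2 (fun x => a * f x).
Proof. by move=> Lf; apply: (@L2Mbounded (cst a) f `|a|). Qed.

Lemma L2D f g : L2 f -> L2 g -> L2 (fun x => f x + g x).
Proof.
move=> Lf Lg; apply: L2_sqr.
  by apply: measurable_funD; exact: L2_measurable.
rewrite [X in _.-integrable _ X](_ : _ =
  ((EFin \o (fun x => f x * f x)%R) \+ (EFin \o (fun x => f x * g x)%R) \+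
  (EFin \o (fun x => f x * g x)%R) \+ (EFin \o (fun x => g x * g x)%R))%E); last first.
  by apply/funext => x /=; rewrite -!EFinD; congr EFin; ring.
by do !(apply: integrableD => //); exact: integrableM_L2.
Qed.

Lemma L2N f : L2 f -> L2 (fun x => - f x).
Proof.
by move=> /(L2Z (-1)); rewrite (_ : (fun x => -1 * f x) = (fun x => - f x))//;
  apply/funext => x; rewrite mulN1r.
Qed.

Lemma L2B f g : L2 f -> L2 g -> L2 (fun x => f x - g x).
Proof. by move=> Lf Lg; apply: L2D => //; exact: L2N. Qed.

Definition ip f g : R := \int[lam]_x (f x * g x).

Lemma eq_ip f f' g g' : measurable_fun setT f -> measurable_fun setT f' ->
  measurable_fun setT g -> measurable_fun setT g' ->
  f = f' %[ae lam] -> g = g' %[ae lam] -> ip f g = ip f' g'.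
Proof.
move=> mf mf' mg mg' ff' gg'; rewrite /ip /Rintegral; congr fine.
apply: ae_eq_integral => //.
- by apply/measurable_EFinP; exact: measurable_funM.
- by apply/measurable_EFinP; exact: measurable_funM.
- by apply: (ae01S2 ff' gg') => x _ h1 h2 _; rewrite /= h1// h2.
Qed.

Lemma ipC f g : ip f g = ip g f.
Proof. by apply: eq_Rintegral => x _; rewrite mulrC. Qed.

Lemma ipDl f g h : L2 f -> L2 g -> L2 h ->
  ip (fun x => f x + g x) h = ip f h + ip g h.
Proof.
move=> Lf Lg Lh; rewrite /ip -RintegralD//; [|exact: integrableM_L2..].
by apply: eq_Rintegral => x _; rewrite mulrDl.
Qed.

Lemma ipZl a f g : L2 f -> L2 g -> ip (fun x => a * f x) g = a * ip f g.
Proof.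
move=> Lf Lg; rewrite /ip -RintegralZl//; last exact: integrableM_L2.
by apply: eq_Rintegral => x _; rewrite mulrA.
Qed.

Lemma ipBl f g h : L2 f -> L2 g -> L2 h ->
  ip (fun x => f x - g x) h = ip f h - ip g h.
Proof.
move=> Lf Lg Lh; rewrite /ip -RintegralB//; [|exact: integrableM_L2..].
by apply: eq_Rintegral => x _; rewrite mulrBl.
Qed.

Lemma ipDr f g h : L2 f -> L2 g -> L2 h ->
  ip h (fun x => f x + g x) = ip h f + ip h g.
Proof. by move=> Lf Lg Lh; rewrite ipC ipDl// !(ipC h). Qed.

Lemma ipZr a f g : L2 f -> L2 g -> ip f (fun x => a * g x) = a * ip f g.
Proof. by move=> Lf Lg; rewrite ipC ipZl// ipC. Qed.

Lemma ip_ge0 f : 0 <= ip f f.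
Proof. by apply: Rintegral_ge0 => x _; rewrite -expr2 sqr_ge0. Qed.

Lemma le_ip f g h k : L2 f -> L2 g -> L2 h -> L2 k ->
  (forall x, 0 < x < 1 -> f x * g x <= h x * k x) -> ip f g <= ip h k.
Proof.
move=> Lf Lg Lh Lk fh; rewrite -subr_ge0 /ip -RintegralB//; try exact: integrableM_L2.
rewrite /Rintegral fine_ge0//.
rewrite (_ : (\int[lam]_x (h x * k x - f x * g x)%:E)%E =
   (\int[lam]_x `|h x * k x - f x * g x|%:E)%E); first exact: integral_ge0.
have mhk : measurable_fun setT (fun x => h x * k x - f x * g x).
  by apply: measurable_funB; apply: measurable_funM; exact: L2_measurable.
apply: ae_eq_integral => //; first exact/measurable_EFinP.
  by apply/measurable_EFinP; exact: measurableT_comp.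
apply: ae01 => x x01 _; rewrite ger0_norm//.
by rewrite subr_ge0 fh.
Qed.

Lemma ip_eq0 f : L2 f -> ip f f = 0 -> f = cst 0 %[ae lam].
Proof.
move=> Lf f0; have mf := L2_measurable Lf.
have i0 : (\int[lam]_x `|(f x * f x)%:E| = 0)%E.
  have -> : (\int[lam]_x `|(f x * f x)%:E| = \int[lam]_x (f x * f x)%:E)%E.
    by apply: eq_integral => x _; rewrite gee0_abs// lee_fin -expr2 sqr_ge0.
  rewrite -(fineK (_ : (\int[lam]_x (f x * f x)%:E)%E \is a fin_num)).
    by rewrite -[fine _]/(ip f f) f0.
  by apply: integrable_fin_num => //; exact: integrableM_L2.
have mff : measurable_fun setT (fun x => (f x * f x)%:E).
  by apply/measurable_EFinP; exact: measurable_funM.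
move/(ae_eq_integral_abs lam measurableT mff) : i0 => /ae01S; apply => x _ h _.
by have /= [/eqP] := h I; rewrite mulf_eq0 orbb => /eqP.
Qed.

Lemma L2norm_ip f : L2 f -> L2norm f = Num.sqrt (ip f f).
Proof.
move=> Lf; rewrite /L2norm unlock /=.
rewrite (_ : (\int[lam]_x _)%E = (ip f f)%:E); last first.
  rewrite /ip /Rintegral fineK; last first.
    by apply: integrable_fin_num => //; exact: integrableM_L2.
  apply: eq_integral => x _; rewrite powR_mulrn// -normrX.
  by rewrite ger0_norm ?sqr_ge0// expr2.
by rewrite poweR_EFin /= powR12_sqrt// ip_ge0.
Qed.

Lemma L2norm_sqr f : L2 f -> L2norm f ^+ 2 = ip f f.
Proof. by move=> Lf; rewrite L2norm_ip// sqr_sqrtr// ip_ge0. Qed.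

(** Evaluate the polynomial at its minimum [- B / C]; when [C] is null, it can
    be nonnegative only if it is constant. *)
Lemma discriminant_le0 (A B C : R) : 0 <= C ->
  (forall t, 0 <= A + 2 * t * B + t ^+ 2 * C) -> B ^+ 2 <= A * C.
Proof.
move=> C_ge0 h; have [C0|C0] := ltrP 0 C.
  have := h (- B / C).
  have -> : A + 2 * (- B / C) * B + (- B / C) ^+ 2 * C = (A * C - B ^+ 2) / C.
    by field; rewrite gt_eqF.
  by rewrite pmulr_lge0 ?invr_gt0// subr_ge0.
have {C_ge0 C0}C0 : C = 0 by apply/eqP; rewrite eq_le C_ge0 C0.
have [->|B0] := eqVneq B 0; first by rewrite C0 expr0n /= mulr0.
have := h (- (A + 1) / (2 * B)); rewrite C0.
have -> : A + 2 * (- (A + 1) / (2 * B)) * B + (- (A + 1) / (2 * B)) ^+ 2 * 0 = -1.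
  by field.
by rewrite oppr_ge0 ler10.
Qed.

Lemma ip_CS f g : L2 f -> L2 g -> ip f g ^+ 2 <= ip f f * ip g g.
Proof.
move=> Lf Lg; apply: discriminant_le0; first exact: ip_ge0.
move=> t; have := ip_ge0 (fun x => f x + t * g x).
have Ltg := L2Z t Lg; have L := L2D Lf Ltg.
rewrite ipDl// !ipDr// !ipZl// !ipZr// (ipC g f).
by congr (0 <= _); ring.
Qed.

Definition nrm f := Num.sqrt (ip f f).

Lemma nrm_ge0 f : 0 <= nrm f. Proof. exact: sqrtr_ge0. Qed.

Lemma nrm_sqr f : nrm f ^+ 2 = ip f f. Proof. by rewrite sqr_sqrtr// ip_ge0. Qed.

Lemma ip_le_nrm f g : L2 f -> L2 g -> `|ip f g| <= nrm f * nrm g.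
Proof.
move=> Lf Lg; rewrite -sqrtrM ?ip_ge0// -sqrtr_sqr ler_wsqrtr//.
exact: ip_CS.
Qed.

Lemma nrmD f g : L2 f -> L2 g -> nrm (fun x => f x + g x) <= nrm f + nrm g.
Proof.
move=> Lf Lg; rewrite -(@ler_pXn2r _ 2)// ?nnegrE ?addr_ge0 ?nrm_ge0//.
rewrite nrm_sqr ipDl ?ipDr//; try exact: L2D.
rewrite (ipC g f) sqrrD !nrm_sqr.
have := le_trans (ler_norm _) (ip_le_nrm Lf Lg).
by rewrite -mulr_natl; lra.
Qed.

Lemma parallelogram f g : L2 f -> L2 g ->
  ip (fun x => f x + g x) (fun x => f x + g x) +
  ip (fun x => f x - g x) (fun x => f x - g x) = 2 * (ip g g + ip f f).
Proof.
move=> Lf Lg; have L1 := L2D Lf Lg; have L2' := L2B Lf Lg.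
rewrite (ipDl Lf Lg L1) (ipBl Lf Lg L2') (ipC f (fun x => f x + g x)).
rewrite (ipC g (fun x => f x + g x)) (ipC f (fun x => f x - g x)) (ipC g (fun x => f x - g x)).
rewrite !(ipDl Lf Lg)// !(ipBl Lf Lg)// (ipC g f).
by do 3 move: (ip _ _) => ?; ring.
Qed.

Lemma ip_norm1 f : L2 f -> \int[lam]_x `|f x| <= nrm f.
Proof.
move=> Lf; have Lf' : L2 (fun x => `|f x|).
  apply: (@L2_dom _ f 1) => //.
    by apply: measurableT_comp => //; exact: L2_measurable.
  by move=> x _; rewrite real_normK ?num_real// mul1r.
have -> : \int[lam]_x `|f x| = ip (fun x => `|f x|) (cst 1).
  by apply: eq_Rintegral => x _; rewrite mulr1.
apply: le_trans (ler_norm _) (le_trans (ip_le_nrm Lf' (L2_cst 1)) _).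
have -> : nrm (cst 1) = 1.
  rewrite /nrm /ip (_ : \int[lam]_x _ = \int[lam]_(x in setT) 1); last first.
    by apply: eq_Rintegral => x _; rewrite mulr1.
  by rewrite Rintegral_cst// mul1r leb01T sqrtr1.
rewrite mulr1 /nrm (_ : ip (fun x => `|f x|) _ = ip f f)//.
by apply: eq_Rintegral => x _; rewrite -normrM ger0_norm// -expr2 sqr_ge0.
Qed.

(** * Completeness of the space of square integrable functions *)
Lemma sum_halves (C : R) n : \sum_(0 <= k < n) C / 2 ^+ k = 2 * C - 2 * C / 2 ^+ n.
Proof.
elim: n => [|n IH]; first by rewrite big_nil expr0 divr1 subrr.
rewrite big_nat_recr//= IH exprS; field.
by rewrite expf_neq0 ?pnatr_eq0.
Qed.

Section completeness.
Variables (F : nat -> R -> R) (C : R).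
Hypothesis LF : forall n, L2 (F n).
Hypothesis C0 : 0 <= C.
Hypothesis FC : forall n, nrm (fun x => F n.+1 x - F n x) <= C / 2 ^+ n.

Let nrm_tail n m : nrm (fun x => F (n + m)%N x - F n x) <= 2 * C / 2 ^+ n.
Proof.
suff : nrm (fun x => F (n + m)%N x - F n x) <= 2 * C / 2 ^+ n - 2 * C / 2 ^+ (n + m).
  by move/le_trans; apply; rewrite gerBl divr_ge0 ?exprn_ge0// mulr_ge0.
elim: m => [|m IH].
  rewrite addn0 subrr (_ : (fun x => _) = cst 0); last by apply/funext => x; rewrite subrr.
  rewrite /nrm /ip (_ : \int[lam]_x _ = \int[lam]_(x in setT) 0); last first.
    by apply: eq_Rintegral => x _; rewrite mulr0.
  by rewrite Rintegral_cst// mul0r sqrtr0.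
rewrite (_ : (fun x => _) = fun x =>
  (F (n + m).+1 x - F (n + m)%N x) + (F (n + m)%N x - F n x)); last first.
  by apply/funext => x; rewrite addnS; ring.
apply: le_trans (nrmD (L2B (LF _) (LF _)) (L2B (LF _) (LF _))) _.
apply: le_trans (lerD (FC _) IH) _; rewrite addnS exprS le_eqVlt; apply/orP; left.
by apply/eqP; field; rewrite !expf_neq0// pnatr_eq0.
Qed.

Let d n x : \bar R := `|F n.+1 x - F n x|%:E.

Let md n : measurable_fun setT (d n).
Proof.
apply/measurable_EFinP; apply: measurableT_comp => //.
by apply: measurable_funB; exact: L2_measurable.
Qed.

Let G x := (\sum_(0 <= n <oo) d n x)%E.

(** The integral of an increment is at most its norm, by Cauchy-Schwarz. *)
Let G_integrable : lam.-integrable setT G.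
Proof.
have d0 n x : (0 <= d n x)%E by rewrite lee_fin.
have mG : measurable_fun setT G.
  by apply: ge0_emeasurable_sum => // k x _; exact: d0.
apply/integrableP; split => //.
rewrite (_ : (\int[lam]_x _)%E = \int[lam]_x G x)%E; last first.
  by apply: eq_integral => x _; rewrite gee0_abs// nneseries_ge0.
rewrite integral_nneseries//.
apply: (@le_lt_trans _ _ (2 * C)%:E); last by rewrite ltry.
apply: lime_le; first by apply: is_cvg_nneseries => n _ _; exact: integral_ge0.
apply: nearW => n; apply: (@le_trans _ _ (\sum_(0 <= k < n) (C / 2 ^+ k)%:E)%E).
  apply: lee_sum => k _.
  apply: (@le_trans _ _ (\int[lam]_x `|F k.+1 x - F k x|)%:E).
    rewrite /Rintegral fineK//; apply: integrable_fin_num => //.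
    by have /Lfun_norm/Lfun1_integrable := (Lfun1_integrable lam _).2 (L2_integrable (L2B (LF k.+1) (LF k))).
  by rewrite lee_fin (le_trans (ip_norm1 (L2B (LF _) (LF _))))// FC.
rewrite sumEFin lee_fin sum_halves gerBl divr_ge0 ?exprn_ge0// mulr_ge0//.
Qed.

Let g x := fine (limn_esup (fun n => (F n x)%:E)).

Let cvgF : {ae lam, forall x, F n x @[n --> \oo] --> g x}.
Proof.
have := integrable_ae measurableT G_integrable.
move=> /ae01S; apply=> x _ /(_ I) Gx.
suff cF : cvgn (fun n => F n x).
  have cE : (F n x)%:E @[n --> \oo] --> (limn (fun n => F n x))%:E.
    by apply: cvg_EFin => //; exact: nearW.
  by rewrite /g (cvg_limn_einf_sup cE).2.
have -> : (fun n => F n x) = (fun n => F 0%N x + series (fun n => F n.+1 x - F n x) n).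
  apply/funext => n; rewrite /series /= telescope_sumr//; ring.
apply: is_cvgD; first exact: is_cvg_cst.
apply: normed_cvg.
apply: nondecreasing_is_cvgn.
  move=> m n mn; rewrite -subr_ge0 sub_series_geq//; apply: sumr_ge0 => k _.
  exact: normr_ge0.
exists (fine (G x)) => _ [n _ <-].
rewrite -lee_fin fineK//.
rewrite /series /= -sumEFin.
by apply: (@nneseries_lim_ge R (fun j => d j x) xpredT 0%N n) => j _ _; rewrite lee_fin.
Qed.

(** The increments of a rapidly convergent sequence form an absolutely
    convergent series almost everywhere.  The lemma of Fatou then bounds the
    distance to the pointwise limit. *)
Lemma L2_complete : exists2 g, L2 g &
  forall n, nrm (fun x => g x - F n x) <= 2 * C / 2 ^+ n.
Proof.
have mg : measurable_fun setT g.
  apply: measurableT_comp => //; apply: measurable_fun_limn_esup => n.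
  by apply/measurable_EFinP; exact: L2_measurable.
have key n : L2 (fun x => g x - F n x) /\
    nrm (fun x => g x - F n x) <= 2 * C / 2 ^+ n.
  have B0 : 0 <= 2 * C / 2 ^+ n by rewrite divr_ge0 ?exprn_ge0// mulr_ge0.
  have mgF : measurable_fun setT (fun x => g x - F n x).
    by apply: measurable_funB => //; exact: L2_measurable.
  pose h m x := ((F (n + m)%N x - F n x) * (F (n + m)%N x - F n x))%:E.
  have h0 m x : (0 <= h m x)%E by rewrite lee_fin -expr2 sqr_ge0.
  have mh m : measurable_fun setT (h m).
    by apply/measurable_EFinP; apply: measurable_funM;
      apply: measurable_funB; exact: L2_measurable.
  have ih : (\int[lam]_x ((g x - F n x) ^+ 2)%:E <= ((2 * C / 2 ^+ n) ^+ 2)%:E)%E.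
    rewrite (_ : (\int[lam]_x _)%E = \int[lam]_x limn_einf (h ^~ x))%E; last first.
      apply: ae_eq_integral => //.
      - by apply/measurable_EFinP; exact: measurable_funX.
      - rewrite (_ : (fun x => _) = (fun x => - limn_esup (fun m => - h m x)))%E.
          apply: measurableT_comp => //; apply: measurable_fun_limn_esup => m.
          exact: (measurableT_comp (@oppe_measurable R setT) (mh m)).
        apply/funext => x; rewrite -(limn_einfN (fun m => - h m x)%E).
        by apply: (congr1 limn_einf); apply/funext => m; rewrite /comp oppeK.
      - apply: (ae01S cvgF) => x _ cx _; apply/esym.
        suff : h m x @[m --> \oo] --> ((g x - F n x) ^+ 2)%:E.
          by move/cvg_limn_einf_sup => [].
        apply: cvg_EFin; first exact: nearW.
        rewrite expr2; apply: cvgM; apply: cvgB; try exact: cvg_cst;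
          by rewrite -(cvg_shiftn n) in cx; under eq_fun do rewrite addnC.
    apply: le_trans (fatou lam measurableT mh (fun m x _ => h0 m x)) _.
    rewrite limn_einf_lim; apply: lime_le; first exact: is_cvg_einfs.
    apply: nearW => j; apply: le_trans (_ : (\int[lam]_x h j x <= _)%E).
      by apply: ereal_inf_lbound; exists j => /=.
    rewrite -[leLHS]fineK; last first.
      by apply: integrable_fin_num => //; apply: integrableM_L2; exact: L2B.
    rewrite lee_fin -[fine _]/(ip (fun x => F (n + j)%N x - F n x) _) -nrm_sqr.
    by rewrite lerXn2r ?nnegrE ?nrm_ge0.
  have L : L2 (fun x => g x - F n x).
    apply: L2_sqr => //; apply/integrableP; split.
      by apply/measurable_EFinP; exact: measurable_funX.
    apply: le_lt_trans (ltry ((2 * C / 2 ^+ n) ^+ 2)); apply: le_trans ih.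
    rewrite le_eqVlt; apply/orP; left; apply/eqP; apply: eq_integral => x _.
    by rewrite gee0_abs// lee_fin sqr_ge0.
  split=> //; rewrite -(@ler_pXn2r _ 2)// ?nnegrE ?nrm_ge0// nrm_sqr -lee_fin.
  rewrite /ip /Rintegral fineK; last first.
    by apply: integrable_fin_num => //; exact: integrableM_L2.
  by under eq_integral do rewrite -expr2.
exists g => [|n]; last exact: (key n).2.
have := L2D (key 0%N).1 (LF 0%N); congr L2.
by apply/funext => x; rewrite subrK.
Qed.

End completeness.

End square_integrable.

(** * Primitives and absolutely continuous functions *)
Section primitives.
Context {R : realType}.
Implicit Types (f g h F G u w : R -> R) (x y z a M : R).
Local Notation lam := (@leb01 R).
Local Notation mu := (@lebesgue_measure R).

Lemma integral_leb01 f : measurable_fun setT f ->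
  (\int[lam]_x (f x)%:E = \int[mu]_(x in `]0%R, 1%R[) (f x)%:E)%E.
Proof.
move=> mf; rewrite -(@eq_measure_integral _ _ _ _ mu lam); last first.
  by move=> A mA A01; rewrite /leb01 /= /mrestr setIidl.
rewrite [RHS]integral_mkcond; apply: ae_eq_integral => //.
- exact/measurable_EFinP.
- apply/(measurable_restrictT _ _).1 => //.
  by apply/measurable_EFinP; exact: measurable_funTS.
- by apply: ae01 => x x01 _; rewrite patchE mem_set//= in_itv.
Qed.

(** The indicator of [y <= x] as a function of [y], so that a primitive is an
    inner product. *)
Definition below x y : R := (y <= x)%R%:R.

Lemma measurable_below x : measurable_fun setT (below x).
Proof.
rewrite (_ : below x = \1_(`]-oo, x]%classic : set R)).
  exact: measurable_indic.
by apply/funext => y; rewrite indicE /below mem_setE in_itv.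
Qed.

Lemma below_norm x y : `|below x y| <= 1.
Proof. by rewrite /below; case: (leP y x) => _ /=; rewrite ?normr0 ?normr1 ?ler01. Qed.

Lemma L2_below x : L2 (below x).
Proof.
apply: (@L2_bounded _ _ 1); first exact: measurable_below.
by move=> y _; exact: below_norm.
Qed.

Lemma L2_below_mul x f : L2 f -> L2 (fun y => below x y * f y).
Proof.
move=> Lf; apply: (@L2Mbounded _ _ _ 1) => //; first exact: measurable_below.
by move=> y _; exact: below_norm.
Qed.

Definition prim f x := ip f (below x).

Lemma primD f g x : L2 f -> L2 g ->
  prim (fun y => f y + g y) x = prim f x + prim g x.
Proof. by move=> Lf Lg; rewrite /prim ipDl//; exact: L2_below. Qed.

Lemma primZ a f x : L2 f -> prim (fun y => a * f y) x = a * prim f x.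
Proof. by move=> Lf; rewrite /prim ipZl//; exact: L2_below. Qed.

Lemma primB f g x : L2 f -> L2 g ->
  prim (fun y => f y - g y) x = prim f x - prim g x.
Proof. by move=> Lf Lg; rewrite /prim ipBl//; exact: L2_below. Qed.

Lemma eq_prim f g x : measurable_fun setT f -> measurable_fun setT g ->
  f = g %[ae lam] -> prim f x = prim g x.
Proof.
by move=> mf mg fg; apply: eq_ip => //; [exact: measurable_below..|exact: ae01].
Qed.

Lemma ip0l g : ip (cst 0) g = 0.
Proof.
rewrite /ip (_ : \int[lam]_x _ = \int[lam]_(x in setT) 0).
  by rewrite Rintegral_cst// mul0r.
by apply: eq_Rintegral => y _; rewrite mul0r.
Qed.

Lemma ip0r g : ip g (cst 0) = 0. Proof. by rewrite ipC ip0l. Qed.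

Lemma prim_cst0 x : prim (cst 0) x = 0. Proof. exact: ip0l. Qed.

Lemma prim_le0 f x : L2 f -> x <= 0 -> prim f x = 0.
Proof.
move=> Lf x0; rewrite -(ip0r f); apply: eq_ip => //; try exact: L2_measurable.
- exact: measurable_below.
- exact: ae01.
- apply: ae01 => y /andP[y0 _] _ /=; rewrite /below leNgt (le_lt_trans x0)//.
Qed.

Lemma prim0 f : L2 f -> prim f 0 = 0. Proof. by move=> /prim_le0; apply. Qed.

Lemma prim_ge1 f x : L2 f -> 1 <= x -> prim f x = ip f (cst 1).
Proof.
move=> Lf x1; apply: eq_ip => //; try exact: L2_measurable.
- exact: measurable_below.
- exact: ae01.
- by apply: ae01 => y /andP[_ y1] _ /=; rewrite /below (le_trans (ltW y1) x1).
Qed.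

Lemma prim1 f : L2 f -> prim f 1 = ip f (cst 1).
Proof. by move=> /prim_ge1; apply. Qed.

Lemma ip_sub_below x y : x <= y ->
  ip (fun z => below y z - below x z) (fun z => below y z - below x z) <= y - x.
Proof.
move=> xy.
have mxy : measurable_fun setT (fun z => below y z - below x z).
  by apply: measurable_funB; exact: measurable_below.
have E z : (below y z - below x z) * (below y z - below x z) = \1_`]x, y]%classic z.
  rewrite indicE mem_setE in_itv /= /below.
  have [zx|zx] := leP z x; have [zy|zy] := leP z y => /=; try ring.
  by move: (le_lt_trans (le_trans zx xy) zy); rewrite ltxx.
rewrite -lee_fin /ip /Rintegral fineK; last first.
  apply: integrable_fin_num => //; apply: integrableM_L2; exact: L2B (L2_below _) (L2_below _).
under eq_integral do rewrite E.
rewrite integral_indic//= setIT /leb01 /= /mrestr.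
apply: (@le_trans _ _ (mu `]x, y]%classic)).
  by apply: le_measure; rewrite ?inE//; exact: measurableI.
by rewrite lebesgue_measure_itv /= lte_fin; case: ltP => // _; rewrite lee_fin subr_ge0.
Qed.

(** A primitive of a square integrable function is Hoelder continuous of
    exponent one half, by the Cauchy-Schwarz inequality. *)
Lemma prim_holder f x y : L2 f -> x <= y ->
  `|prim f y - prim f x| <= nrm f * Num.sqrt (y - x).
Proof.
move=> Lf xy; have Lb := L2B (L2_below y) (L2_below x).
rewrite /prim ![ip f _]ipC -ipBl//; try exact: L2_below.
rewrite ipC (le_trans (ip_le_nrm Lf Lb))// ler_wpM2l ?nrm_ge0//.
by rewrite ler_wsqrtr// ip_sub_below.
Qed.

Lemma prim_bound f x : L2 f -> `|prim f x| <= nrm f.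
Proof.
move=> Lf; have [x0|x0] := leP x 0; first by rewrite prim_le0// normr0 nrm_ge0.
have [x1|x1] := leP 1 x.
  rewrite prim_ge1// -prim1//; have := prim_holder Lf ler01.
  by rewrite prim0// !subr0 sqrtr1 mulr1.
have := prim_holder Lf (ltW x0); rewrite prim0// !subr0 => /le_trans; apply.
rewrite ler_piMr ?nrm_ge0// -sqrtr1 ler_wsqrtr// ltW//.
Qed.

Lemma prim_continuous f : L2 f -> continuous (prim f).
Proof.
move=> Lf x; apply/cvgrPdist_le => e e0.
have H y : `|prim f x - prim f y| <= nrm f * Num.sqrt `|x - y|.
  have [xy|/ltW yx] := leP x y.
    by rewrite distrC (distrC x y) (ger0_norm (_ : 0 <= y - x)) ?subr_ge0// prim_holder.
  by rewrite (ger0_norm (_ : 0 <= x - y)) ?subr_ge0// prim_holder.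
have N0 : 0 < nrm f + 1 by rewrite ltr_wpDl// nrm_ge0.
have d0 : 0 < (e / (nrm f + 1)) ^+ 2 by rewrite exprn_gt0// divr_gt0.
near=> y.
apply: le_trans (H y) _.
apply: (@le_trans _ _ (nrm f * (e / (nrm f + 1)))).
  rewrite ler_wpM2l ?nrm_ge0//.
  apply: (@le_trans _ _ (Num.sqrt ((e / (nrm f + 1)) ^+ 2))).
    by rewrite ler_wsqrtr//; near: y; exact: cvgr_dist_le.
  by rewrite sqrtr_sqr gtr0_norm// divr_gt0.
by rewrite mulrA ler_pdivrMr// [nrm f * e]mulrC ler_wpM2l ?ltW// ltrDl.
Unshelve. all: by end_near. Qed.

Lemma measurable_prim f : L2 f -> measurable_fun setT (prim f).
Proof. by move=> Lf; apply: continuous_measurable_fun; exact: prim_continuous. Qed.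

Lemma L2_prim f : L2 f -> L2 (prim f).
Proof.
move=> Lf; apply: (@L2_bounded _ _ (nrm f)); first exact: measurable_prim.
by move=> x _; exact: prim_bound.
Qed.

Lemma L2_mul_prim f g : L2 f -> L2 g -> L2 (fun x => prim f x * g x).
Proof.
move=> Lf Lg; apply: (@L2Mbounded _ _ _ (nrm f)) => //; first exact: measurable_prim.
by move=> x _; exact: prim_bound.
Qed.

(** Fubini over the triangle [y <= z]: both sides are the integral of
    [f y * g z]. *)
Lemma ip_prim f g : L2 f -> L2 g ->
  ip f (fun y => ip g (fun z => below z y)) = ip g (prim f).
Proof.
move=> Lf Lg.
have mf := L2_measurable Lf; have mg := L2_measurable Lg.
pose K (yz : measurableTypeR R * measurableTypeR R) : \bar R :=
  (f yz.1 * (g yz.2 * below yz.2 yz.1))%:E.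
have mb : measurable_fun setT
    (fun yz : measurableTypeR R * measurableTypeR R => below yz.2 yz.1).
  rewrite (_ : (fun yz => _) = fun yz => if (yz.1 <= yz.2)%R then 1 else 0).
    by apply: measurable_fun_ifT => //; exact: measurable_fun_ler.
  by apply/funext => yz; rewrite /below; case: (_ <= _)%R.
have mK : measurable_fun setT K.
  apply/measurable_EFinP; apply: measurable_funM; first exact: measurableT_comp.
  by apply: measurable_funM => //; exact: measurableT_comp.
have i1 h : L2 h -> (\int[lam]_z `|h z|%:E < +oo)%E.
  by move=> /L2_integrable /integrableP[_].
have fing : (\int[lam]_z `|g z|%:E)%E \is a fin_num.
  by rewrite ge0_fin_numE ?i1//; exact: integral_ge0.
have iK : (mu01 \x mu01)%E.-integrable setT K.
  apply/(integrable12ltyP mu01 mu01 mK).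
  apply: (@le_lt_trans _ _ (\int[lam]_y (`|f y|%:E * \int[lam]_z `|g z|%:E))%E).
    apply: ge0_le_integral => //.
    - by move=> y _; exact: integral_ge0.
    - apply: (@measurable_fun_fubini_tonelli_F _ _ _ _ _ mu01 (abse \o K)).
        exact: measurableT_comp.
      by move=> ?; exact: abse_ge0.
    - rewrite -(fineK fing); apply: emeasurable_funM => //.
      by apply/measurable_EFinP; exact: measurableT_comp.
    - move=> y _; rewrite -ge0_integralZl//.
      + apply: ge0_le_integral => //.
        * apply: measurableT_comp => //.
          exact: (measurableT_comp mK (pair1_measurable y)).
        * apply: emeasurable_funM => //.
          by apply/measurable_EFinP; exact: measurableT_comp.
        * move=> z _; rewrite -EFinM lee_fin !normrM ler_wpM2l//.
          by rewrite ler_piMr// below_norm.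
      + by apply/measurable_EFinP; exact: measurableT_comp.
  rewrite ge0_integralZr//.
  - by rewrite lte_mul_pinfty// ?integral_ge0// ?i1// ge0_fin_numE ?i1//; exact: integral_ge0.
  - by apply/measurable_EFinP; exact: measurableT_comp.
  - exact: integral_ge0.
have := Fubini iK; rewrite /K /=.
have Lg' y : L2 (fun z => below z y).
  apply: (@L2_bounded _ _ 1); last by move=> z _; exact: below_norm.
  exact: (measurableT_comp mb (pair1_measurable y)).
under eq_integral => y _.
  under eq_integral do rewrite EFinM.
  rewrite integralZl//; last by apply: integrableM_L2.
  rewrite -[X in (_ * X)%E]fineK; last first.
    by apply: integrable_fin_num => //; exact: integrableM_L2.
  rewrite -EFinM.
  over.
under [X in _ = X -> _]eq_integral => z _.
  under eq_integral do rewrite mulrCA EFinM.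
  rewrite integralZl//; last exact: integrableM_L2 (L2_below _).
  rewrite -[X in (_ * X)%E]fineK; last first.
    by apply: integrable_fin_num => //; exact: integrableM_L2 (L2_below _).
  rewrite -EFinM.
  over.
by rewrite /ip /Rintegral => ->.
Qed.

Lemma below_ae x : (fun z => below x z + below z x) = cst 1 %[ae lam].
Proof.
exists [set x]; split => //.
  apply/eqP; rewrite -measure_le0.
  rewrite -[X in (_ <= X)%E](lebesgue_measure_set1 x).
  by apply: le_measure; rewrite ?inE//; exact: measurableI.
move=> z /= /not_implyP[_]; rewrite /below.
by case: (ltgtP z x) => [zx|xz|//] /=; rewrite ?(mulr1n, mulr0n, addr0, add0r) => /(_ erefl).
Qed.

Lemma L2_below_swap y : L2 (fun z => below z y).
Proof.
apply: (@L2_bounded _ _ 1); last by move=> z _; exact: below_norm.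
rewrite (_ : below^~ y = fun z => if (y <= z)%R then 1 else 0).
  by apply: measurable_fun_ifT => //; exact: measurable_fun_ler.
by apply/funext => z; rewrite /below; case: (_ <= _)%R.
Qed.

(** The two triangles below and above the diagonal make up the unit square. *)
Lemma prim_triangle f g : L2 f -> L2 g ->
  ip f (prim g) + ip g (prim f) = ip f (cst 1) * ip g (cst 1).
Proof.
move=> Lf Lg.
have Ls : L2 (fun y => ip f (below^~ y)).
  rewrite (_ : (fun y => _) = fun y => ip f (cst 1) - prim f y).
    by apply: L2B; [exact: L2_cst|exact: L2_prim].
  apply/funext => y; rewrite /prim; have Lb := L2_below y.
  have Lc := L2_cst (1 : R).
  rewrite ![ip f _]ipC -ipBl//.
  apply: eq_ip; try exact: L2_measurable.
  + exact: L2_measurable (L2_below_swap y).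
  + exact: L2_measurable (L2B Lc Lb).
  + by apply: (ae01S (below_ae y)) => z _ h _; rewrite -(h I) /= addrC addKr.
  + exact: ae01.
rewrite -ip_prim// -ipDr//; last exact: L2_prim.
rewrite -(ipZr _ Lg (L2_cst 1)); congr (ip g _); apply/funext => y.
rewrite mulr1 addrC -ipDr//; [|exact: L2_below|exact: L2_below_swap].
apply: eq_ip; try exact: L2_measurable.
- exact: L2_measurable (L2D (L2_below y) (L2_below_swap y)).
- exact: measurable_cst.
- exact: ae01.
- exact: below_ae.
Qed.

(** Cutting [f] and [g] off at [x] turns the product of their primitives at [x]
    into an integral over the unit square, split by [prim_triangle]. *)
Lemma primM f g x : L2 f -> L2 g ->
  prim f x * prim g x = prim (fun y => prim f y * g y + prim g y * f y) x.
Proof.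
move=> Lf Lg.
have Lxf := L2_below_mul x Lf; have Lxg := L2_below_mul x Lg.
have E h : prim h x = ip (fun y => below x y * h y) (cst 1).
  by apply: eq_Rintegral => y _; rewrite mulr1 mulrC.
have bp h y : below x y * prim (fun z => below x z * h z) y = below x y * prim h y.
  rewrite {1 3}/below; have [yx|_] := leP y x; last by rewrite !mul0r.
  rewrite !mul1r; apply: eq_Rintegral => z _; rewrite mulrAC mulrC; congr (_ * _).
  rewrite /below; have [zy|zy] := leP z y; last by rewrite mulr0.
  by rewrite (le_trans zy yx) mulr1.
have F h k : ip (fun y => below x y * h y) (prim (fun z => below x z * k z)) =
    ip (fun y => below x y * h y) (prim k).
  by apply: eq_Rintegral => y _; rewrite mulrAC bp mulrAC.
rewrite !E -prim_triangle// !F [RHS](_ : _ =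
  ip (fun y => prim f y * (below x y * g y) + prim g y * (below x y * f y)) (cst 1)).
  rewrite ipDl; [|exact: L2_mul_prim..|exact: L2_cst].
  rewrite addrC; congr (_ + _); apply: eq_Rintegral => y _;
    by rewrite mulr1 [LHS]mulrC.
by apply: eq_Rintegral => y _; congr (_ * _); ring.
Qed.

(** The absolutely continuous functions on [[0, 1]] whose derivative is the
    square integrable function [f]. *)
Definition ac F f := [/\ measurable_fun setT F, L2 f &
  forall x, 0 <= x <= 1 -> F x = F 0 + prim f x].

Lemma ac_cont F f : ac F f -> {within `[0, 1], continuous F}.
Proof.
case=> mF Lf FE.
apply: (@subspace_eq_continuous _ _ _ (fun x => F 0 + prim f x)).
  by move=> x; rewrite inE /= in_itv => /FE /esym.
apply: continuous_subspaceT => x.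
by apply: cvgD; [exact: cvg_cst|exact: prim_continuous].
Qed.

Lemma ac_bound F f x : ac F f -> 0 < x < 1 -> `|F x| <= `|F 0| + nrm f.
Proof.
move=> [mF Lf FE] /andP[/ltW x0 /ltW x1]; rewrite FE ?x0//.
by rewrite (le_trans (ler_normD _ _))// lerD2l prim_bound.
Qed.

Lemma ac_L2 F f : ac F f -> L2 F.
Proof.
move=> aF; apply: (@L2_bounded _ _ (`|F 0| + nrm f)); first by case: aF.
by move=> x; exact: ac_bound.
Qed.

Lemma ac_mul_L2 F f g : ac F f -> L2 g -> L2 (fun x => F x * g x).
Proof.
move=> aF Lg; apply: (@L2Mbounded _ _ _ (`|F 0| + nrm f)) => //; first by case: aF.
by move=> x; exact: ac_bound.
Qed.

Lemma ac_prim f : L2 f -> ac (prim f) f.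
Proof.
by move=> Lf; split=> //; [exact: measurable_prim|move=> x _; rewrite prim0// add0r].
Qed.

Lemma ac_cst a : ac (cst a) (cst 0).
Proof. by split => //; [exact: L2_cst|move=> x _; rewrite prim_cst0 addr0]. Qed.

Lemma acD F f G g : ac F f -> ac G g ->
  ac (fun x => F x + G x) (fun x => f x + g x).
Proof.
move=> [mF Lf FE] [mG Lg GE]; split; [exact: measurable_funD|exact: L2D|].
by move=> x x01; rewrite FE// GE// primD//; ring.
Qed.

Lemma acZ a F f : ac F f -> ac (fun x => a * F x) (fun x => a * f x).
Proof.
move=> [mF Lf FE]; split; [exact: measurable_funM|exact: L2Z|].
by move=> x x01; rewrite FE// primZ// mulrDr.
Qed.

Lemma acB F f G g : ac F f -> ac G g ->
  ac (fun x => F x - G x) (fun x => f x - g x).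
Proof.
move=> [mF Lf FE] [mG Lg GE]; split; [exact: measurable_funB|exact: L2B|].
by move=> x x01; rewrite FE// GE// primB//; ring.
Qed.

Lemma acM F f G g : ac F f -> ac G g ->
  ac (fun x => F x * G x) (fun x => F x * g x + G x * f x).
Proof.
move=> aF aG; have LFg := ac_mul_L2 aF (let: And3 _ h _ := aG in h).
have LGf := ac_mul_L2 aG (let: And3 _ h _ := aF in h).
move: aF aG => [mF Lf FE] [mG Lg GE]; split.
- exact: measurable_funM.
- exact: L2D.
- move=> x x01.
  have P0 : L2 (fun y => F 0 * g y) by exact: L2Z.
  have Q0 : L2 (fun y => G 0 * f y) by exact: L2Z.
  have P1 := L2_mul_prim Lf Lg; have Q1 := L2_mul_prim Lg Lf.
  rewrite (@eq_prim _ (fun y => (F 0 * g y + G 0 * f y) +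
    (prim f y * g y + prim g y * f y))).
  + rewrite primD; [|exact: L2D..]; rewrite primD// !primZ// -primM// FE// GE//; ring.
  + exact: L2_measurable (L2D LFg LGf).
  + exact: L2_measurable (L2D (L2D P0 Q0) (L2D P1 Q1)).
  + by apply: ae01 => y /andP[/ltW y0 /ltW y1] _; rewrite FE ?y0// GE ?y0//; ring.
Qed.

(** The product rule [acM] evaluated at the end points. *)
Lemma ac_by_parts F f G g : ac F f -> ac G g ->
  ip F g + ip G f = F 1 * G 1 - F 0 * G 0.
Proof.
move=> aF aG; have [_ L E] := acM aF aG; have [_ Lf _] := aF; have [_ Lg _] := aG.
rewrite E ?lexx ?ler01// prim1// addrAC subrr add0r.
rewrite ipDl; [|exact: ac_mul_L2 aF _|exact: ac_mul_L2 aG _|exact: L2_cst].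
by congr (_ + _); apply: eq_Rintegral => y _; rewrite mulr1.
Qed.

End primitives.

(** * Weak derivatives *)
Section weak_derivatives.
Context {R : realType}.
Implicit Types (f g h F G u w phi psi : R -> R) (x y z a M : R).
Local Notation lam := (@leb01 R).
Local Notation mu := (@lebesgue_measure R).

Lemma prim_itv f x : L2 f -> 0 <= x <= 1 ->
  prim f x = \int[mu]_(t in `]0, x[) f t.
Proof.
move=> Lf /andP[x0 x1]; have mf := L2_measurable Lf.
have mfb := L2_measurable (L2_below_mul x Lf).
rewrite /prim ipC /ip /Rintegral integral_leb01//; congr fine.
rewrite [LHS]integral_mkcond [RHS]integral_mkcond; apply: ae_eq_integral => //.
- apply/(measurable_restrictT _ _).1 => //.
  by apply/measurable_EFinP; exact: measurable_funTS.
- apply/(measurable_restrictT _ _).1 => //.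
  by apply/measurable_EFinP; exact: measurable_funTS.
exists [set x]; split => //; first exact: lebesgue_measure_set1.
move=> t /= /not_implyP[_]; rewrite !patchE !mem_setE !in_itv /= /below.
case: (ltgtP t x) => [tx|xt|//]; rewrite ?(andbT, andbF) ?mul1r ?mul0r.
  by rewrite (lt_le_trans tx x1) andbT => /(_ erefl).
by case: ifP => _ /(_ erefl).
Qed.

Lemma prim_cst1 x : 0 <= x <= 1 -> prim (cst 1) x = x.
Proof.
move=> /andP[x0 x1]; rewrite prim_itv ?x0//; last exact: L2_cst.
rewrite /cst Rintegral_cst// mul1r.
apply: etrans (congr1 fine (@lebesgue_measure_itv R `]0, x[)) _; rewrite /= lte_fin.
have [_ /=|x0'] := ltP 0 x; first by rewrite subr0.
by apply/eqP; rewrite eq_le x0.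
Qed.

Lemma primE f x : L2 f ->
  prim f x = \int[mu]_(t in `]-oo, x]) (f \_ `]0, 1[) t.
Proof.
move=> Lf; have mf := L2_measurable Lf.
have mfb := L2_measurable (L2_below_mul x Lf).
rewrite /prim ipC /ip /Rintegral integral_leb01//; congr fine.
rewrite [LHS]integral_mkcond [RHS]integral_mkcond.
apply: eq_integral => t _; rewrite !patchE !mem_setE !in_itv /= /below.
case: (leP t x) => [tx|xt] /=; rewrite ?mul1r ?mul0r; last by case: ifP.
by case: ifP.
Qed.

Lemma integrable_restrict01 f (D : set R) : L2 f -> measurable D ->
  mu.-integrable D (EFin \o (f \_ `]0, 1[)).
Proof.
move=> Lf mD; apply: (@integrableS _ _ _ _ setT) => //.
rewrite -restrict_EFin; apply/(integrable_restrict _ _ _ _).1 => //.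
rewrite setTI; have mf := L2_measurable Lf.
apply/integrableP; split.
  by apply/measurable_EFinP; exact: measurable_funTS.
have /integrableP[_] := L2_integrable Lf; apply: le_lt_trans.
under [leRHS]eq_integral do rewrite -[(EFin \o f) _]/((f _)%:E) abse_EFin.
by rewrite integral_leb01//; exact: measurableT_comp.
Qed.

Lemma prim_derivable f x : L2 f -> {for x, continuous (f \_ `]0, 1[)} ->
  derivable (prim f) x 1 /\ derive1 (prim f) x = (f \_ `]0, 1[) x.
Proof.
move=> Lf cf; have x1 : x < x + 1 by rewrite ltrDl.
rewrite (_ : prim f = fun y => \int[mu]_(t in `]-oo, y]) (f \_ `]0, 1[) t); last first.
  by apply/funext => y; exact: primE.
apply: (continuous_FTC1 x1) => //; [exact: integrable_restrict01|exact: ltNyr].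
Qed.

Lemma ae_leb01 (P : R -> Prop) : {ae mu, forall x, P x} -> {ae lam, forall x, P x}.
Proof.
move=> [N [mN N0 NP]]; exists N; split => //.
apply/eqP; rewrite -measure_le0 -[X in (_ <= X)%E]N0.
by apply: le_measure; rewrite ?inE//; exact: measurableI.
Qed.

(** By the Lebesgue differentiation theorem, a square integrable function is
    determined by its primitive. *)
Lemma prim_eq0 f : L2 f -> (forall x, 0 <= x <= 1 -> prim f x = 0) ->
  f = cst 0 %[ae lam].
Proof.
move=> Lf f0.
have L : locally_integrable setT (f \_ `]0, 1[).
  apply: integrable_locally_restrict => //; apply/(integrable_mkcond _ _).2 => //.
  by rewrite restrict_EFin; exact: integrable_restrict01.
have E : (fun y => \int[mu]_(t in `]-oo, y]) (f \_ `]0, 1[) t) = prim f.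
  by apply/funext => y; rewrite -primE.
have /= := FTC1Ny (fun y => integrable_restrict01 Lf (measurable_itv _)) L.
rewrite E => /ae_leb01 /ae01S; apply => x x01 [_ + _].
rewrite patchE mem_set ?in_itv//= => <-.
rewrite derive1E (near_eq_derive (g := cst 0)) ?derive_cst//.
have : x \in `]0, 1[ by rewrite in_itv.
move=> /near_in_itvoo; apply: filterS => y /=; rewrite in_itv /= => /andP[y0 y1].
by rewrite f0// !ltW.
Qed.

(** The fundamental theorem of calculus, for an integral over the open interval. *)
Lemma ac_C1 F : (forall x, derivable F x 1) -> continuous (derive1 F) ->
  ac F (derive1 F).
Proof.
move=> dF cF.
have cF0 : continuous F by move=> x; exact/differentiable_continuous/derivable1_diffP.
have cwF : {within `[0, 1], continuous (fun x => `|derive1 F x|)}.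
  apply: continuous_subspaceT => x.
  by apply: (continuous_comp (cF x)); exact: norm_continuous.
have [M _ FM] := EVT_max ler01 cwF.
have mF : measurable_fun setT (derive1 F) by exact: continuous_measurable_fun.
have LF : L2 (derive1 F).
  apply: (@L2_bounded _ _ (`|derive1 F M|)) => // x /andP[/ltW x0 /ltW x1].
  by apply: FM; rewrite in_itv /= x0.
split => //; first exact: continuous_measurable_fun.
move=> x /andP[]; rewrite le_eqVlt => /predU1P[<- _|x0 x1].
  by rewrite prim0// addr0.
have iF : mu.-integrable `[0, x]%classic (EFin \o derive1 F).
  apply: continuous_compact_integrable; first exact: segment_compact.
  exact: continuous_subspaceT.
have iF1 b0 b1 : mu.-integrable [set` Interval (BSide b0 0) (BSide b1 x)]
    (EFin \o derive1 F).
  apply: (integrableS _ _ _ iF) => //; apply: subset_itv.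
    by case: b0; rewrite bnd_simp.
  by case: b1; rewrite bnd_simp.
rewrite prim_itv ?(ltW x0)// Rintegral_itv_bndo_bndc ?Rintegral_itv_obnd_cbnd//.
rewrite /Rintegral (@continuous_FTC2 _ (derive1 F) F 0 x x0) /=.
- by rewrite addrCA subrr addr0.
- exact: continuous_subspaceT.
- split => //.
  + by apply: cvg_at_right_filter; exact: cF0.
  + by apply: cvg_at_left_filter; exact: cF0.
- by [].
Qed.

Lemma test_ac phi : test_function phi -> ac phi (derive1 phi).
Proof. by move=> [dphi cphi _]; apply: ac_C1 dphi cphi. Qed.

Lemma test_ends phi : test_function phi -> phi 0 = 0 /\ phi 1 = 0.
Proof.
case=> _ _ [al [be [a0 b1 out]]]; split; apply: out; rewrite in_itv /=.
- by rewrite leNgt a0.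
- by rewrite negb_and -!ltNge b1 orbT.
Qed.

Lemma ac_weak_derivative u F f : measurable_fun setT u -> ac F f ->
  u = F %[ae lam] -> is_weak_derivative u f.
Proof.
move=> mu_ aF uF phi tphi; have aphi := test_ac tphi.
have := ac_by_parts aF aphi; have [-> ->] := test_ends tphi.
rewrite !mulr0 subr0 => /eqP; rewrite addr_eq0 => /eqP.
have [mF Lf _] := aF; have [mphi Lphi' _] := aphi.
rewrite (ipC phi) => <-; apply: eq_ip => //; try exact: L2_measurable.
exact: ae01.
Qed.

Definition bump psi := continuous psi /\ exists alpha beta : R,
  [/\ 0 < alpha, beta < 1 & forall x, x \notin `[alpha, beta] -> psi x = 0].

Lemma bump_L2 psi : bump psi -> L2 psi.
Proof.
move=> [cpsi _].
have cwF : {within `[0, 1], continuous (fun x => `|psi x|)}.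
  apply: continuous_subspaceT => x.
  by apply: (continuous_comp (cpsi x)); exact: norm_continuous.
have [M _ FM] := EVT_max ler01 cwF.
apply: (@L2_bounded _ _ (`|psi M|)); first exact: continuous_measurable_fun.
by move=> x /andP[/ltW x0 /ltW x1]; apply: FM; rewrite in_itv /= x0.
Qed.

(** As [psi] has zero mean, its primitive vanishes on the right of its support
    as well as on the left. *)
Lemma bump_test psi : bump psi -> ip psi (cst 1) = 0 ->
  test_function (prim psi) /\ derive1 (prim psi) = psi.
Proof.
move=> bpsi psi0; have Lpsi := bump_L2 bpsi.
have [cpsi [al [be [a0 b1 out]]]] := bpsi.
have E : psi \_ `]0, 1[ = psi.
  apply/funext => x; rewrite patchE mem_setE in_itv /=.
  case: ifPn => // /negP x01; apply/esym/out; rewrite in_itv /=.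
  apply/negP => /andP[ax xb]; apply: x01.
  by rewrite (lt_le_trans a0 ax) (le_lt_trans xb b1).
have D x : derivable (prim psi) x 1 /\ derive1 (prim psi) x = psi x.
  by have := @prim_derivable psi x Lpsi; rewrite E; apply; exact: cpsi.
have D1 : derive1 (prim psi) = psi by apply/funext => x; exact: (D x).2.
split; last by [].
split; [by move=> x; exact: (D x).1|by rewrite D1|].
exists al, be; split => // x; rewrite in_itv /= negb_and -!ltNge => /orP[xa|bx].
- rewrite -(ip0l (cst 1)) /prim; apply: eq_Rintegral => z _.
  rewrite mulr1 /below; have [zx|_] := leP z x; last by rewrite mulr0.
  by rewrite mulr1 out// in_itv /= negb_and -ltNge (le_lt_trans zx xa).
- rewrite -[RHS]psi0 /prim; apply: eq_Rintegral => z _.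
  rewrite mulr1 /below; have [zx|xz] := leP z x; first by rewrite mulr1.
  by rewrite out ?mul0r// in_itv /= negb_and -!ltNge (lt_trans bx xz) orbT.
Qed.

Lemma bump_lin a psi1 b psi2 : bump psi1 -> bump psi2 ->
  bump (fun x => a * psi1 x - b * psi2 x).
Proof.
move=> [c1 [a1 [b1 [a10 b11 o1]]]] [c2 [a2 [b2 [a20 b21 o2]]]]; split.
  move=> x; apply: cvgB; apply: cvgM; [exact: cvg_cst|exact: c1|exact: cvg_cst|exact: c2].
exists (Num.min a1 a2), (Num.max b1 b2); split.
- by rewrite lt_min a10.
- by rewrite gt_max b11.
- move=> x; rewrite in_itv /= ge_min le_max => /negP h.
  rewrite o1 ?o2 ?mulr0 ?subr0// in_itv /=; apply/negP => /andP[h1 h2]; apply: h.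
    by rewrite h1 h2 !orbT.
  by rewrite h1 h2.
Qed.

(** Continuous approximations, from below, of the indicator of [[al, be]]. *)
Definition trapezoid (al be : R) (n : nat) x :=
  Num.min 1 (n%:R * Num.max 0 (Num.min (x - al) (be - x))).

Lemma bump_trapezoid al be n : 0 < al -> be < 1 -> bump (trapezoid al be n).
Proof.
move=> a0 b1; split.
  move=> x.
  apply: (@continuous_min R R (cst 1)
    (fun x => n%:R * Num.max 0 (Num.min (x - al) (be - x)))); first exact: cvg_cst.
  apply: cvgM; first exact: cvg_cst.
  apply: (@continuous_max R R (cst 0)
    (fun x => Num.min (x - al) (be - x))); first exact: cvg_cst.
  apply: (@continuous_min R R (fun x => x - al) (fun x => be - x));
    by apply: cvgB; [exact: cvg_id || exact: cvg_cst|exact: cvg_id || exact: cvg_cst].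
exists al, be; split => // x; rewrite in_itv /= negb_and -!ltNge => h.
rewrite /trapezoid (_ : Num.max 0 (Num.min (x - al) (be - x)) = 0).
  by rewrite mulr0 min_r.
apply/max_idPl; rewrite ge_min !subr_le0.
by case/orP : h => /ltW ->; rewrite ?orbT.
Qed.

Lemma trapezoid_bound al be n x : `|trapezoid al be n x| <= 1.
Proof.
rewrite ger0_norm; first by rewrite /trapezoid ge_min lexx.
by rewrite /trapezoid le_min ler01 mulr_ge0// le_max lexx.
Qed.

Lemma trapezoid_cvg al be x : al < be -> x != al -> x != be ->
  trapezoid al be n x @[n --> \oo] --> below be x - below al x.
Proof.
move=> ab xa xb; set m := Num.max 0 (Num.min (x - al) (be - x)).
have [m0|m0] := ltrP 0 m.
  move: (m0); rewrite /m lt_max ltxx /= lt_min !subr_gt0 => /andP[ax xb'].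
  rewrite /below (ltW xb') leNgt ax /= subr0.
  apply: cvg_near_cst; near=> n.
  rewrite /trapezoid -/m; apply/min_idPl.
  rewrite -ler_pdivrMr// mul1r.
  by near: n; exact: nbhs_infty_ger.
have -> : below be x - below al x = 0.
  move: m0; rewrite /m ge_max lexx /= ge_min !subr_le0 /below.
  case/orP => [xa'|bx].
    by rewrite xa' (le_trans xa' (ltW ab)) subrr.
  rewrite leNgt lt_neqAle eq_sym xb bx /=.
  by rewrite leNgt (lt_le_trans ab bx) subrr.
apply: cvg_near_cst; apply: nearW => n.
have -> : trapezoid al be n x = Num.min 1 (n%:R * m) by [].
have -> : m = 0 by apply/eqP; rewrite eq_le m0 /m le_max lexx.
by rewrite mulr0 min_r.
Unshelve. all: by end_near. Qed.

Lemma cvg_ip f (psi_ : nat -> R -> R) psi : L2 f ->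
  (forall n, measurable_fun setT (psi_ n)) -> measurable_fun setT psi ->
  (forall n x, `|psi_ n x| <= 1) ->
  {ae lam, forall x, psi_ n x @[n --> \oo] --> psi x} ->
  ip f (psi_ n) @[n --> \oo] --> ip f psi.
Proof.
move=> Lf mpsi_ mpsi b cv; have mf := L2_measurable Lf.
have /integrable_abse fi := L2_integrable Lf.
have [] := @dominated_convergence _ _ _ lam setT measurableT
  (fun n x => (f x * psi_ n x)%:E) (fun x => (f x * psi x)%:E)
  (abse \o (EFin \o f)) _ _ _ fi _.
- move=> n; apply/measurable_EFinP.
  exact: (measurable_funM mf (mpsi_ n)).
- by apply/measurable_EFinP; exact: measurable_funM.
- apply: (ae01S cv) => x _ cx _; apply: cvg_EFin; first exact: nearW.
  by apply: cvgM; [exact: cvg_cst|exact: cx].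
- apply: ae01 => x _ n _ /=; rewrite lee_fin normrM ler_piMr//.
move=> ifp _ cvi.
apply: (@fine_cvg _ _ _ _ (fun n => \int[lam]_x (f x * psi_ n x)%:E)%E).
by rewrite /ip /Rintegral fineK//; exact: integrable_fin_num.
Qed.

Lemma ae_neq a : {ae lam, forall x, x != a}.
Proof.
apply: ae_leb01; exists [set a]; split => //; first exact: lebesgue_measure_set1.
by move=> x /= /negP; rewrite negbK => /eqP.
Qed.

Lemma trapezoid_ip f al be : L2 f -> 0 < al -> al < be -> be < 1 ->
  ip f (trapezoid al be n) @[n --> \oo] --> prim f be - prim f al.
Proof.
move=> Lf a0 ab b1; have La := L2_below al; have Lb := L2_below be.
have -> : prim f be - prim f al = ip f (fun x => below be x - below al x).
  by rewrite /prim ![ip f _]ipC ipBl.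
apply: cvg_ip => //.
- by move=> n; exact: continuous_measurable_fun (bump_trapezoid n a0 b1).1.
- exact: L2_measurable (L2B Lb La).
- by move=> n x; exact: trapezoid_bound.
- by apply: (ae01S2 (ae_neq al) (ae_neq be)) => x _ xa xb; exact: trapezoid_cvg.
Qed.

(** A combination with zero mean of two continuous functions is the derivative
    of a test function, so that [f] integrates the two functions in proportion
    to their own integrals.  Approximating the indicators of intervals by such
    functions, the integrals of [f] over intervals are proportional to the
    lengths; hence the primitive of [f - m] is constant, and null at 0. *)
Lemma du_Bois_Reymond f : L2 f ->
  (forall phi, test_function phi -> ip f (derive1 phi) = 0) ->
  exists m, f = cst m %[ae lam].
Proof.
move=> Lf f_orth.
have prop psi1 psi2 : bump psi1 -> bump psi2 ->
    ip f psi1 * ip (cst 1) psi2 = ip f psi2 * ip (cst 1) psi1.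
  move=> b1 b2; have L1 := bump_L2 b1; have L2 := bump_L2 b2.
  have Lc := L2_cst (1 : R).
  have Z1 c : Defs.L2 (fun x => c * psi1 x) by exact: L2Z.
  have Z2 c : Defs.L2 (fun x => c * psi2 x) by exact: L2Z.
  have b := bump_lin (ip (cst 1) psi2) (ip (cst 1) psi1) b1 b2.
  have [|t d] := bump_test b.
    by rewrite ipBl// !ipZl// !(ipC _ (cst 1)) mulrC subrr.
  have := f_orth _ t; rewrite d ipC ipBl// !ipZl// !(ipC _ f).
  by move=> /eqP; rewrite subr_eq0 mulrC => /eqP ->; rewrite mulrC.
have lin al be al' be' : 0 < al -> al < be -> be < 1 ->
    0 < al' -> al' < be' -> be' < 1 ->
  (prim f be - prim f al) * (be' - al') = (prim f be' - prim f al') * (be - al).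
  move=> a0 ab b1 a0' ab' b1'.
  have L1 := L2_cst (1 : R).
  have E x y : 0 < x -> x < y -> y < 1 ->
      y - x = prim (cst 1) y - prim (cst 1) x.
    by move=> x0 xy y1; rewrite !prim_cst1// !ltW//=; apply: lt_trans; eassumption.
  rewrite (E al be)// (E al' be')//.
  have c1 := trapezoid_ip Lf a0 ab b1; have c2 := trapezoid_ip L1 a0' ab' b1'.
  have c3 := trapezoid_ip Lf a0' ab' b1'; have c4 := trapezoid_ip L1 a0 ab b1.
  have c12 : ip f (trapezoid al be n) * ip (cst 1) (trapezoid al' be' n)
      @[n --> \oo] --> (prim f be - prim f al) *
                       (prim (cst 1) be' - prim (cst 1) al') by exact: cvgM.
  have c34 : ip f (trapezoid al be n) * ip (cst 1) (trapezoid al' be' n)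
      @[n --> \oo] --> (prim f be' - prim f al') *
                       (prim (cst 1) be - prim (cst 1) al).
    rewrite (_ : (fun n => _) = fun n =>
      ip f (trapezoid al' be' n) * ip (cst 1) (trapezoid al be n)).
      exact: cvgM.
    by apply/funext => n; apply: prop; exact: bump_trapezoid.
  exact: (cvg_unique (@norm_hausdorff _ R) c12 c34).
(* The mean of [f] over the interval from 1/4 to 3/4. *)
pose m := 2 * (prim f (3/4) - prim f (1/4)); exists m.
have Lm := L2_cst m; have Lfm := L2B Lf Lm.
have const x y : 0 < x -> x < y -> y < 1 ->
    prim (fun z => f z - cst m z) x = prim (fun z => f z - cst m z) y.
  move=> x0 xy y1; rewrite !primB//.
  have := @lin x y (1/4) (3/4) x0 xy y1.
  rewrite (_ : 3 / 4 - 1 / 4 = 1 / 2 :> R); last by lra.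
  move=> /(_ _ _ _) E.
  have {}E : (prim f y - prim f x) * (1 / 2) =
    (prim f (3 / 4) - prim f (1 / 4)) * (y - x) by apply: E; lra.
  have P z : 0 < z -> z < 1 -> prim (cst m) z = m * z.
    move=> z0 z1; have z01 : 0 <= z <= 1 by rewrite !ltW.
    rewrite -[in RHS](prim_cst1 z01) -primZ; last exact: L2_cst.
    by apply: eq_Rintegral => t _; rewrite mulr1.
  rewrite !P//; try lra.
  rewrite /m; lra.
have : (fun z => f z - cst m z) = cst 0 %[ae lam].
  apply: prim_eq0 => //.
  set e := (fun z => f z - cst m z) in Lfm const *.
  have c12 : prim e (1/2) = 0.
    have c : prim e x @[x --> 0^'+] --> prim e 0.
      by apply: cvg_at_right_filter; exact: prim_continuous.
    rewrite prim0// in c.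
    apply/esym/(cvg_unique (@norm_hausdorff _ R) c); apply: cvg_near_cst.
    near=> x; apply: const; last by lra.
    - by near: x; exact: nbhs_right_gt.
    - by near: x; apply: nbhs_right_lt; lra.
  have mid x : 0 < x -> x < 1 -> prim e x = 0.
    move=> x0 x1; have [xh|xh|->//] := ltgtP x (1/2).
      by rewrite (const _ _ x0 xh)//; lra.
    by rewrite -c12; apply/esym/const => //; lra.
  move=> x /andP[x0 x1].
  move: x0; rewrite le_eqVlt => /predU1P[<-|x0]; first by rewrite prim0.
  move: x1; rewrite le_eqVlt => /predU1P[->|x1]; last exact: mid.
  have c : prim e x @[x --> 1^'-] --> prim e 1.
    by apply: cvg_at_left_filter; exact: prim_continuous.
  apply: (cvg_unique (@norm_hausdorff _ R) c); apply: cvg_near_cst.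
  near=> y; apply: mid.
  - by near: y; apply: nbhs_left_gt.
  - by near: y; exact: nbhs_left_lt.
by move=> /ae01S; apply => x _ h _; have /eqP := h I; rewrite subr_eq0 => /eqP.
Unshelve. all: by end_near. Qed.

End weak_derivatives.

(** * Representatives of Sobolev functions *)
Section sobolev_spaces.
Context {R : realType}.
Implicit Types (f g h F G u w phi psi : R -> R) (x y z a M : R).
Local Notation lam := (@leb01 R).
Local Notation mu := (@lebesgue_measure R).

Lemma aeq_sym f g : f = g %[ae lam] -> g = f %[ae lam].
Proof. by move=> /ae01S; apply=> x _ h /h ->. Qed.

Lemma aeq_trans f g h : f = g %[ae lam] -> g = h %[ae lam] -> f = h %[ae lam].
Proof. by move=> fg gh; apply: (ae01S2 fg gh) => x _ h1 h2 X; rewrite h1// h2. Qed.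

Lemma aeq_refl f : f = f %[ae lam].
Proof. exact: ae01. Qed.

Lemma ae_dense (P : R -> Prop) a b : {ae lam, forall x, P x} -> 0 <= a -> a < b ->
  b <= 1 -> exists2 z, a < z < b & P z.
Proof.
move=> [N [mN N0 NP]] a0 ab b1; apply: contrapT => nex.
have sub : `]a, b[%classic `<=` N.
  move=> z /=; rewrite in_itv /= => zab; apply: NP => Pz.
  by apply: nex; exists z.
have : (lam `]a, b[%classic <= lam N)%E by apply: le_measure; rewrite ?inE.
rewrite N0 {1}/leb01 /= /mrestr setIidl; last first.
  move=> z /=; rewrite !in_itv /= => /andP[az zb].
  by rewrite (le_lt_trans a0 az) (lt_le_trans zb b1).
rewrite leNgt => /negP; apply.
apply: (@lt_le_trans _ _ (b - a)%:E); first by rewrite lte_fin subr_gt0.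
rewrite le_eqVlt; apply/orP; left; apply/eqP/esym.
apply: etrans (@lebesgue_measure_itv R `]a, b[) _.
by rewrite /= lte_fin ab EFinB.
Qed.

(** A set of full measure is dense. *)
Lemma continuous_aeq F G : {within `[0, 1], continuous F} ->
  {within `[0, 1], continuous G} -> F = G %[ae lam] ->
  forall x, 0 <= x <= 1 -> F x = G x.
Proof.
move=> /subspace_continuousP cF /subspace_continuousP cG FG x x01.
have xA : `[0, 1]%classic x by rewrite /= in_itv.
apply/eqP; rewrite -subr_eq0; apply/negPn/negP => ne0.
have c : F y - G y @[y --> within `[0, 1]%classic (nbhs x)] --> F x - G x.
  by apply: cvgB; [exact: cF|exact: cG].
have [d /= d0 H] := cvgr_neq0 _ c ne0.
have [|||z /andP[z1 z2] Pz] := ae_dense (a := Num.max 0 (x - d))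
    (b := Num.min 1 (x + d)) FG.
- by rewrite le_max lexx.
- rewrite gt_max !lt_min; move/andP : x01 => [x0 x1].
  by rewrite -!andbA; apply/and4P; split; lra.
- by rewrite ge_min lexx.
move: z1 z2; rewrite gt_max lt_min => /andP[z0 zd] /andP[z1 zd'].
have /= := H z; rewrite Pz// subrr eqxx => /(_ _ _) h.
suff : false by [].
apply: h; first by rewrite ltr_norml; apply/andP; split; lra.
by rewrite in_itv /= !ltW.
Qed.

Lemma wD_spec u : H1 u -> L2 (wD u) /\ is_weak_derivative u (wD u).
Proof. by case=> _ [w hw]; apply: (@xgetPex _ (cst 0) [set w | L2 w /\ is_weak_derivative u w]); exists w. Qed.

Lemma acE F f g : ac F f -> f = g -> ac F g. Proof. by move=> aF <-. Qed.

(** The difference of [u] and the primitive of its weak derivative is orthogonal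
    to the derivatives of the test functions. *)
Lemma H1_ac u : H1 u -> exists2 F, ac F (wD u) & u = F %[ae lam].
Proof.
move=> Hu; have [Lw Dw] := wD_spec Hu; have [Lu _] := Hu.
have Lp := L2_prim Lw; have Ld := L2B Lu Lp.
have [phi tphi|m um] := du_Bois_Reymond Ld.
  have aphi := test_ac tphi; have [mphi Lphi' _] := aphi.
  rewrite ipBl//; have := ac_by_parts (ac_prim Lw) aphi.
  have [-> ->] := test_ends tphi; rewrite !mulr0 subr0 => /eqP.
  rewrite addr_eq0 => /eqP ->.
  have := Dw _ tphi; rewrite -/(ip _ _) -/(ip _ _) => ->.
  by rewrite (ipC phi) subrr.
exists (fun x => m + prim (wD u) x).
  apply: acE (acD (ac_cst m) (ac_prim Lw)) _.
  by apply/funext => x; rewrite add0r.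
by move: um => /ae01S; apply => x _ h _; have /eqP := h I; rewrite subr_eq => /eqP.
Qed.

Lemma ac_aeq F f G g : ac F f -> ac G g -> F = G %[ae lam] -> f = g %[ae lam].
Proof.
move=> aF aG FG; have E := continuous_aeq (ac_cont aF) (ac_cont aG) FG.
have [_ Lf FE] := aF; have [_ Lg GE] := aG.
have : (fun x => f x - g x) = cst 0 %[ae lam].
  apply: prim_eq0; first exact: L2B.
  move=> x x01; rewrite primB//; have := E x x01; rewrite FE// GE//.
  by rewrite E ?lexx ?ler01// => /addrI ->; rewrite subrr.
by move=> /ae01S; apply=> x _ h _; have /eqP := h I; rewrite subr_eq0 => /eqP.
Qed.

(** The means to compute [wD] and [crep], which are defined by choice: both can
    be read off from any absolutely continuous representative of [u]. *)
Lemma ac_H1 u F f : L2 u -> ac F f -> u = F %[ae lam] ->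
  [/\ H1 u, wD u = f %[ae lam] & forall x, 0 <= x <= 1 -> crep u x = F x].
Proof.
move=> Lu aF uF; have [mF Lf _] := aF.
have Hu : H1 u.
  split => //; exists f; split => //.
  exact: (ac_weak_derivative (L2_measurable Lu) aF uF).
split => //.
  have [G aG uG] := H1_ac Hu.
  apply: ac_aeq aG aF _; exact: aeq_trans (aeq_sym uG) uF.
have [cc uc] : {within `[0, 1], continuous (crep u)} /\ u = crep u %[ae lam].
  apply: (@xgetPex _ (cst 0) [set g : R -> R |
    {within `[0, 1], continuous g} /\ u = g %[ae leb01]]).
  by exists F; split => //; exact: ac_cont aF.
apply: continuous_aeq => //; first exact: ac_cont aF.
exact: aeq_trans (aeq_sym uc) uF.
Qed.

Lemma H1_crep u : H1 u -> exists F, [/\ ac F (wD u), u = F %[ae lam] &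
  forall x, 0 <= x <= 1 -> crep u x = F x].
Proof.
move=> Hu; have [F aF uF] := H1_ac Hu; exists F; split => //.
by have [Lu _] := Hu; have [] := ac_H1 Lu aF uF.
Qed.

Lemma H1_aeq u v : L2 v -> H1 u -> u = v %[ae lam] ->
  [/\ H1 v, wD v = wD u %[ae lam] & forall x, 0 <= x <= 1 -> crep v x = crep u x].
Proof.
move=> Lv Hu uv; have [F [aF uF cF]] := H1_crep Hu.
have [H E c] := ac_H1 Lv aF (aeq_trans (aeq_sym uv) uF).
by split => // x x01; rewrite c// cF.
Qed.

Lemma ac_exp k : ac (fun x => expR (k * x)) (fun x => k * expR (k * x)).
Proof.
have D (x : R) : is_derive x 1 (fun x => expR (k * x)) (k * expR (k * x)).
  have h1 : is_derive x 1 (fun x => k * x) (k *: 1) by exact: is_deriveZ.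
  apply: is_derive_eq (@is_derive1_comp _ expR (fun x => k * x) x _ _ (is_derive_expR _) h1) _.
  by rewrite [k%:A]mulr1 mulrC.
have E : derive1 (fun x => expR (k * x)) = (fun x => k * expR (k * x)).
  by apply/funext => x; rewrite derive1E derive_val.
have cE (x : R) : {for x, continuous (fun x : R => expR (k * x))}.
  apply: (continuous_comp (f := fun x => k * x)); last exact: continuous_expR.
  by apply: cvgM; [exact: cvg_cst|exact: cvg_id].
rewrite -E; apply: ac_C1 => x; first exact: ex_derive.
by rewrite E; apply: cvgM; [exact: cvg_cst|exact: cE].
Qed.

(** The integral of the derivative of [expR (k * x) * F x ^+ 2]. *)
Lemma ip_exp k F f : ac F f -> 2 * ip (fun x => expR (k * x) * F x) f =
  expR k * F 1 ^+ 2 - F 0 ^+ 2 - k * ip (fun x => expR (k * x) * F x) F.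
Proof.
move=> aF; have [_ Lf _] := aF; have LF := ac_L2 aF; have ae := ac_exp k.
have L1 := ac_mul_L2 ae Lf; have L2 := ac_mul_L2 ae LF.
have := ac_by_parts (acM ae aF) aF; rewrite mulr0 mulr1 expR0.
have [_ Lk _] := ae; have L3 := ac_mul_L2 aF Lk.
rewrite [ip F _]ipC (ipDl L1 L3 LF).
have -> : ip (fun x => expR (k * x) * f x) F = ip (fun x => expR (k * x) * F x) f.
  by apply: eq_Rintegral => x _; rewrite mulrAC.
have -> : ip (fun x => F x * (k * expR (k * x))) F = k * ip (fun x => expR (k * x) * F x) F.
  by rewrite -ipZl//; apply: eq_Rintegral => x _; ring.
do 2 move: (ip _ _) => ?; lra.
Qed.

Lemma prim_sqr f x : L2 f -> prim f x ^+ 2 <= ip f f.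
Proof.
move=> Lf; rewrite -nrm_sqr -real_normK ?num_real// ler_pXn2r// ?nnegrE ?normr_ge0 ?nrm_ge0//.
exact: prim_bound.
Qed.

Lemma ac_trace F f x : ac F f -> 0 <= x <= 1 -> F x ^+ 2 <= 2 * F 0 ^+ 2 + 2 * ip f f.
Proof.
move=> [_ Lf FE] x01; rewrite FE//; have := prim_sqr x Lf.
have := sqr_ge0 (F 0 - prim f x); nra.
Qed.

Lemma ac_poincare F f : ac F f -> ip F F <= 2 * F 0 ^+ 2 + 2 * ip f f.
Proof.
move=> aF; have LF := ac_L2 aF; set M := (X in _ <= X).
have L1 : L2 (cst (1 : R)) := L2_cst 1.
rewrite -[M]mulr1 -[X in M * X](@prim_cst1 R 1) ?ler01 ?lexx// prim1// -ipZl//.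
apply: le_ip => //; first exact: L2Z.
by move=> x /andP[/ltW x0 /ltW x1]; rewrite -expr2 !mulr1 (ac_trace aF)// x0.
Qed.

Lemma nrm_aeq f g : L2 f -> L2 g -> (nrm (fun x => f x - g x) = 0 <-> f = g %[ae lam]).
Proof.
move=> Lf Lg; have L := L2B Lf Lg; split.
  move=> n0; have E : ip (fun x => f x - g x) (fun x => f x - g x) = 0.
    by rewrite -nrm_sqr n0 expr0n.
  have E2 := ip_eq0 L E.
  by apply: (ae01S E2) => x _ h X; apply/eqP; rewrite -subr_eq0 h.
move=> fg; rewrite /nrm (_ : ip _ _ = 0) ?sqrtr0// -(ip0l (fun x => f x - g x)).
apply: eq_ip; try exact: L2_measurable; try exact: L2_measurable (L2_cst 0).
- by apply: (ae01S fg) => x _ h X; rewrite h// subrr.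
- exact: aeq_refl.
Qed.

End sobolev_spaces.

(** * Linear identities in a module *)
Section linear_identities.
Context {R : pzRingType} {V : lmodType R}.

(** Linear expressions over the vectors of a list.  Two of them are equal as
    soon as their coefficients are, which [ring] or [field] can decide. *)
Inductive lexp : Type :=
  Atom of nat | Zero | Add of lexp & lexp | Opp of lexp | Scale of R & lexp.

Fixpoint leval (s : seq V) (e : lexp) : V :=
  match e with
  | Atom i => s`_i
  | Zero => 0
  | Add e1 e2 => leval s e1 + leval s e2
  | Opp e1 => - leval s e1
  | Scale k e1 => k *: leval s e1
  end.

Fixpoint lcoef (e : lexp) (i : nat) : R :=
  match e with
  | Atom j => if j == i then 1 else 0
  | Zero => 0
  | Add e1 e2 => lcoef e1 i + lcoef e2 i
  | Opp e1 => - lcoef e1 i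
  | Scale k e1 => k * lcoef e1 i
  end.

Lemma levalE s e : leval s e = \sum_(i < size s) lcoef e i *: s`_i.
Proof.
elim: e => [j||e1 IH1 e2 IH2|e IH|k e IH] /=.
- have [js|sj] := ltnP j (size s).
    rewrite (bigD1 (Ordinal js))//= eqxx scale1r big1 ?addr0// => i ij.
    case: eqP => [E|_]; last by rewrite scale0r.
    by move/negP: ij; case; apply/eqP/val_inj.
  rewrite nth_default// big1// => i _.
  case: eqP => [E|_]; last by rewrite scale0r.
  by move: sj; rewrite E leqNgt ltn_ord.
- by rewrite big1// => i _; rewrite scale0r.
- by rewrite IH1 IH2 -big_split; apply: eq_bigr => i _; rewrite scalerDl.
- by rewrite IH -sumrN; apply: eq_bigr => i _; rewrite scaleNr.
- by rewrite IH scaler_sumr; apply: eq_bigr => i _; rewrite scalerA.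
Qed.

Fixpoint lagree (e1 e2 : lexp) (n : nat) : Prop :=
  if n is m.+1 then lcoef e1 m = lcoef e2 m /\ lagree e1 e2 m else True.

Lemma leval_eq s e1 e2 : lagree e1 e2 (size s) -> leval s e1 = leval s e2.
Proof.
move=> h; rewrite !levalE; apply: eq_bigr => i _; congr (_ *: _).
case: i => i /=; elim: (size s) h => // n IH [h hn].
by rewrite ltnS leq_eqVlt => /predU1P[->|]; [|exact: IH].
Qed.

End linear_identities.

Ltac lmod_index x s :=
  lazymatch s with
  | ?y :: ?s' =>
    match constr:(tt) with
    | _ => let _ := match goal with _ => unify x y end in constr:(0%N)
    | _ => let n := lmod_index x s' in constr:(S n)
    end
  end.

Ltac lmod_atoms s t :=
  lazymatch t with
  | (?a + ?b)%R => let s' := lmod_atoms s a in lmod_atoms s' b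
  | (- ?a)%R => lmod_atoms s a
  | (_ *: ?a)%R => lmod_atoms s a
  | 0%R => s
  | _ => match constr:(tt) with
         | _ => let _ := lmod_index t s in s
         | _ => constr:(t :: s)
         end
  end.

Ltac lmod_reify R s t :=
  lazymatch t with
  | (?a + ?b)%R => let e := lmod_reify R s a in let f := lmod_reify R s b in
                   constr:(@Add R e f)
  | (- ?a)%R => let e := lmod_reify R s a in constr:(@Opp R e)
  | (?k *: ?a)%R => let e := lmod_reify R s a in constr:(@Scale R k e)
  | 0%R => constr:(@Zero R)
  | _ => let n := lmod_index t s in constr:(@Atom R n)
  end.

(** Reduces an equality of linear combinations in the module [V] over [R] to the
    equalities of the coefficients. *)
Ltac lmod_with R V :=
  cbv beta;
  lazymatch goal with
  | |- ?a = ?b =>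
    let s0 := lmod_atoms constr:(@nil V) a in
    let s := lmod_atoms s0 b in
    let e := lmod_reify R s a in
    let f := lmod_reify R s b in
    apply: (@leval_eq R V s e f) => /=; repeat split
  end.

(** * Semi-Hilbert spaces *)
(** The form may be degenerate.  Completeness is asked of rapidly convergent
    sequences only, and with any constant in the rate of convergence to the
    limit; [sn_complete] recovers the natural one. *)
Record semi_hilbert (R : realType) (V : lmodType R) := SemiHilbert {
  form :> V -> V -> R;
  formC : forall x y, form x y = form y x;
  formDl : forall x y z, form (x + y) z = form x z + form y z;
  formZl : forall k x y, form (k *: x) y = k * form x y;
  form_ge0 : forall x, 0 <= form x x;
  form_complete : forall (x_ : nat -> V) (C : R), 0 <= C ->
    (forall n, form (x_ n.+1 - x_ n) (x_ n.+1 - x_ n) <= (C / 2 ^+ n) ^+ 2) ->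
    exists x C', forall n, form (x - x_ n) (x - x_ n) <= (C' / 2 ^+ n) ^+ 2
}.

Lemma le_of_halves {R : realType} (a b C : R) :
  (forall n, a <= b + C / 2 ^+ n) -> a <= b.
Proof.
move=> h; rewrite leNgt; apply/negP => ba.
have ab0 : 0 < a - b by rewrite subr_gt0.
have C0 : 0 < C by have := h 0%N; rewrite expr0 divr1; lra.
have [n nC] : exists n : nat, C / (a - b) < n%:R.
  by exists (Num.bound (C / (a - b))); apply: archi_boundP; rewrite divr_ge0 ?ltW.
have n2 : (n%:R : R) <= 2 ^+ n by rewrite -natrX ler_nat ltnW// ltn_expl.
have := h n; rewrite leNgt => /negP; apply.
have := lt_le_trans nC n2; rewrite ltr_pdivrMr// => H.
rewrite -ltrBrDl ltr_pdivrMr ?exprn_gt0//; first by rewrite mulrC.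
Qed.

Lemma halves_small {R : realType} (C e : R) : 0 < e -> exists n, C / 2 ^+ n <= e.
Proof.
move=> e0; apply: contrapT => /forallNP h; move: e0; rewrite ltNge => /negP; apply.
apply: (@le_of_halves _ _ _ C) => n; rewrite add0r; apply/ltW.
by rewrite ltNge; apply/negP/h.
Qed.

Section semi_hilbert.
Context {R : realType} {V : lmodType R} (H : semi_hilbert V).
Implicit Types (x y z : V) (k h e : R).

Ltac lmod := lmod_with R V.

Lemma formDr x y z : H z (x + y) = H z x + H z y.
Proof. by rewrite formC formDl !(formC _ z). Qed.

Lemma formZr k x y : H x (k *: y) = k * H x y.
Proof. by rewrite formC formZl (formC _ y). Qed.

Lemma formNl x y : H (- x) y = - H x y.
Proof. by rewrite -scaleN1r formZl mulN1r. Qed.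

Lemma formNr x y : H x (- y) = - H x y.
Proof. by rewrite formC formNl formC. Qed.

Definition formE := (formDl, formDr, formNl, formNr, formZl, formZr).

Definition sn x := Num.sqrt (H x x).

Lemma sn_ge0 x : 0 <= sn x. Proof. exact: sqrtr_ge0. Qed.

Lemma sn_sqr x : sn x ^+ 2 = H x x. Proof. by rewrite sqr_sqrtr// form_ge0. Qed.

Lemma form_le x y : `|H x y| <= sn x * sn y.
Proof.
rewrite -sqrtrM ?form_ge0// -sqrtr_sqr ler_wsqrtr//.
apply: discriminant_le0; first exact: form_ge0.
move=> t; have := form_ge0 H (x + t *: y).
by rewrite !formE (formC H y x); congr (0 <= _); ring.
Qed.

Lemma snD x y : sn (x + y) <= sn x + sn y.
Proof.
rewrite -(@ler_pXn2r _ 2)// ?nnegrE ?addr_ge0 ?sn_ge0//.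
rewrite sn_sqr sqrrD !sn_sqr !formE (formC H y x).
have := le_trans (ler_norm _) (form_le x y).
by rewrite -mulr_natl; lra.
Qed.

Lemma snZ k x : sn (k *: x) = `|k| * sn x.
Proof. by rewrite /sn !formE mulrA -expr2 sqrtrM ?sqr_ge0// sqrtr_sqr. Qed.

Lemma snN x : sn (- x) = sn x.
Proof. by rewrite -scaleN1r snZ normrN1 mul1r. Qed.

Lemma sn0 : sn 0 = 0.
Proof. by rewrite -(scale0r 0) snZ normr0 mul0r. Qed.

Lemma snB x y : sn (x - y) <= sn x + sn y.
Proof. by rewrite (le_trans (snD _ _))// snN. Qed.

Lemma sn_dist x y : sn (x - y) = sn (y - x).
Proof. by rewrite -snN opprB. Qed.

Lemma sn_tri y x z : sn (x - z) <= sn (x - y) + sn (y - z).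
Proof. by rewrite -[x - z](subrKA y) snD. Qed.

Lemma sn_le_dist x y : sn x <= sn y + sn (x - y).
Proof. by rewrite -{1}[x](subrK y) addrC snD// addrC. Qed.

Lemma sn_sum (I : Type) (r : seq I) (F : I -> V) :
  sn (\sum_(i <- r) F i) <= \sum_(i <- r) sn (F i).
Proof.
elim: r => [|i r IH]; first by rewrite !big_nil sn0.
by rewrite !big_cons (le_trans (snD _ _))// lerD2l.
Qed.

Lemma form_sn0 x y : sn x = 0 -> H x y = 0.
Proof.
move=> x0; apply/eqP; rewrite -normr_eq0 eq_le normr_ge0 andbT.
by rewrite (le_trans (form_le x y))// x0 mul0r.
Qed.

Lemma sn_eq0 x : H x x = 0 -> sn x = 0. Proof. by rewrite /sn => ->; rewrite sqrtr0. Qed.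

Lemma sn_le0 x : sn x <= 0 -> sn x = 0.
Proof. by move=> h; apply/eqP; rewrite eq_le h sn_ge0. Qed.

Lemma sn_null0 x y : sn x = 0 -> sn y = 0 -> sn (x + y) = 0.
Proof. by move=> x0 y0; apply: sn_le0; rewrite (le_trans (snD _ _))// x0 y0 addr0. Qed.

Lemma sn_complete (x_ : nat -> V) C : 0 <= C ->
  (forall n, sn (x_ n.+1 - x_ n) <= C / 2 ^+ n) ->
  exists x, forall n, sn (x - x_ n) <= 2 * C / 2 ^+ n.
Proof.
move=> C0 h; have p n (D : R) : 0 <= D -> 0 <= D / 2 ^+ n.
  by move=> D0; rewrite divr_ge0 ?exprn_ge0.
have tail n m : sn (x_ (n + m)%N - x_ n) <= 2 * C / 2 ^+ n - 2 * C / 2 ^+ (n + m).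
  elim: m => [|m IH]; first by rewrite addn0 !subrr sn0.
  apply: le_trans (sn_tri (x_ (n + m)%N) _ _) _; rewrite addnS.
  apply: le_trans (lerD (h _) IH) _; rewrite exprS le_eqVlt; apply/orP; left.
  by apply/eqP; field; rewrite !expf_neq0// pnatr_eq0.
have [|x [C' xP]] := @form_complete _ _ H x_ C C0.
  by move=> n; rewrite -sn_sqr lerXn2r ?nnegrE ?sn_ge0 ?p.
exists x => n; apply: (@le_of_halves _ _ _ `|C'|) => m.
have xm : sn (x - x_ (n + m)%N) <= `|C'| / 2 ^+ m.
  apply: (@le_trans _ _ (`|C'| / 2 ^+ (n + m))).
    rewrite -(@ler_pXn2r _ 2)// ?nnegrE ?sn_ge0 ?p// sn_sqr.
    by apply: le_trans (xP _) _; rewrite !exprMn real_normK// num_real.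
  rewrite ler_wpM2l// lef_pV2 ?posrE ?exprn_gt0//.
  by rewrite ler_weXn2l ?ler1n// leq_addl.
have := tail n m; have := sn_tri (x_ (n + m)%N) x (x_ n).
have := p (n + m)%N (2 * C); rewrite mulr_ge0// => /(_ isT); lra.
Qed.

(** * Vector-valued Riemann integrals *)

Definition tagged (d t : R) n (s xi : nat -> R) :=
  [/\ s 0%N = 0, s n = t & forall i, (i < n)%N ->
    [/\ s i <= xi i, xi i <= s i.+1 & s i.+1 - s i < d]].

Definition is_integral (Y : R -> V) t w := forall e, 0 < e ->
  exists2 d, 0 < d & forall n s xi, tagged d t n s xi ->
    sn (\sum_(i < n) (s i.+1 - s i) *: Y (xi i) - w) < e.

Lemma tagged_incr d t n s xi i j : tagged d t n s xi -> (i <= j <= n)%N ->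
  s i <= s j.
Proof.
move=> [_ _ h] /andP[+ jn]; elim: j jn => [_|j IH jn].
  by rewrite leqn0 => /eqP ->.
rewrite leq_eqVlt => /predU1P[->//|]; rewrite ltnS => ij.
have [h1 h2 _] := h _ jn.
by apply: le_trans (IH (ltnW jn) ij) (le_trans h1 h2).
Qed.

Lemma tagged_mem d t n s xi i : tagged d t n s xi -> (i < n)%N ->
  [/\ 0 <= s i, s i <= xi i, xi i <= s i.+1, s i.+1 <= t & s i.+1 - s i < d].
Proof.
move=> T i_n; have [s0 sn h] := T; have [h1 h2 h3] := h _ i_n.
split => //.
- by rewrite -s0; apply: tagged_incr T _; rewrite leq0n ltnW.
- by rewrite -sn; apply: tagged_incr T _; rewrite i_n leqnn.
Qed.

Lemma tagged_sum d t n s xi : tagged d t n s xi ->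
  \sum_(i < n) (s i.+1 - s i) = t.
Proof.
move=> [s0 sn _]; rewrite -(big_mkord xpredT (fun i => s i.+1 - s i)).
by rewrite telescope_sumr// s0 sn subr0.
Qed.

(** The uniform subdivision of [[0, t]] followed by that of [[t, t']], so that
    the same sums approximate the integrals up to [t] and up to [t']. *)
Lemma tagged2_ex d t t' : 0 < d -> 0 <= t -> t <= t' -> exists n s,
  [/\ tagged d t n s s, tagged d t' (n + n) s s &
      forall i, (n <= i)%N -> t <= s i].
Proof.
move=> d0 t0 tt'.
have [n nP] : exists n : nat, (t + (t' - t)) / d < n%:R.
  by exists (Num.bound ((t + (t' - t)) / d)); apply: archi_boundP;
    rewrite divr_ge0 ?(ltW d0)//; lra.
have n0 : 0 < n%:R :> R.
  by apply: le_lt_trans nP; rewrite divr_ge0 ?(ltW d0)//; lra.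
have nn0 : n%:R != 0 :> R by rewrite gt_eqF.
move: nP; rewrite ltr_pdivrMr// => nP.
have lt1 : t / n%:R < d by rewrite ltr_pdivrMr// mulrC; lra.
have lt2 : (t' - t) / n%:R < d by rewrite ltr_pdivrMr// mulrC; lra.
pose s i := if (i <= n)%N then t * i%:R / n%:R else t + (t' - t) * (i - n)%:R / n%:R.
have sL i : (i <= n)%N -> s i = t * i%:R / n%:R by rewrite /s => ->.
have sR i : (n <= i)%N -> s i = t + (t' - t) * (i - n)%:R / n%:R.
  rewrite leq_eqVlt => /predU1P[<-|ni]; last by rewrite /s leqNgt ni.
  by rewrite sL// subnn mulr0 mul0r addr0 mulfK.
have dL i : (i < n)%N -> s i.+1 - s i = t / n%:R.
  by move=> i_n; rewrite !sL// ?(ltnW i_n)// -addn1 natrD; field.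
have dR i : (n <= i)%N -> s i.+1 - s i = (t' - t) / n%:R.
  by move=> ni; rewrite !sR// ?(leqW ni)// subSn// -addn1 natrD; field.
have s0 : s 0%N = 0 by rewrite sL// mulr0 mul0r.
have stn : s n = t by rewrite sL//; field.
have q1 : 0 <= t / n%:R by rewrite divr_ge0 ?(ltW n0).
have q2 : 0 <= (t' - t) / n%:R by rewrite divr_ge0 ?subr_ge0 ?(ltW n0).
exists n, s; split.
- by split => // i i_n; have := dL i i_n; split; lra.
- split => //; first by rewrite sR ?leq_addr// addnK; field.
  move=> i _; have [i_n|ni] := ltnP i n.
    by have := dL i i_n; split; lra.
  by have := dR i ni; split; lra.
- by move=> i ni; rewrite sR// lerDl mulr_ge0 ?invr_ge0 ?(ltW n0)// mulr_ge0// subr_ge0 tt'.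
Qed.

Lemma tagged_ex d t : 0 < d -> 0 <= t -> exists n s, tagged d t n s s.
Proof.
by move=> d0 t0; have [n [s [T _ _]]] := tagged2_ex d0 t0 (lexx t); exists n, s.
Qed.

Lemma tagged_le d d' t n s xi : d <= d' -> tagged d t n s xi -> tagged d' t n s xi.
Proof.
move=> dd [s0 sn h]; split => // i /h[h1 h2 h3].
by split => //; apply: lt_le_trans dd.
Qed.

Lemma integral_dist Y Z t w z M : 0 <= t -> is_integral Y t w -> is_integral Z t z ->
  (forall r, 0 <= r <= t -> sn (Y r - Z r) <= M) -> sn (w - z) <= t * M.
Proof.
move=> t0 iY iZ YZ; apply/ler_addgt0Pr => e e0.
have e20 : 0 < e / 2 by rewrite divr_gt0.
have [d1 d10 h1] := iY _ e20; have [d2 d20 h2] := iZ _ e20.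
have [|n [s T]] := @tagged_ex (Num.min d1 d2) t _ t0; first by rewrite lt_min d10.
have {h1} := h1 n s s (tagged_le _ T); rewrite ge_min lexx => /(_ isT).
have {h2} := h2 n s s (tagged_le _ T); rewrite ge_min lexx orbT => /(_ isT).
set SZ := \sum_(i < n) _ *: Z _; set SY := \sum_(i < n) _ *: Y _ => hZ hY.
have YZM : sn (SY - SZ) <= t * M.
  rewrite -(tagged_sum T) mulr_suml -sumrB (le_trans (sn_sum _ _))//.
  apply: ler_sum => i _; have [h1 h2 h3 h4 h5] := tagged_mem T (ltn_ord i).
  rewrite -scalerBr snZ ger0_norm ?subr_ge0//.
  by rewrite ler_wpM2l ?subr_ge0// YZ// h1 (le_trans h3 h4).
have := sn_tri SZ w z; have := sn_tri SY w SZ; rewrite (sn_dist w SY); lra.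
Qed.

Lemma integral0 Y w : is_integral Y 0 w -> sn w = 0.
Proof.
move=> iY; apply: sn_le0; apply/ler_addgt0Pr => e e0; rewrite add0r.
have [d d0 h] := iY e e0.
have /h : tagged d 0 0 (cst 0) (cst 0) by split.
by rewrite big_ord0 sub0r snN => /ltW.
Qed.

Lemma integral_lin k Y Z t w z : is_integral Y t w -> is_integral Z t z ->
  is_integral (fun r => Y r + k *: Z r) t (w + k *: z).
Proof.
move=> iY iZ e e0.
have k1 : 0 < `|k| + 1 by rewrite ltr_wpDl.
have e20 : 0 < e / 2 by rewrite divr_gt0.
have [d1 d10 h1] := iY _ e20; have [d2 d20 h2] := iZ (e / 2 / (`|k| + 1)) (divr_gt0 e20 k1).
exists (Num.min d1 d2) => [|n s xi T]; first by rewrite lt_min d10.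
have {h1} := h1 n s xi (tagged_le _ T); rewrite ge_min lexx => /(_ isT) h1.
have {h2} := h2 n s xi (tagged_le _ T); rewrite ge_min lexx orbT => /(_ isT) h2.
under eq_bigr => i _ do rewrite scalerDr scalerA mulrC -scalerA.
rewrite big_split/= -scaler_sumr opprD addrACA -scalerBr.
apply: le_lt_trans (snD _ _) _; rewrite snZ.
rewrite [e]splitr; apply: ltr_leD => //.
apply: (@le_trans _ _ (`|k| * (e / 2 / (`|k| + 1)))).
  by rewrite ler_wpM2l// ltW.
by rewrite mulrA ler_pdivrMr// [`|k| * _]mulrC ler_wpM2l ?(ltW e20)// lerDl.
Qed.

Lemma integral_eq Y t w w' : is_integral Y t w -> sn (w' - w) = 0 -> is_integral Y t w'.
Proof.
move=> iY ww' e /iY[d d0 h]; exists d => // n s xi /h.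
apply: le_lt_trans; set S := \sum_(i < n) _.
by have := sn_tri w S w'; rewrite (sn_dist w w') ww' addr0.
Qed.

Lemma integral_incr Y t t' w w' y M : 0 <= t -> t <= t' ->
  is_integral Y t w -> is_integral Y t' w' ->
  (forall r, t <= r <= t' -> sn (Y r - y) <= M) ->
  sn (w' - w - (t' - t) *: y) <= (t' - t) * M.
Proof.
move=> t0 tt' iw iw' YM; apply/ler_addgt0Pr => e e0.
have e20 : 0 < e / 2 by rewrite divr_gt0.
have [d1 d10 h1] := iw _ e20; have [d2 d20 h2] := iw' _ e20.
have [|n [s [T T' sT]]] := @tagged2_ex (Num.min d1 d2) t t' _ t0 tt'.
  by rewrite lt_min d10.
have {h1} := h1 n s s (tagged_le _ T); rewrite ge_min lexx => /(_ isT).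
have {h2} := h2 _ s s (tagged_le _ T'); rewrite ge_min lexx orbT => /(_ isT).
rewrite big_split_ord/=.
set S1 := \sum_(i < n) (s i.+1 - s i) *: _.
set S2 := \sum_(i < n) _ => hw' hw.
have S2y : sn (S2 - (t' - t) *: y) <= (t' - t) * M.
  have E : t' - t = \sum_(i < n) (s (n + i).+1 - s (n + i)%N).
    have := tagged_sum T'; rewrite big_split_ord/= => <-.
    by rewrite (tagged_sum T) addrAC subrr add0r.
  rewrite E scaler_suml mulr_suml -sumrB (le_trans (sn_sum _ _))//.
  apply: ler_sum => i _; have ni : (n + i < n + n)%N by rewrite ltn_add2l.
  have [h1 h2 h3 h4 h5] := tagged_mem T' ni.
  rewrite -scalerBr snZ ger0_norm ?subr_ge0//.
  by rewrite ler_wpM2l ?subr_ge0// YM// (le_trans h3 h4) sT ?leq_addr.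
have -> : w' - w - (t' - t) *: y =
    - (S1 + S2 - w') + ((S1 - w) + (S2 - (t' - t) *: y)) by lmod; ring.
have := snD (- (S1 + S2 - w')) ((S1 - w) + (S2 - (t' - t) *: y)).
have := snD (S1 - w) (S2 - (t' - t) *: y); rewrite snN; lra.
Qed.

(** The errors of a Riemann sum telescope when [Y] is the derivative of [W] with
    a uniform quadratic remainder. *)
Lemma integral_lipschitz Y W K t : 0 <= t -> 0 <= K -> sn (W 0) = 0 ->
  (forall s r s', 0 <= s -> s <= r -> r <= s' ->
     sn (W s' - W s - (s' - s) *: Y r) <= (s' - s) ^+ 2 * K) ->
  is_integral Y t (W t).
Proof.
move=> t0 K0 W0 h e e0.
have Kt0 : 0 < K * t + 1 by rewrite ltr_wpDl// mulr_ge0.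
exists (e / (K * t + 1)); first by rewrite divr_gt0.
move=> n s xi T; have [s0 stn _] := T.
have -> : \sum_(i < n) (s i.+1 - s i) *: Y (xi i) - W t =
   - W 0 + \sum_(i < n) ((s i.+1 - s i) *: Y (xi i) - (W (s i.+1) - W (s i))).
  rewrite sumrB -(big_mkord xpredT (fun i => W (s i.+1) - W (s i))).
  rewrite (telescope_sumr (fun i => W (s i)))// s0 stn.
  suff E (A : V) : A - W t = - W 0 + (A - (W t - W 0)) by exact: E.
  by lmod; ring.
apply: le_lt_trans (snD _ _) _; rewrite snN W0 add0r.
apply: le_lt_trans (sn_sum _ _) _.
apply: (@le_lt_trans _ _ (\sum_(i < n) (s i.+1 - s i) * (e / (K * t + 1) * K))).
  apply: ler_sum => i _; have [h1 h2 h3 h4 h5] := tagged_mem T (ltn_ord i).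
  rewrite sn_dist (le_trans (h _ _ _ h1 h2 h3))// expr2 -mulrA.
  by rewrite ler_wpM2l ?subr_ge0 ?(le_trans h2)// ler_wpM2r// ltW.
rewrite -mulr_suml (tagged_sum T).
rewrite [ltLHS](_ : _ = e * ((K * t) / (K * t + 1))); last by ring.
by rewrite gtr_pMr// ltr_pdivrMr// mul1r ltrDl.
Qed.

End semi_hilbert.

(** * Decay of the orbits of a dissipative operator *)
(** The operator is a relation that is compatible with the equality induced by
    the seminorm.  The range condition is imposed for every step [h], so that
    the implicit Euler scheme can be run. *)
Record m_dissipative (R : realType) (V : lmodType R) (H : semi_hilbert V) (om : R) :=
  MDissipative {
  graph :> V -> V -> Prop;
  graph0 : graph 0 0;
  graph_lin : forall k x f y g, graph x f -> graph y g ->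
    graph (x + k *: y) (f + k *: g);
  graph_sn : forall x f g, graph x f -> sn H (f - g) = 0 -> graph x g;
  graph_fun : forall x f, graph x f -> sn H x = 0 -> sn H f = 0;
  graph_diss : forall x f, graph x f -> H x f <= - om * H x x;
  graph_range : forall h f, 0 < h -> exists x g, graph x g /\ sn H (x - h *: g - f) = 0
}.

Section evolution.
Context {R : realType} {V : lmodType R} (H : semi_hilbert V).
Variables (om : R) (om0 : 0 <= om) (A : m_dissipative H om).
Implicit Types (x y z : V) (k h e t d r q : R) (Y Z : R -> V).

Ltac lmod := lmod_with R V.
Local Notation sn := (sn H).

Lemma graphB x f y g : A x f -> A y g -> A (x - y) (f - g).
Proof. by move=> xf yg; rewrite -(scaleN1r y) -(scaleN1r g); exact: graph_lin. Qed.

Lemma graphD x f y g : A x f -> A y g -> A (x + y) (f + g).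
Proof. by move=> xf yg; rewrite -[y]scale1r -[g]scale1r; exact: graph_lin. Qed.

Lemma graphZ k x f : A x f -> A (k *: x) (k *: f).
Proof.
move=> xf; rewrite -[k *: x]add0r -[k *: f]add0r.
by apply: graph_lin => //; exact: graph0.
Qed.

Definition continuous_orbit Y := forall t, 0 <= t -> forall e, 0 < e ->
  exists2 d, 0 < d & forall r, 0 <= r -> `|r - t| < d -> sn (Y r - Y t) <= e.

Definition mild y0 Y := continuous_orbit Y /\ forall t, 0 <= t ->
  exists w g, [/\ is_integral H Y t w, A w g & sn (Y t - (y0 + g)) = 0].

Lemma integral_derive Y w t e : continuous_orbit Y ->
  (forall r, 0 <= r -> is_integral H Y r (w r)) -> 0 <= t -> 0 < e ->
  exists2 d, 0 < d & forall r, 0 <= r -> `|r - t| < d ->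
    sn (w r - w t - (r - t) *: Y t) <= `|r - t| * e.
Proof.
move=> cY iw t0 e0; have [d d0 h] := cY t t0 e e0; exists d => // r r0.
have [tr|/ltW rt] := leP t r => rtd.
  rewrite ger0_norm ?subr_ge0//; apply: integral_incr => //; try exact: iw.
  move=> q /andP[tq qr]; apply: h; first exact: le_trans tq.
  apply: le_lt_trans rtd; rewrite !ger0_norm ?subr_ge0//; first by rewrite lerB.
have -> : w r - w t - (r - t) *: Y t = - (w t - w r - (t - r) *: Y t) by lmod; ring.
rewrite snN ler0_norm ?subr_le0// opprB; apply: integral_incr => //; try exact: iw.
move=> q /andP[rq qt]; apply: h; first exact: le_trans rq.
by apply: le_lt_trans rtd; rewrite !ler0_norm ?subr_le0// lerN2 lerB.
Qed.

(** Along a differentiable curve with [X' = A X], the derivative of [|X|^2] is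
    [2 (X, A X)], which is at most [- 2 om |X|^2]. *)
Lemma classical_decay (X Z : R -> V) :
  (forall t, 0 <= t -> A (X t) (Z t)) ->
  (forall t, 0 <= t -> forall e, 0 < e -> exists2 d, 0 < d &
    forall r, 0 <= r -> `|r - t| < d ->
      sn (X r - X t - (r - t) *: Z t) <= `|r - t| * e) ->
  forall t, 0 <= t -> sn (X t) <= expR (- om * t) * sn (X 0).
Proof.
move=> XZ dX.
pose F t := H (X t) (X t).
have F_diff t : 0 <= t -> forall e, 0 < e -> exists2 d, 0 < d &
    forall r, 0 <= r -> `|r - t| < d ->
      `|F r - F t - (r - t) * (2 * H (X t) (Z t))| <= `|r - t| * e.
  move=> t0 e e0.
  pose a := sn (X t); pose b := sn (Z t).
  have a0 : 0 <= a by exact: sn_ge0.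
  have b0 : 0 <= b by exact: sn_ge0.
  pose c := 2 * a + 2 * b + 2.
  have c0 : 0 < c by rewrite /c; lra.
  pose e1 := Num.min 1 (e / (2 * c)).
  have e10 : 0 < e1 by rewrite lt_min ltr01 divr_gt0// mulr_gt0.
  have [d d0 h] := dX t t0 e1 e10.
  pose d1 := Num.min 1 (e / (2 * (b ^+ 2 + 1))).
  have b20 : 0 < 2 * (b ^+ 2 + 1) by have := sqr_ge0 b; lra.
  have d10 : 0 < d1 by rewrite lt_min ltr01 divr_gt0.
  exists (Num.min d d1); first by rewrite lt_min d0.
  move=> r r0; rewrite lt_min => /andP[rd rd1].
  have [u E hu] : exists2 u, X r = X t + (r - t) *: Z t + u & sn u <= `|r - t| * e1.
    by exists (X r - X t - (r - t) *: Z t); [lmod; ring|exact: h].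
  have -> : F r - F t - (r - t) * (2 * H (X t) (Z t)) =
     (r - t) ^+ 2 * H (Z t) (Z t) + 2 * H (X t) u + 2 * (r - t) * H (Z t) u + H u u.
    by rewrite /F E !formE (formC H (Z t) (X t)) (formC H u (X t)) (formC H u (Z t)); ring.
  set del := `|r - t| in hu rd rd1 *.
  have del0 : 0 <= del by exact: normr_ge0.
  have del2 : (r - t) ^+ 2 = del ^+ 2 by rewrite /del real_normK// num_real.
  have e11 : e1 <= 1 by rewrite ge_min lexx.
  have del1 : del <= 1 by move: rd1; rewrite lt_min => /andP[/ltW].
  have su0 := sn_ge0 H u.
  have su1 : sn u <= del * e1 by [].
  have H1 := form_le H (X t) u; have H2 := form_le H (Z t) u.
  rewrite -!sn_sqr -/b del2.
  have T1 : `|2 * H (X t) u| <= 2 * a * (del * e1).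
    by rewrite normrM ger0_norm// -mulrA ler_wpM2l// (le_trans H1)// ler_wpM2l.
  have T2 : `|2 * (r - t) * H (Z t) u| <= 2 * b * (del * e1).
    rewrite !normrM ger0_norm// -/del.
    have h1 : `|H (Z t) u| <= b * (del * e1) := le_trans H2 (ler_wpM2l b0 su1).
    have h2 : del * `|H (Z t) u| <= `|H (Z t) u| by rewrite ler_piMl.
    lra.
  have T3 : `|sn u ^+ 2| <= del * e1.
    rewrite ger0_norm ?sqr_ge0// expr2 -[leRHS]mulr1 ler_pM//.
    by rewrite (le_trans su1)// -[leRHS]mulr1 ler_pM// ltW.
  have T4 : `|del ^+ 2 * b ^+ 2| <= del * (e / 2).
    rewrite ger0_norm ?mulr_ge0 ?sqr_ge0// expr2 -mulrA ler_wpM2l//.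
    move: rd1; rewrite lt_min => /andP[_ /ltW rd1].
    apply: (@le_trans _ _ (e / (2 * (b ^+ 2 + 1)) * b ^+ 2)).
      by rewrite ler_wpM2r// sqr_ge0.
    rewrite mulrAC ler_pdivrMr// -mulrA ler_wpM2l ?(ltW e0)//.
    by have := sqr_ge0 b; lra.
  have T5 : c * (del * e1) <= del * (e / 2).
    rewrite mulrCA ler_wpM2l//.
    apply: (@le_trans _ _ (c * (e / (2 * c)))); last first.
      by rewrite le_eqVlt; apply/orP; left; apply/eqP; field; rewrite gt_eqF.
    by rewrite ler_wpM2l ?(ltW c0)// ge_min lexx orbT.
  have N4 (p q s v : R) : `|p + q + s + v| <= `|p| + `|q| + `|s| + `|v|.
    by rewrite (le_trans (ler_normD _ _))// lerD2r (le_trans (ler_normD _ _))//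
      lerD2r ler_normD.
  apply: le_trans (N4 _ _ _ _) _.
  have q0 : 0 <= del * e1 by rewrite mulr_ge0// ltW.
  move: T1 T2 T3 T4 T5 q0; rewrite /c; set q := del * e1; lra.
have F_cont t : 0 <= t -> F r @[r --> within `[0, +oo[%classic (nbhs t)] --> F t.
  move=> t0; apply/cvgrPdist_le => e e0.
  have [d d0 h] := F_diff t t0 1 ltr01.
  have near_dist k : 0 < k -> \forall r \near within `[0, +oo[%classic (nbhs t),
      `|r - t| < k.
    move=> k0; apply: cvg_within; apply/nbhs_ballP; exists k => // r.
    by rewrite /ball /= distrC.
  pose K := `|2 * H (X t) (Z t)| + 1.
  have K0 : 0 < K by rewrite /K ltr_wpDl.
  near=> r.
  have r0 : 0 <= r.
    have : r \in `[0, +oo[ by near: r; exact: withinT.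
    by rewrite in_itv /= andbT.
  have rd : `|r - t| < d by near: r; exact: near_dist.
  have rK : `|r - t| * K <= e.
    by rewrite -ler_pdivlMr// ltW//; near: r; apply: near_dist; rewrite divr_gt0.
  rewrite distrC; apply: le_trans rK.
  have := h r r0 rd; rewrite mulr1 => hr.
  rewrite -[F r - F t](subrK ((r - t) * (2 * H (X t) (Z t)))).
  apply: le_trans (ler_normD _ _) _.
  by rewrite /K mulrDr mulr1 addrC lerD// normrM.
have F_der t : 0 < t -> is_derive t 1 F (2 * H (X t) (Z t)).
  move=> t0.
  have c : h^-1 *: (F (h *: 1 + t) - F t) @[h --> 0^'] --> 2 * H (X t) (Z t).
    apply/cvgrPdist_le => e e0.
    have [d d0 hd] := F_diff t (ltW t0) e e0.
    near=> h.
    have hn0 : h != 0 by near: h; exact: nbhs_dnbhs_neq.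
    have hd' : `|h| < d.
      by near: h; apply: dnbhs0_lt.
    have ht : `|h| < t by near: h; apply: dnbhs0_lt.
    have E : h *: 1 + t - t = h by rewrite addrK /GRing.scale /= mulr1.
    have := hd (h *: 1 + t); rewrite E => /(_ _ hd').
    have -> : h *: (1 : R) = h by rewrite /GRing.scale /= mulr1.
    have r0 : 0 <= h + t by move: ht; rewrite ltr_norml => /andP[]; lra.
    move=> /(_ r0) B.
    have -> : 2 * H (X t) (Z t) - h^-1 *: (F (h + t) - F t) =
       - (h^-1 * (F (h + t) - F t - h * (2 * H (X t) (Z t)))).
      by rewrite /GRing.scale /=; field.
    by rewrite normrN normrM normfV ler_pdivrMl ?normr_gt0.
  by apply: DeriveDef; [apply/cvg_ex; eexists; exact: c|exact: cvg_lim c].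
(* This function is nonincreasing by dissipativity. *)
pose P t := expR (2 * om * t) * F t.
have E_der t : is_derive t 1 (fun t => expR (2 * om * t)) (expR (2 * om * t) * (2 * om)).
  apply: (@is_derive1_comp _ expR (fun t => 2 * om * t)).
  rewrite -[X in is_derive _ _ _ X]mulr1; exact: is_deriveZ.
have P_der t : 0 < t -> is_derive t 1 P
    (expR (2 * om * t) * (2 * H (X t) (Z t)) + F t * (expR (2 * om * t) * (2 * om))).
  by move=> t0; apply: (is_deriveM (E_der t) (F_der t t0)).
have P_noninc t : 0 <= t -> P t <= P 0.
  move=> t0; apply: (@ler0_derive1_nincry _ P 0) => //.
  - move=> x; rewrite in_itv /= andbT => x0; by have [] := P_der x x0.
  - move=> x; rewrite in_itv /= andbT => x0; rewrite derive1E.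
    have [_ ->] := P_der x x0.
    have := graph_diss (XZ x (ltW x0)); rewrite -/(F x) => hd.
    rewrite [leLHS](_ : _ = expR (2 * om * x) * (2 * (H (X x) (Z x) + om * F x))); last by ring.
    by rewrite pmulr_rle0 ?expR_gt0//; lra.
  - apply/subspace_continuousP => x; rewrite /= in_itv /= andbT => x0.
    apply: cvgM; last exact: F_cont.
    apply: cvg_within_filter.
    apply: (continuous_comp (f := fun t => 2 * om * t)); last exact: continuous_expR.
    by apply: cvgM; [exact: cvg_cst|exact: cvg_id].
move=> t t0; rewrite -(@ler_pXn2r _ 2)// ?nnegrE ?mulr_ge0 ?expR_ge0 ?sn_ge0//.
rewrite exprMn !sn_sqr -/(F t) -/(F 0).
have := P_noninc t t0; rewrite /P mulr0 expR0 mul1r.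
have -> : expR (- om * t) ^+ 2 = (expR (2 * om * t))^-1.
  by rewrite -expRN expr2 -expRD; congr expR; ring.
by rewrite ler_pdivlMl ?expR_gt0.
Unshelve. all: by end_near. Qed.

(** The increments [w (t + h) - w t] of the integral of an orbit form a
    differentiable curve in the domain with [X' = A X]; divided by [h], they
    converge to the orbit as [h] tends to 0. *)
Lemma orbit_decay y0 Y : mild y0 Y ->
  forall t, 0 <= t -> sn (Y t) <= expR (- om * t) * sn (Y 0).
Proof.
move=> [cY hY].
have /choice [w hw] : forall t, exists w, 0 <= t ->
    is_integral H Y t w /\ exists g, A w g /\ sn (Y t - (y0 + g)) = 0.
  move=> t; have [t0|t0] := leP 0 t; last by exists 0.
  by have [w [g [h1 h2 h3]]] := hY t t0; exists w => _; split => //; exists g.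
have iw t : 0 <= t -> is_integral H Y t (w t) by move=> /hw[].
have window h : 0 < h -> forall t, 0 <= t ->
    sn (w (t + h) - w t) <= expR (- om * t) * sn (w h - w 0).
  move=> h0; pose X t := w (t + h) - w t; pose Z t := Y (t + h) - Y t.
  have th t : 0 <= t -> 0 <= t + h by move=> t0; rewrite addr_ge0// ltW.
  suff W t : 0 <= t -> sn (X t) <= expR (- om * t) * sn (X 0).
    by move=> t t0; have := W t t0; rewrite /X add0r.
  move: t; apply: (@classical_decay X Z) => t t0.
    have [_ [g [wg Yg]]] := hw t t0; have [_ [g' [wg' Yg']]] := hw _ (th _ t0).
    apply: graph_sn (graphB wg' wg) _.
    have -> : g' - g - Z t = (Y t - (y0 + g)) - (Y (t + h) - (y0 + g')).
      by rewrite /Z; lmod; ring.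
    by apply: sn_null0 => //; rewrite snN.
  move=> e e0; have e20 : 0 < e / 2 by rewrite divr_gt0.
  have [d1 d10 h1] := integral_derive cY iw t0 e20.
  have [d2 d20 h2] := integral_derive cY iw (th _ t0) e20.
  exists (Num.min d1 d2); first by rewrite lt_min d10.
  move=> r r0; rewrite lt_min => /andP[rd1 rd2].
  have := h2 (r + h) (th _ r0); have -> : r + h - (t + h) = r - t by ring.
  move=> /(_ rd2) B2; have B1 := h1 r r0 rd1.
  have -> : X r - X t - (r - t) *: Z t =
      (w (r + h) - w (t + h) - (r - t) *: Y (t + h)) - (w r - w t - (r - t) *: Y t).
    by rewrite /X /Z; lmod; ring.
  apply: le_trans (snB _ _ _) (le_trans (lerD B2 B1) _).
  by rewrite -mulrDr -splitr.
move=> t t0; apply/ler_addgt0Pr => e e0.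
have e20 : 0 < e / 2 by rewrite divr_gt0.
have [d1 d10 h1] := integral_derive cY iw t0 e20.
have [d2 d20 h2] := integral_derive cY iw (lexx 0) e20.
pose h := Num.min d1 d2 / 2.
have m0 : 0 < Num.min d1 d2 by rewrite lt_min d10.
have h0 : 0 < h by rewrite divr_gt0.
have hm : h < Num.min d1 d2 by rewrite /h; lra.
have nh : `|h| = h by rewrite gtr0_norm.
move: hm; rewrite lt_min => /andP[hd1 hd2].
have B1 := h1 (t + h); have B2 := h2 h (ltW h0).
move: B1 B2; rewrite subr0 [t + h - t]addrAC subrr add0r nh => B1 B2.
have {}B1 := B1 (addr_ge0 t0 (ltW h0)) hd1; have {}B2 := B2 hd2.
have W := window h h0 t t0.
have exp1 : expR (- om * t) <= 1.
  by rewrite -expR0 ler_expR mulNr oppr_le0 mulr_ge0.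
have Y1 : h * sn (Y t) <= sn (w (t + h) - w t) + h * (e / 2).
  rewrite -{1}nh -snZ; apply: le_trans (sn_le_dist H _ (w (t + h) - w t)) _.
  by rewrite lerD2l sn_dist.
have Y2 : sn (w h - w 0) <= h * sn (Y 0) + h * (e / 2).
  by rewrite -{2}nh -snZ; apply: le_trans (sn_le_dist H _ (h *: Y 0)) _; rewrite lerD2l.
have E0 : 0 <= expR (- om * t) by exact: expR_ge0.
have Y3 := ler_wpM2l E0 Y2.
have Y4 : expR (- om * t) * (h * (e / 2)) <= h * (e / 2).
  by rewrite ler_piMl// mulr_ge0// ltW.
rewrite -(ler_pM2l h0); move: W Y1 Y3 Y4.
have -> : expR (- om * t) * (h * sn (Y 0) + h * (e / 2)) =
  h * (expR (- om * t) * sn (Y 0)) + expR (- om * t) * (h * (e / 2)) by ring.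
have -> : h * (expR (- om * t) * sn (Y 0) + e) =
  h * (expR (- om * t) * sn (Y 0)) + h * (e / 2) + h * (e / 2) by field.
lra.
Qed.

Lemma orbit0 y0 Y : mild y0 Y -> sn (Y 0 - y0) = 0.
Proof.
move=> [_ /(_ 0 (lexx 0))[w [g [iw wg Yg]]]].
have g0 := graph_fun wg (integral0 iw).
by rewrite (_ : Y 0 - y0 = (Y 0 - (y0 + g)) + g); [exact: sn_null0|lmod; ring].
Qed.

Lemma mild_decay y0 Y : mild y0 Y ->
  forall t, 0 <= t -> sn (Y t) <= expR (- om * t) * sn y0.
Proof.
move=> mY t t0; apply: le_trans (orbit_decay mY t0) _.
rewrite ler_wpM2l ?expR_ge0//.
by apply: le_trans (sn_le_dist H _ y0) _; rewrite (orbit0 mY) addr0.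
Qed.

Lemma mildB y0 Y z0 Z : mild y0 Y -> mild z0 Z ->
  mild (y0 - z0) (fun t => Y t - Z t).
Proof.
move=> [cY hY] [cZ hZ]; split.
  move=> t t0 e e0; have e20 : 0 < e / 2 by rewrite divr_gt0.
  have [d1 d10 h1] := cY t t0 _ e20; have [d2 d20 h2] := cZ t t0 _ e20.
  exists (Num.min d1 d2); first by rewrite lt_min d10.
  move=> r r0; rewrite lt_min => /andP[rd1 rd2].
  have -> : Y r - Z r - (Y t - Z t) = (Y r - Y t) - (Z r - Z t) by lmod; ring.
  by rewrite [e]splitr (le_trans (snB _ _ _))// lerD// ?h1// h2.
move=> t t0; have [w [g [iw wg Yg]]] := hY t t0; have [z [k [iz zk Zk]]] := hZ t t0.
exists (w - z), (g - k); split.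
- rewrite -(scaleN1r z) (_ : (fun t => _) = fun r => Y r + (-1) *: Z r).
    exact: integral_lin.
  by apply/funext => r; rewrite scaleN1r.
- exact: graphB.
- have -> : Y t - Z t - (y0 - z0 + (g - k)) = (Y t - (y0 + g)) - (Z t - (z0 + k)).
    by lmod; ring.
  by apply: sn_null0; rewrite ?snN.
Qed.

(** The difference of two orbits is an orbit. *)
Lemma mild_dist y0 Y z0 Z : mild y0 Y -> mild z0 Z ->
  forall t, 0 <= t -> sn (Y t - Z t) <= sn (y0 - z0).
Proof.
move=> mY mZ t t0; apply: le_trans (mild_decay (mildB mY mZ) t0) _.
by rewrite ler_piMl ?sn_ge0// -expR0 ler_expR mulNr oppr_le0 mulr_ge0.
Qed.

End evolution.

(** * Existence of orbits by the implicit Euler scheme *)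
Section existence.
Context {R : realType} {V : lmodType R} (H : semi_hilbert V).
Variables (om : R) (om0 : 0 <= om) (A : m_dissipative H om).
Implicit Types (x y z f g : V) (k h e t d r q : R) (Y Z : R -> V) (m n j : nat).

Ltac lmod := lmod_with R V.
Local Notation sn := (sn H).

Lemma sn_sub_sqr x h g : sn (x - h *: g) ^+ 2 = sn x ^+ 2 - 2 * h * H x g + h ^+ 2 * sn g ^+ 2.
Proof. by rewrite !sn_sqr !formE (formC H g x); ring. Qed.

(** In the expansion of the square of [sn (x - h *: g)], the mixed term is
    nonnegative by dissipativity. *)
Lemma resolvent_contr x g h : A x g -> 0 <= h -> sn x <= sn (x - h *: g).
Proof.
move=> xg h0; rewrite -(@ler_pXn2r _ 2)// ?nnegrE ?sn_ge0// sn_sub_sqr.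
have D : H x g <= 0.
  by apply: le_trans (graph_diss xg) _; rewrite mulNr oppr_le0 mulr_ge0// form_ge0.
have := mulr_ge0 (sqr_ge0 h) (sqr_ge0 (sn g)).
have : 0 <= - (h * H x g) by rewrite -mulrN mulr_ge0// oppr_ge0.
lra.
Qed.

Lemma resolvent_ex : exists J : R -> V -> V, forall h f, 0 < h ->
  A (J h f) (h^-1 *: (J h f - f)).
Proof.
suff /choice [J hJ] : forall hf : R * V, exists x, 0 < hf.1 ->
    A x (hf.1^-1 *: (x - hf.2)).
  by exists (fun h f => J (h, f)) => h f h0; exact: (hJ (h, f)).
move=> [h f] /=; have [h0|h0] := ltP 0 h; last by exists 0.
have [x [g [xg E]]] := graph_range A f h0; exists x => _.
apply: graph_sn xg _.
have -> : g - h^-1 *: (x - f) = - h^-1 *: (x - h *: g - f).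
  by lmod; field; rewrite gt_eqF.
by rewrite snZ E mulr0.
Qed.

(** The resolvent: [J h f] is a choice of a solution [x] of [x - h A x = f], up
    to null vectors. *)
Definition J : R -> V -> V := sval (cid resolvent_ex).

Lemma JP h f : 0 < h -> A (J h f) (h^-1 *: (J h f - f)).
Proof. by rewrite /J; case: cid => J0 /= P; exact: P. Qed.

Lemma J_dist x g h f : A x g -> 0 < h -> sn (x - J h f) <= sn (x - h *: g - f).
Proof.
move=> xg h0; apply: le_trans (resolvent_contr (graphB xg (JP f h0)) (ltW h0)) _.
rewrite le_eqVlt; apply/orP; left; apply/eqP; congr sn.
by lmod; field; rewrite gt_eqF.
Qed.

Lemma J_contr h f g : 0 < h -> sn (J h f - J h g) <= sn (f - g).
Proof.
move=> h0; apply: le_trans (J_dist g (JP f h0) h0) _.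
rewrite le_eqVlt; apply/orP; left; apply/eqP; congr sn.
by lmod; field; rewrite gt_eqF.
Qed.

Lemma J_le h f : 0 < h -> sn (J h f) <= sn f.
Proof.
move=> h0; have := J_dist f (graph0 A) h0.
by rewrite scaler0 subr0 !sub0r !snN.
Qed.

Lemma J_diff x g h : A x g -> 0 < h -> sn (J h x - x) <= h * sn g.
Proof.
move=> xg h0; rewrite sn_dist; apply: le_trans (J_dist x xg h0) _.
have -> : x - h *: g - x = - (h *: g) by lmod; ring.
by rewrite snN snZ gtr0_norm.
Qed.

(** The resolvent commutes with [A]. *)
Lemma J_graph x g h : A x g -> 0 < h -> A (J h x) (J h g).
Proof.
move=> xg h0; apply: graph_sn (JP x h0) _.
have L := graphD xg (graphZ h (JP g h0)).
have {L} := J_dist x L h0.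
have -> : x + h *: J h g - h *: (g + h *: (h^-1 *: (J h g - g))) - x = 0.
  by lmod; field; rewrite gt_eqF.
rewrite sn0 => /sn_le0 E.
have -> : h^-1 *: (J h x - x) - J h g = - h^-1 *: (x + h *: J h g - J h x).
  by lmod; field; rewrite gt_eqF.
by rewrite snZ E mulr0.
Qed.

(** An operator is closed when its resolvent is continuous. *)
Lemma graph_closed (x_ g_ : nat -> V) x g C : (forall n, A (x_ n) (g_ n)) ->
  (forall n, sn (x - x_ n) <= C / 2 ^+ n) -> (forall n, sn (g - g_ n) <= C / 2 ^+ n) ->
  exists2 x', A x' g & sn (x' - x) = 0.
Proof.
move=> Axg xn gn; have J1 := JP (x - g) ltr01.
have E : sn (J 1 (x - g) - x) = 0.
  apply: sn_le0; apply: (@le_of_halves _ _ _ (3 * C)) => n; rewrite add0r.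
  have := sn_tri H (x_ n) (J 1 (x - g)) x; have := J_dist (x - g) (Axg n) ltr01.
  rewrite (sn_dist H (x_ n)) (sn_dist H (x_ n) x).
  have -> : x_ n - 1 *: g_ n - (x - g) = (g - g_ n) - (x - x_ n) by lmod; ring.
  have := snB H (g - g_ n) (x - x_ n); have := xn n; have := gn n.
  rewrite -(mulrA 3 C); lra.
exists (J 1 (x - g)) => //; apply: graph_sn J1 _.
have -> : 1^-1 *: (J 1 (x - g) - (x - g)) - g = J 1 (x - g) - x.
  by lmod; field.
exact: E.
Qed.

(** The errors [J (1 / a) z - z] form a Cauchy family as [a] grows, because
    dissipativity makes their norms decrease with [a] and controls their
    distances by the differences of the squared norms.  Their limit is
    orthogonal to the domain, hence null by the range condition. *)
Lemma domain_dense z e : 0 < e -> exists x g, A x g /\ sn (x - z) <= e.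
Proof.
have [w wE] : exists w, forall a, w a = J a^-1 z - z by exists (fun a => J a^-1 z - z).
have Aw a : 0 < a -> A (J a^-1 z) (a *: w a).
  by move=> a0; rewrite wE; have := JP z (_ : 0 < a^-1); rewrite invrK invr_gt0; apply.
(* Dissipativity applied to the difference of two errors. *)
have dist a b : 0 < b -> b <= a -> sn (w a - w b) ^+ 2 <= sn (w b) ^+ 2 - sn (w a) ^+ 2.
  move=> b0; rewrite le_eqVlt => /predU1P[->|ba]; first by rewrite !subrr sn0 expr0n.
  have a0 := lt_trans b0 ba.
  have := graph_diss (graphB (Aw a a0) (Aw b b0)).
  have -> : J a^-1 z - J b^-1 z = w a - w b by rewrite !wE; lmod; ring.
  move=> D; have {D} : H (w a - w b) (a *: w a - b *: w b) <= 0.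
    by apply: le_trans D _; rewrite mulNr oppr_le0 mulr_ge0// form_ge0.
  rewrite !sn_sqr !formE (formC H (w b) (w a)).
  set p := H (w a) (w a); set s := H (w a) (w b); set v := H (w b) (w b) => D.
  have S0 : 0 <= p - 2 * s + v.
    have := form_ge0 H (w a - w b); rewrite !formE (formC H (w b) (w a)) -/p -/s -/v; lra.
  have K : (a + b) * (p - 2 * s + v) <= (a - b) * (v - p) by lra.
  have ab0 : 0 < a - b by rewrite subr_gt0.
  have vp : 0 <= v - p.
    rewrite -(pmulr_rge0 _ ab0); apply: le_trans K; rewrite mulr_ge0//; lra.
  have ab2 : 0 < a + b by lra.
  have : (a + b) * (p - 2 * s + v) <= (a + b) * (v - p).
    by apply: le_trans K _; rewrite ler_wpM2r//; lra.
  by rewrite ler_pM2l//; lra.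
pose S := [set sn (w a) ^+ 2 | a in [set a | 0 < a]].
have S0 : lbound S 0 by move=> _ [a _ <-]; exact: sqr_ge0.
have hS : has_inf S by split; [exists (sn (w 1) ^+ 2); exists 1 => //=|exists 0].
have /choice [al hal] : forall n, exists a, 2 ^+ n <= a /\
    sn (w a) ^+ 2 <= inf S + (1 / 2 ^+ n) ^+ 2.
  move=> n; have [|_ [b /= b0 <-] hb] := @inf_adherent _ S ((1 / 2 ^+ n) ^+ 2) _ hS.
    by rewrite exprn_gt0// divr_gt0// exprn_gt0.
  exists (Num.max b (2 ^+ n)); rewrite le_max lexx orbT; split => //.
  have := dist _ _ b0 (_ : b <= Num.max b (2 ^+ n)); rewrite le_max lexx => /(_ isT).
  by have := sqr_ge0 (sn (w (Num.max b (2 ^+ n)) - w b)); lra.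
have al0 n : 0 < al n by apply: lt_le_trans (hal n).1; rewrite exprn_gt0.
have infS n : inf S <= sn (w (al n)) ^+ 2.
  by apply: ge_inf; [exists 0|exists (al n) => //=; exact: al0].
have Lw : forall n, sn (w (al n.+1) - w (al n)) <= 1 / 2 ^+ n.
  move=> n; rewrite -(@ler_pXn2r _ 2)// ?nnegrE ?sn_ge0//.
  have q0 : (1 / 2 ^+ n.+1 : R) ^+ 2 <= (1 / 2 ^+ n) ^+ 2.
    rewrite lerXn2r ?nnegrE ?divr_ge0 ?exprn_ge0// !div1r lef_pV2 ?posrE ?exprn_gt0//.
    by rewrite ler_weXn2l ?ler1n.
  have [h1|/ltW h1] := leP (al n) (al n.+1).
    have := dist _ _ (al0 n) h1; have := (hal n).2; have := infS n.+1; lra.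
  rewrite sn_dist; have := dist _ _ (al0 _) h1; have := (hal n.+1).2; have := infS n; lra.
have [w0 hw0] := sn_complete ler01 Lw.
have xn n : A (J (al n)^-1 z) (al n *: w (al n)) by exact: Aw.
have zw n : J (al n)^-1 z - (z + w0) = - (w0 - w (al n)) by rewrite !wE; lmod; ring.
have p2 n : (0 : R) <= 2 / 2 ^+ n by rewrite divr_ge0 ?exprn_ge0.
have p2' n : (2 : R) / 2 ^+ n <= 2.
  by rewrite ler_pdivrMr ?exprn_gt0// ler_peMr// exprn_ege1 ?ler1n.
(* Dissipativity applied to [x] and to the approximations of [z + w0], divided
   by [al n] so that only the limit of the error remains. *)
have orth x g : A x g -> H (z + w0) w0 <= H x w0.
  move=> xg.
  pose a := sn (x - (z + w0)); pose b := sn (g); pose c := sn w0.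
  have [a0 b0 c0] : [/\ 0 <= a, 0 <= b & 0 <= c] by split; exact: sn_ge0.
  apply: (@le_of_halves _ _ _ (2 * a + 2 * c + 4 + (a + 2) * b)) => n.
  have := graph_diss (graphB xg (xn n)).
  set xx := J (al n)^-1 z; set ww := w (al n); set aa := al n.
  move=> D; have {D} : H (x - xx) (g - aa *: ww) <= 0.
    by apply: le_trans D _; rewrite mulNr oppr_le0 mulr_ge0// form_ge0.
  pose u := w0 - ww; have wwE : ww = w0 - u by rewrite /u; lmod; ring.
  have su : sn u <= 2 / 2 ^+ n by have := hw0 n; rewrite mulr1.
  have xxE : x - xx = (x - (z + w0)) + u.
    have := zw n; rewrite -/xx -/ww -/u => E.
    have -> : x - xx = (x - (z + w0)) - (xx - (z + w0)) by lmod; ring.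
    by rewrite E opprK.
  rewrite xxE wwE.
  have T1 := form_le H ((x - (z + w0)) + u) g.
  have T2 := form_le H ((x - (z + w0)) + u) u.
  have T3 := form_le H u w0.
  have T4 := snD H (x - (z + w0)) u.
  have aa0 : 0 < aa := al0 n.
  move: T1 T2 T4; set y := (x - (z + w0)) + u => T1 T2 T4.
  rewrite formDr formNr formZr formDr formNr => D.
  have D' : H y g / aa <= H y w0 - H y u by rewrite ler_pdivrMr//; lra.
  have yb : sn y <= a + 2.
    by apply: le_trans T4 _; rewrite lerD2l; apply: le_trans su (p2' n).
  have T1' : - ((a + 2) * b / 2 ^+ n) <= H y g / aa.
    rewrite lerNl -mulNr; apply: (@le_trans _ _ ((a + 2) * b / aa)).
      rewrite ler_pM2r ?invr_gt0//; apply: le_trans (ler_norm _) _.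
      by rewrite normrN; apply: le_trans T1 _; rewrite ler_wpM2r.
    rewrite ler_wpM2l ?mulr_ge0 ?addr_ge0// lef_pV2 ?posrE ?exprn_gt0//.
    exact: (hal n).1.
  have T2' : `|H y u| <= (a + 2) * (2 / 2 ^+ n).
    by apply: le_trans T2 _; rewrite ler_pM// sn_ge0.
  have T3' : `|H u w0| <= 2 / 2 ^+ n * c.
    by apply: le_trans T3 _; rewrite ler_wpM2r.
  have yE : H y w0 = H x w0 - H (z + w0) w0 + H u w0.
    by rewrite /y formDl formDl formNl.
  move: (ler_norm (H u w0)) (ler_norm (- H y u)); rewrite normrN => N1 N2.
  have -> : (2 * a + 2 * c + 4 + (a + 2) * b) / 2 ^+ n =
     (a + 2) * (2 / 2 ^+ n) + 2 / 2 ^+ n * c + (a + 2) * b / 2 ^+ n by ring.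
  lra.
(* A linear form that is bounded below on a subspace vanishes on it. *)
have perp x g : A x g -> H x w0 = 0.
  move=> xg; have [//|ne] := eqVneq (H x w0) 0.
  have := orth _ _ (graphZ ((H (z + w0) w0 - 1) / H x w0) xg).
  by rewrite formZl divfK//; lra.
have [xi [ka [xk rho0]]] := graph_range A w0 ltr01.
have xi0 : sn xi = 0.
  apply: sn_eq0; apply/eqP; rewrite eq_le form_ge0 andbT.
  have {1}-> : xi = ka + w0 + (xi - 1 *: ka - w0) by lmod; ring.
  rewrite formDl (form_sn0 _ rho0) addr0 formDl (formC H w0) (perp _ _ xk) addr0 formC.
  by apply: le_trans (graph_diss xk) _; rewrite mulNr oppr_le0 mulr_ge0// form_ge0.
have w00 : sn w0 = 0.
  have -> : w0 = xi - ka - (xi - 1 *: ka - w0) by lmod; ring.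
  by apply: sn_null0; [apply: sn_null0|]; rewrite ?snN// (graph_fun xk).
move=> e0; have [n hn] := halves_small 2 e0.
exists (J (al n)^-1 z), (al n *: w (al n)); split; first exact: xn.
rewrite -wE; apply: le_trans hn.
apply: le_trans (sn_le_dist H _ w0) _; rewrite w00 add0r sn_dist.
by have := hw0 n; rewrite mulr1.
Qed.

(** The resolvent maps the domain of [A] into that of [A^2]. *)
Lemma domain2_dense z e : 0 < e ->
  exists x g f, [/\ A x g, A g f & sn (x - z) <= e].
Proof.
move=> e0; have e20 : 0 < e / 2 by rewrite divr_gt0.
have [x [g [xg xz]]] := domain_dense z e20.
have g1 : 0 < 2 * (sn g + 1) by rewrite mulr_gt0// ltr_wpDl// sn_ge0.
pose h := e / (2 * (sn g + 1)); have h0 : 0 < h by rewrite divr_gt0.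
exists (J h x), (J h g), (h^-1 *: (J h g - g)); split.
- exact: J_graph.
- exact: JP.
- rewrite [e]splitr; apply: le_trans (sn_tri H x _ _) _; apply: lerD => //.
  apply: le_trans (J_diff xg h0) _; rewrite /h mulrAC ler_pdivrMr//.
  have := sn_ge0 H g; nra.
Qed.

(** The domain of [A^2], with a bound on [A^2 y]. *)
Definition smooth y (K : R) := exists g f, [/\ A y g, A g f & sn f <= K].

Lemma smooth_J y K h : smooth y K -> 0 < h -> smooth (J h y) K.
Proof.
move=> [g [f [yg gf fK]]] h0; exists (J h g), (J h f).
by split; [exact: J_graph|exact: J_graph|exact: le_trans (J_le f h0) fK].
Qed.

Lemma J_null x g h : A x g -> 0 < h -> sn (J h x - h *: J h g - x) = 0.
Proof.
move=> xg h0; have := graph_fun (graphB (JP x h0) (J_graph xg h0)).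
rewrite subrr sn0 => /(_ erefl) E.
have -> : J h x - h *: J h g - x = h *: (h^-1 *: (J h x - x) - J h g).
  by lmod; field; rewrite gt_eqF.
by rewrite snZ E mulr0.
Qed.

(** Two steps of length [h] differ from one step of length [2 h] by the term
    [h^2 A^2] of the expansion of [(1 - h A)^2]. *)
Lemma J_halve y K h : smooth y K -> 0 < h ->
  sn (J h (J h y) - J (2 * h) y) <= h ^+ 2 * K.
Proof.
move=> [g [f [yg gf fK]]] h0; have h20 : 0 < 2 * h by rewrite mulr_gt0.
have Jyg := J_graph yg h0; have JJ := J_graph Jyg h0.
apply: le_trans (J_dist y JJ h20) _.
have -> : J h (J h y) - (2 * h) *: J h (J h g) - y =
    ((J h (J h y) - h *: J h (J h g) - J h y) + (J h y - h *: J h g - y))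
    - h *: (J h (J h g) - J h g) by lmod; ring.
apply: le_trans (snB _ _ _) _.
rewrite (sn_null0 (J_null Jyg h0) (J_null yg h0)) add0r snZ gtr0_norm//.
rewrite expr2 -mulrA ler_wpM2l ?(ltW h0)//.
apply: le_trans (J_diff (J_graph gf h0) h0) _; rewrite ler_wpM2l ?(ltW h0)//.
exact: le_trans (J_le f h0) fK.
Qed.

(** The result of [n] steps of length [h] of the implicit Euler scheme. *)
Definition U h n x := iter n (J h) x.

Lemma U_contr h n x y : 0 < h -> sn (U h n x - U h n y) <= sn (x - y).
Proof.
move=> h0; elim: n => //= n IH; exact: le_trans (J_contr _ _ h0) IH.
Qed.

Lemma U_le h n x : 0 < h -> sn (U h n x) <= sn x.
Proof. by move=> h0; elim: n => //= n IH; exact: le_trans (J_le _ h0) IH. Qed.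

Lemma U_add h n m x : U h (n + m) x = U h n (U h m x).
Proof. by rewrite /U iterD. Qed.

Lemma U_smooth h n x K : 0 < h -> smooth x K -> smooth (U h n x) K.
Proof. by move=> h0 xK; elim: n => //= n IH; exact: smooth_J. Qed.

Lemma U_diff h n x g : 0 < h -> A x g -> sn (U h n x - x) <= n%:R * (h * sn g).
Proof.
move=> h0 xg; elim: n => [|n IH]; first by rewrite subrr sn0 mul0r.
rewrite -addn1 natrD mulrDl mul1r addn1 /=.
apply: le_trans (sn_tri H (J h x) _ _) _; apply: lerD; last exact: J_diff.
exact: le_trans (J_contr _ _ h0) IH.
Qed.

Lemma U_dist h n m x g : 0 < h -> A x g -> (n <= m)%N ->
  sn (U h m x - U h n x) <= (m - n)%:R * (h * sn g).
Proof.
move=> h0 xg nm; rewrite -{1}(subnKC nm) U_add.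
exact: le_trans (U_contr _ _ _ h0) (U_diff _ h0 xg).
Qed.

(** The local errors bounded by [J_halve] add up without amplification, as the
    steps are contractions. *)
Lemma U_halve h n x K : 0 < h -> smooth x K ->
  sn (U h n.*2 x - U (2 * h) n x) <= n%:R * (h ^+ 2 * K).
Proof.
move=> h0 xK; have h20 : 0 < 2 * h by rewrite mulr_gt0.
elim: n => [|n IH]; first by rewrite subrr sn0 mul0r.
rewrite -addn1 natrD [leRHS]mulrDl mul1r addn1 doubleS /=.
apply: le_trans (sn_tri H (J h (J h (U (2 * h) n x))) _ _) _; apply: lerD.
  by apply: le_trans (J_contr _ _ h0) (le_trans (J_contr _ _ h0) IH).
exact: J_halve (U_smooth n h20 xK) h0.
Qed.

Section smooth_orbit.
Variables (x g : V) (K : R).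
Hypotheses (xg : A x g) (xK : smooth x K).

Let h_ n : R := (2 ^+ n)^-1.

Let h_gt0 n : 0 < h_ n. Proof. by rewrite invr_gt0 exprn_gt0. Qed.

Let h_double n : 2 * h_ n.+1 = h_ n.
Proof. by rewrite /h_ exprS; field; rewrite expf_neq0 ?pnatr_eq0. Qed.

Let h_le1 n : h_ n <= 1.
Proof. by rewrite invf_le1 ?exprn_gt0// exprn_ege1 ?ler1n. Qed.

(** The number of steps of length [h_ n] up to time [t]. *)
Let k_ n t := Num.truncn (t * 2 ^+ n).

Let kP n t : 0 <= t -> (k_ n t)%:R * h_ n <= t < (k_ n t)%:R * h_ n + h_ n.
Proof.
move=> t0; have p0 : (0 : R) < 2 ^+ n by rewrite exprn_gt0.
have := truncn_itv (mulr_ge0 t0 (ltW p0)); rewrite -/(k_ n t) -[(k_ n t).+1%:R]natr1.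
rewrite /h_ => /andP[k1 k2]; apply/andP; split; first by rewrite ler_pdivrMr.
by rewrite -{2}[(2 ^+ n)^-1]mul1r -mulrDl ltr_pdivlMr.
Qed.

Let k_double n t : 0 <= t -> ((k_ n t).*2 <= k_ n.+1 t <= (k_ n t).*2.+1)%N.
Proof.
move=> t0; have /andP[a1 a2] := kP n t0; have /andP[b1 b2] := kP n.+1 t0.
have hd := h_double n; have h1 := h_gt0 n.+1.
have D : (k_ n t).*2%:R * h_ n.+1 = (k_ n t)%:R * h_ n.
  by rewrite -mul2n natrM -hd; ring.
apply/andP; split.
  by rewrite -ltnS -(ltr_nat R) -[(k_ n.+1 t).+1%:R]natr1 -(ltr_pM2r h1) mulrDl mul1r D; lra.
rewrite -ltnS -(ltr_nat R) -(ltr_pM2r h1) -[(k_ n t).*2.+1.+1%:R]natr1.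
by rewrite -[(k_ n t).*2.+1%:R]natr1 !mulrDl mul1r D; lra.
Qed.

Let Y_ n t := U (h_ n) (k_ n t) x.

(** The sum over the end points of the steps, for which [A W_ = Y_ - x] holds
    exactly. *)
Let W_ n t := \sum_(0 <= j < k_ n t) h_ n *: U (h_ n) j.+1 x.

Let sg0 := sn_ge0 H g.
Let sx0 := sn_ge0 H x.
Let K0 : 0 <= K. Proof. by case: xK => ? [f [_ _ /(le_trans (sn_ge0 H f))]]. Qed.

Let step n j : sn (U (h_ n.+1) j.*2 x - U (h_ n) j x) <= j%:R * h_ n * h_ n * K.
Proof.
have := U_halve j (h_gt0 n.+1) xK; rewrite h_double => /le_trans; apply.
have := h_gt0 n.+1; rewrite -(h_double n); set h := h_ n.+1 => h0.
rewrite -!mulrA ler_wpM2l ?ler0n//.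
have h2 : 0 <= h ^+ 2 * K by rewrite mulr_ge0 ?sqr_ge0.
by rewrite (_ : 2 * (h * (2 * (h * K))) = 4 * (h ^+ 2 * K)); [lra|ring].
Qed.

Let Y_cauchy n t : 0 <= t -> sn (Y_ n.+1 t - Y_ n t) <= (t * K + sn g) / 2 ^+ n.
Proof.
move=> t0; have /andP[a1 a2] := kP n t0; have /andP[b1 b2] := k_double n t0.
rewrite -/(h_ n) mulrDl.
apply: le_trans (sn_tri H (U (h_ n.+1) (k_ n t).*2 x) _ _) _.
rewrite addrC; apply: lerD.
  apply: le_trans (step n (k_ n t)) _.
  by rewrite mulrAC ler_wpM2r ?(ltW (h_gt0 n))// ler_wpM2r.
apply: le_trans (U_dist (h_gt0 _) xg b1) _.
have b3 : ((k_ n.+1 t - (k_ n t).*2)%:R : R) <= 1 by rewrite lern1 leq_subLR addn1.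
have hh := h_double n; have h1 := h_gt0 n.+1.
have hg : 0 <= h_ n.+1 * sn g by rewrite mulr_ge0// ltW.
apply: le_trans (ler_wpM2r hg b3) _; rewrite -hh; lra.
Qed.

Let W_cauchy n t : 0 <= t ->
  sn (W_ n.+1 t - W_ n t) <= (t * (t * K + sn g) + sn x) / 2 ^+ n.
Proof.
move=> t0; have /andP[a1 a2] := kP n t0; have /andP[b1 b2] := k_double n t0.
have hd := h_double n; have h1 := h_gt0 n.+1.
rewrite -/(h_ n); set k := k_ n t in a1 a2 b1 b2 *.
have split_sum : W_ n.+1 t - W_ n t =
    \sum_(k.*2 <= j < k_ n.+1 t) h_ n.+1 *: U (h_ n.+1) j.+1 x +
    \sum_(0 <= j < k) h_ n.+1 *: ((U (h_ n.+1) j.*2.+1 x - U (h_ n) j.+1 x) +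
                                 (U (h_ n.+1) j.+1.*2 x - U (h_ n) j.+1 x)).
  rewrite /W_ (big_cat_nat (n := k.*2))//= -/k.
  have -> : \sum_(0 <= j < k.*2) h_ n.+1 *: U (h_ n.+1) j.+1 x =
      \sum_(0 <= j < k) h_ n.+1 *: (U (h_ n.+1) j.*2.+1 x + U (h_ n.+1) j.+1.*2 x).
    elim: k {a1 a2 b1 b2} => [|m IH]; first by rewrite !big_nil.
    by rewrite doubleS !big_nat_recr//= IH -addrA -scalerDr.
  rewrite addrAC addrC -sumrB; congr (_ + _); apply: eq_bigr => j _.
  rewrite -hd; lmod; ring.
rewrite split_sum mulrDl addrC; apply: le_trans (snD _ _ _) _; apply: lerD.
  apply: le_trans (sn_sum _ _ _) _.
  apply: (@le_trans _ _ (\sum_(0 <= j < k) h_ n * (h_ n * (t * K + sn g)))).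
    rewrite big_nat_cond [leRHS]big_nat_cond; apply: ler_sum => j /andP[/andP[_ jk] _].
    have jt : j.+1%:R * h_ n <= t.
      by apply: le_trans a1; rewrite ler_wpM2r ?(ltW (h_gt0 n))// ler_nat.
    have S1 : sn (U (h_ n.+1) j.+1.*2 x - U (h_ n) j.+1 x) <= t * h_ n * K.
      apply: le_trans (step n j.+1) _; rewrite ler_wpM2r// ler_wpM2r//.
      exact: ltW.
    have S2 : sn (U (h_ n.+1) j.*2.+1 x - U (h_ n.+1) j.+1.*2 x) <= h_ n.+1 * sn g.
      rewrite sn_dist; have := U_dist h1 xg (leqnSn j.*2.+1).
      by rewrite subSnn mul1r.
    have S3 := sn_tri H (U (h_ n.+1) j.+1.*2 x) (U (h_ n.+1) j.*2.+1 x) (U (h_ n) j.+1 x).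
    rewrite snZ gtr0_norm//.
    apply: (@le_trans _ _ (h_ n.+1 * (2 * (t * h_ n * K) + h_ n.+1 * sn g))).
      rewrite ler_wpM2l ?(ltW h1)//; apply: le_trans (snD _ _ _) _; lra.
    rewrite -hd; have : 0 <= h_ n.+1 * h_ n.+1 * sn g.
      by rewrite !mulr_ge0 ?(ltW h1).
    lra.
  rewrite sumr_const_nat subn0 -mulr_natl mulrA [leRHS]mulrAC -[leRHS]mulrA.
  rewrite ler_wpM2r//; rewrite mulr_ge0 ?(ltW (h_gt0 n))// addr_ge0// mulr_ge0//.
apply: le_trans (sn_sum _ _ _) _.
apply: (@le_trans _ _ (\sum_(k.*2 <= j < k_ n.+1 t) h_ n.+1 * sn x)).
  apply: ler_sum => j _; rewrite snZ gtr0_norm// ler_wpM2l ?(ltW h1)//.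
  exact: U_le.
have hx : 0 <= h_ n.+1 * sn x by rewrite mulr_ge0 ?(ltW h1).
rewrite sumr_const_nat -mulr_natl.
have b3 : ((k_ n.+1 t - k.*2)%:R : R) <= 1 by rewrite lern1 leq_subLR addn1.
by apply: le_trans (ler_wpM2r hx b3) _; rewrite -hd; lra.
Qed.

(** The Euler approximations [Y_] converge uniformly on bounded intervals, and
    so do their sums [W_].  The limit of [W_] is the integral of that of [Y_],
    and the relation [A W_ = Y_ - x] passes to the limit since [A] is closed. *)
Lemma smooth_mild : exists Y, mild A x Y.
Proof.
pose CY t := t * K + sn g; pose CW t := t * (t * K + sn g) + sn x.
have CY0 t : 0 <= t -> 0 <= CY t by move=> t0; rewrite addr_ge0// mulr_ge0.
have CW0 t : 0 <= t -> 0 <= CW t.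
  by move=> t0; rewrite addr_ge0// mulr_ge0// CY0.
have /choice [Y hY] : forall t, exists y, 0 <= t ->
    forall n, sn (y - Y_ n t) <= 2 * CY t / 2 ^+ n.
  move=> t; have [t0|t0] := leP 0 t; last by exists 0.
  by have [y hy] := sn_complete (CY0 t t0) (fun n => Y_cauchy n t0); exists y.
have /choice [W hW] : forall t, exists y, 0 <= t ->
    forall n, sn (y - W_ n t) <= 2 * CW t / 2 ^+ n.
  move=> t; have [t0|t0] := leP 0 t; last by exists 0.
  by have [y hy] := sn_complete (CW0 t t0) (fun n => W_cauchy n t0); exists y.
have k_mono n s r : 0 <= s -> s <= r -> (k_ n s <= k_ n r)%N.
  by move=> s0 sr; apply: le_truncn; rewrite ler_wpM2r// exprn_ge0.
have k_diff n s r : 0 <= s -> s <= r ->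
    `|(k_ n r - k_ n s)%:R * h_ n - (r - s)| <= h_ n.
  move=> s0 sr; have r0 := le_trans s0 sr.
  have /andP[a1 a2] := kP n s0; have /andP[b1 b2] := kP n r0.
  rewrite natrB ?k_mono// ler_norml; apply/andP; split; lra.
have lip s r : 0 <= s -> s <= r -> sn (Y r - Y s) <= (r - s) * sn g.
  move=> s0 sr; have r0 := le_trans s0 sr.
  apply: (@le_of_halves _ _ _ (2 * CY r + 2 * CY s + sn g)) => n.
  have T1 : sn (Y_ n r - Y_ n s) <= (r - s + h_ n) * sn g.
    apply: le_trans (U_dist (h_gt0 n) xg (k_mono n s r s0 sr)) _.
    rewrite mulrA ler_wpM2r//.
    by have := k_diff n s r s0 sr; rewrite ler_norml => /andP[_]; lra.
  have T2 := hY r r0 n; have T3 := hY s s0 n.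
  have -> : Y r - Y s = (Y r - Y_ n r) - (Y s - Y_ n s) + (Y_ n r - Y_ n s).
    by lmod; ring.
  apply: le_trans (snD _ _ _) _; apply: le_trans (lerD (snB _ _ _) (lexx _)) _.
  rewrite !mulrDl; move: T1 T2 T3; rewrite /h_; lra.
have W0 : sn (W 0) = 0.
  apply: sn_le0; apply: (@le_of_halves _ _ _ (2 * CW 0)) => n; rewrite add0r.
  have := hW 0 (lexx 0) n; rewrite /W_ /k_ mul0r truncn0 big_nil subr0; exact.
have incr s r s' : 0 <= s -> s <= r -> r <= s' ->
    sn (W s' - W s - (s' - s) *: Y r) <= (s' - s) ^+ 2 * sn g.
  move=> s0 sr rs'; have r0 := le_trans s0 sr; have s'0 := le_trans r0 rs'.
  have ss' := le_trans sr rs'.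
  pose D := s' - s; have D0 : 0 <= D by rewrite subr_ge0.
  apply: (@le_of_halves _ _ _ (2 * CW s' + 2 * CW s + D * (2 * CY r) +
    (2 * D * sn g + sn g + sn x))) => n.
  have hn0 := h_gt0 n; have hn1 := h_le1 n.
  have km := k_diff n s s' s0 ss'.
  set m := (k_ n s' - k_ n s)%N in km.
  have T1 : sn (W_ n s' - W_ n s - (m%:R * h_ n) *: Y_ n r) <= (D + h_ n) ^+ 2 * sn g.
    have -> : W_ n s' - W_ n s - (m%:R * h_ n) *: Y_ n r =
        \sum_(k_ n s <= j < k_ n s') h_ n *: (U (h_ n) j.+1 x - Y_ n r).
      rewrite /W_ (big_cat_nat (n := k_ n s) (p := k_ n s'))//=; last exact: k_mono.
      rewrite [X in X - _ = _]addrAC subrr add0r.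
      under [RHS]eq_bigr do rewrite scalerBr.
      rewrite sumrB sumr_const_nat; congr (_ - _).
      by rewrite -[RHS]scaler_nat scalerA.
    apply: le_trans (sn_sum _ _ _) _.
    apply: (@le_trans _ _ (\sum_(k_ n s <= j < k_ n s') h_ n * ((D + h_ n) * sn g))).
      rewrite big_nat_cond [leRHS]big_nat_cond; apply: ler_sum => j /andP[/andP[j1 j2] _].
      rewrite snZ gtr0_norm// ler_wpM2l ?(ltW hn0)// /Y_.
      have k1 := k_mono n s r s0 sr; have k2 := k_mono n r s' r0 rs'.
      have mD : m%:R * h_ n <= D + h_ n.
        by move: km; rewrite ler_norml => /andP[_]; rewrite /D; lra.
      have key i i' : (i <= i')%N -> (i' - i <= m)%N ->
          sn (U (h_ n) i' x - U (h_ n) i x) <= (D + h_ n) * sn g.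
        move=> ii' im; apply: le_trans (U_dist hn0 xg ii') _.
        rewrite mulrA ler_wpM2r//; apply: le_trans mD.
        by rewrite ler_wpM2r ?(ltW hn0)// ler_nat.
      have [kj|jk] := leqP (k_ n r) j.+1.
        by apply: key => //; apply: leq_sub.
      rewrite sn_dist; apply: key; first exact: ltnW.
      by apply: leq_sub => //; exact: leqW.
    rewrite sumr_const_nat -/m -mulr_natl mulrA expr2 -[leRHS]mulrA ler_wpM2r//.
      by rewrite mulr_ge0// addr_ge0// ltW.
    by move: km; rewrite ler_norml => /andP[_]; rewrite /D; lra.
  have T2 := hW s' s'0 n; have T3 := hW s s0 n; have T4 := hY r r0 n.
  have T5 : sn (Y_ n r) <= sn x by exact: U_le.
  have -> : W s' - W s - (s' - s) *: Y r = (W s' - W_ n s') - (W s - W_ n s)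
      - D *: (Y r - Y_ n r)
      + (W_ n s' - W_ n s - (m%:R * h_ n) *: Y_ n r + (m%:R * h_ n - D) *: Y_ n r).
    by rewrite /D; lmod; ring.
  have T6 : sn ((m%:R * h_ n - D) *: Y_ n r) <= h_ n * sn x.
    by rewrite snZ ler_pM// sn_ge0.
  have T7 : sn (D *: (Y r - Y_ n r)) <= D * (2 * CY r / 2 ^+ n).
    by rewrite snZ ger0_norm// ler_wpM2l.
  apply: le_trans (snD _ _ _) _.
  apply: le_trans (lerD (snB _ _ _) (snD _ _ _)) _.
  have B1 := snB H (W s' - W_ n s') (W s - W_ n s).
  have hh : h_ n ^+ 2 * sn g <= h_ n * sn g.
    by rewrite ler_wpM2r// expr2 ler_piMl// ltW.
  rewrite -/D.
  have -> : (2 * CW s' + 2 * CW s + D * (2 * CY r) + (2 * D * sn g + sn g + sn x)) / 2 ^+ n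
    = 2 * CW s' / 2 ^+ n + 2 * CW s / 2 ^+ n + D * (2 * CY r / 2 ^+ n) +
      (2 * D * (h_ n * sn g) + h_ n * sn g + h_ n * sn x) by rewrite /h_; ring.
  have E : (D + h_ n) ^+ 2 * sn g = D ^+ 2 * sn g + 2 * D * (h_ n * sn g) + h_ n ^+ 2 * sn g.
    by ring.
  move: T1 T2 T3 T6 T7 B1 hh; rewrite E; lra.
exists Y; split.
  move=> t t0 e e0.
  have g1 : 0 < sn g + 1 by rewrite ltr_wpDl.
  exists (e / (sn g + 1)); first by rewrite divr_gt0.
  move=> r r0; rewrite ltr_pdivlMr// => /ltW rt; apply: le_trans rt.
  have gle : sn g <= sn g + 1 by rewrite lerDl.
  have [tr|/ltW rt] := leP t r.
    apply: le_trans (lip t r t0 tr) _; rewrite ger0_norm ?subr_ge0//.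
    by rewrite ler_wpM2l// subr_ge0.
  rewrite sn_dist; apply: le_trans (lip r t r0 rt) _; rewrite distrC ger0_norm ?subr_ge0//.
  by rewrite ler_wpM2l// subr_ge0.
move=> t t0.
have iW : is_integral H Y t (W t) by apply: integral_lipschitz incr.
have AW n : A (W_ n t) (Y_ n t - x).
  rewrite /W_ /Y_; elim: (k_ n t) => [|m IH].
    by rewrite big_nil subrr; exact: graph0.
  rewrite big_nat_recr//=.
  have -> : J (h_ n) (U (h_ n) m x) - x = (U (h_ n) m x - x) +
     h_ n *: ((h_ n)^-1 *: (J (h_ n) (U (h_ n) m x) - U (h_ n) m x)).
    by lmod; field; rewrite gt_eqF.
  by apply: graphD => //; apply: graphZ; exact: JP.
pose C := 2 * CW t + 2 * CY t.
have [w Aw Ww] : exists2 w, A w (Y t - x) & sn (w - W t) = 0.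
  apply: (graph_closed (C := C) AW) => n.
    apply: le_trans (hW t t0 n) _; rewrite ler_wpM2r ?invr_ge0 ?exprn_ge0//.
    by rewrite /C lerDl mulr_ge0// CY0.
  have -> : Y t - x - (Y_ n t - x) = Y t - Y_ n t by lmod; ring.
  apply: le_trans (hY t t0 n) _; rewrite ler_wpM2r ?invr_ge0 ?exprn_ge0//.
  by rewrite /C lerDr mulr_ge0// CW0.
exists w, (Y t - x); split => //; first exact: integral_eq iW Ww.
by have -> : Y t - (x + (Y t - x)) = 0 by [lmod; ring]; rewrite sn0.
Qed.

End smooth_orbit.

(** Orbits of arbitrary data are uniform limits of orbits of smooth data, by
    [mild_dist]. *)
Lemma mild_exists y0 : exists Y, mild A y0 Y.
Proof.
have p0 (C : R) n : 0 <= C -> 0 <= C / 2 ^+ n by move=> C0; rewrite divr_ge0 ?exprn_ge0.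
have /choice [x_ hx] : forall n, exists x,
    (exists Y, mild A x Y) /\ sn (x - y0) <= 1 / 2 ^+ n.
  move=> n; have [|x [g [f [xg gf xy]]]] := @domain2_dense y0 (1 / 2 ^+ n).
    by rewrite divr_gt0// exprn_gt0.
  exists x; split => //; apply: (@smooth_mild x g (sn f) xg).
  by exists g, f.
have /choice [Y_ mY] : forall n, exists Y, mild A (x_ n) Y by move=> n; case: (hx n).
have x_dist n : sn (x_ n.+1 - x_ n) <= 2 / 2 ^+ n.
  apply: le_trans (sn_tri H y0 _ _) _; rewrite (sn_dist H y0).
  have := (hx n).2; have := (hx n.+1).2.
  have : (1 : R) / 2 ^+ n.+1 <= 1 / 2 ^+ n.
    by rewrite !div1r lef_pV2 ?posrE ?exprn_gt0// ler_weXn2l// ler1n.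
  lra.
have Y_dist n t : 0 <= t -> sn (Y_ n.+1 t - Y_ n t) <= 2 / 2 ^+ n.
  by move=> t0; apply: le_trans (mild_dist om0 (mY _) (mY _) t0) (x_dist n).
have /choice [Y hY] : forall t, exists y, 0 <= t ->
    forall n, sn (y - Y_ n t) <= 4 / 2 ^+ n.
  move=> t; have [t0|t0] := leP 0 t; last by exists 0.
  have [y hy] := sn_complete (ler0n R 2) (fun n => Y_dist n t t0).
  by exists y => _ n; have := hy n; rewrite -natrM.
exists Y; split.
  move=> t t0 e e0; have e30 : 0 < e / 3 by rewrite divr_gt0.
  have [n hn] := halves_small 4 e30.
  have [d d0 hd] := (mY n).1 t t0 _ e30; exists d => // r r0 rt.
  have -> : Y r - Y t = (Y r - Y_ n r) - (Y t - Y_ n t) + (Y_ n r - Y_ n t).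
    by lmod; ring.
  apply: le_trans (snD _ _ _) _; apply: le_trans (lerD (snB _ _ _) (lexx _)) _.
  have := hY r r0 n; have := hY t t0 n; have := hd r r0 rt; lra.
move=> t t0.
have /choice [w hw] : forall n, exists w, is_integral H (Y_ n) t w /\
    exists g, A w g /\ sn (Y_ n t - (x_ n + g)) = 0.
  by move=> n; have [w [g [h1 h2 h3]]] := (mY n).2 t t0; exists w; split => //; exists g.
have /choice [g hg] : forall n, exists g, A (w n) g /\ sn (Y_ n t - (x_ n + g)) = 0.
  by move=> n; case: (hw n).
have t20 : 0 <= t * 2 by rewrite mulr_ge0.
have [|w0 hw0] := @sn_complete _ _ H w (t * 2) t20.
  move=> n; rewrite -mulrA; apply: integral_dist t0 (hw _).1 (hw _).1 _ => r /andP[r0 _].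
  exact: Y_dist.
have iw0 : is_integral H Y t w0.
  move=> e e0; have e30 : 0 < e / 4 by rewrite divr_gt0.
  have [n hn] := halves_small (4 * (t + 1)) e30.
  have [d d0 hd] := (hw n).1 _ e30; exists d => // m s xi T.
  set S := \sum_(i < m) _; pose S' := \sum_(i < m) (s i.+1 - s i) *: Y_ n (xi i).
  have SS' : sn (S - S') <= t * (4 / 2 ^+ n).
    rewrite /S /S' -sumrB -{1}(tagged_sum T) mulr_suml.
    apply: le_trans (sn_sum _ _ _) _; apply: ler_sum => i _.
    have [h1 h2 h3 h4 h5] := tagged_mem T (ltn_ord i).
    rewrite -scalerBr snZ ger0_norm ?subr_ge0 ?(le_trans h2)//.
    by rewrite ler_wpM2l ?subr_ge0 ?(le_trans h2)// hY// (le_trans h1).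
  have -> : S - w0 = (S - S') + (S' - w n) - (w0 - w n) by lmod; ring.
  apply: le_lt_trans (snB _ _ _) _.
  apply: le_lt_trans (lerD (snD _ _ _) (lexx _)) _.
  have := hd _ _ _ T; rewrite -/S' => hS'; have := hw0 n.
  have := p0 4 n (ler0n R 4).
  move: hn SS'; lra.
pose C := t * 4 + 5.
have [w' Aw' ww'] : exists2 w', A w' (Y t - y0) & sn (w' - w0) = 0.
  apply: (graph_closed (C := C) (x_ := w) (g_ := g)) => n; first by case: (hg n).
    apply: le_trans (hw0 n) _; rewrite ler_wpM2r ?invr_ge0 ?exprn_ge0// /C; lra.
  have -> : Y t - y0 - g n = (Y t - Y_ n t) + (Y_ n t - (x_ n + g n)) + (x_ n - y0).
    by lmod; ring.
  apply: le_trans (snD _ _ _) _; apply: le_trans (lerD (snD _ _ _) (lexx _)) _.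
  rewrite (hg n).2 addr0; apply: le_trans (lerD (hY t t0 n) (hx n).2) _.
  by rewrite -mulrDl ler_wpM2r ?invr_ge0 ?exprn_ge0// /C; lra.
exists w', (Y t - y0); split => //; first exact: integral_eq iw0 ww'.
by have -> : Y t - (y0 + (Y t - y0)) = 0 by [lmod; ring]; rewrite sn0.
Qed.

End existence.

(** * The domain of the operator *)
Section domain.
Context {R : realType}.
Implicit Types (f g h F G P u v w p : R -> R) (x k a b c d eps : R) (y z : state R).
Local Notation lam := (@leb01 R).

Lemma H1L_wD u : H1L u -> u = prim (wD u) %[ae lam].
Proof.
move=> [Hu u0]; have [F [aF uF cF]] := H1_crep Hu; have [_ Lw FE] := aF.
apply: (ae01S uF) => x /andP[/ltW x0 /ltW x1] h X.
by rewrite h// FE ?x0// -cF ?lexx ?ler01// u0 add0r.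
Qed.

Lemma prim_wD u g : L2 u -> L2 g -> u = prim g %[ae lam] ->
  H1L u /\ wD u = g %[ae lam].
Proof.
move=> Lu Lg ug; have [H E c] := ac_H1 Lu (ac_prim Lg) ug.
by do 2 split => //; rewrite c ?lexx ?ler01// prim0.
Qed.

Lemma H2_ac u : H2 u -> exists F F1, [/\ ac F F1, ac F1 (wD (wD u)),
  u = F %[ae lam], wD u = F1 %[ae lam] &
  forall x, 0 <= x <= 1 -> crep u x = F x /\ crep (wD u) x = F1 x].
Proof.
move=> [Hu Hw]; have [F [aF uF cF]] := H1_crep Hu.
have [F1 [aF1 uF1 cF1]] := H1_crep Hw.
exists F, F1; split => //; last by move=> x x01; rewrite cF// cF1.
have [mF Lw FE] := aF; split => //; first exact: ac_L2 aF1.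
move=> x x01; rewrite FE//; congr (_ + _); apply: eq_prim => //.
  exact: L2_measurable.
by case: aF1.
Qed.

Lemma ac_H2 u F F1 f2 : L2 u -> ac F F1 -> ac F1 f2 -> u = F %[ae lam] ->
  [/\ H2 u, wD u = F1 %[ae lam], wD (wD u) = f2 %[ae lam] &
  forall x, 0 <= x <= 1 -> crep u x = F x /\ crep (wD u) x = F1 x].
Proof.
move=> Lu aF aF1 uF; have [Hu E c] := ac_H1 Lu aF uF.
have [Lw _] := wD_spec Hu.
have [Hw E2 c2] := ac_H1 Lw aF1 E.
by split => // x x01; rewrite c// c2.
Qed.

(** The elements of the domain, described by the continuous representatives [F],
    [F1] of [u], [u_x], [G] of [v] and [P], [P1] of [p], [p_x], and by the
    derivatives [f2], [g], [p2] of [F1], [G], [P1]. *)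
Record reps (a b c d : R) y F F1 f2 G g P P1 p2 : Prop := Reps {
  acF : ac F F1; acF1 : ac F1 f2; F_0 : F 0 = 0;
  acG : ac G g; G_0 : G 0 = 0;
  acP : ac P P1; acP1 : ac P1 p2;
  u_F : st_u y = F %[ae lam]; v_G : st_v y = G %[ae lam]; p_P : st_p y = P %[ae lam];
  bc_wave : F1 1 = - a * G 1 + b * P 0;
  bc_heat0 : P1 0 = c * P 0;
  bc_heat1 : P1 1 = d * F 1 }.

Lemma domA_reps a b c d y : domA a b c d y ->
  exists F F1 G P P1, reps a b c d y F F1 (wD (wD (st_u y))) G (wD (st_v y))
    P P1 (wD (wD (st_p y))).
Proof.
move=> [[Hu [_ u0]] [Hv v0] Hp [b1 b2 b3]].
have [F [F1 [aF aF1 uF uF1 cF]]] := H2_ac Hu.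
have [P [P1 [aP aP1 pP pP1 cP]]] := H2_ac Hp.
have [G [aG vG cG]] := H1_crep Hv.
have i0 : 0 <= (0 : R) <= 1 by rewrite lexx ler01.
have i1 : 0 <= (1 : R) <= 1 by rewrite lexx ler01.
exists F, F1, G, P, P1; split => //.
- by rewrite -(cF 0 i0).1.
- by rewrite -cG.
- by rewrite -(cF 1 i1).2 -cG// -(cP 0 i0).1.
- by rewrite -(cP 0 i0).2 -(cP 0 i0).1.
- by rewrite -(cP 1 i1).2 -(cF 1 i1).1.
Qed.

Lemma reps_domA a b c d y F F1 f2 G g P P1 p2 : L2 (st_u y) -> L2 (st_v y) ->
  L2 (st_p y) -> reps a b c d y F F1 f2 G g P P1 p2 ->
  [/\ domA a b c d y, wD (wD (st_u y)) = f2 %[ae lam] &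
      wD (wD (st_p y)) = p2 %[ae lam]].
Proof.
move=> Lu Lv Lp [aF aF1 F0 aG G0 aP aP1 uF vG pP b1 b2 b3].
have [Hu _ E1 cF] := ac_H2 Lu aF aF1 uF.
have [Hp _ E2 cP] := ac_H2 Lp aP aP1 pP.
have [Hv _ cG] := ac_H1 Lv aG vG.
have i0 : 0 <= (0 : R) <= 1 by rewrite lexx ler01.
have i1 : 0 <= (1 : R) <= 1 by rewrite lexx ler01.
split => //; split => //.
- split => //; split; first by case: Hu.
  by rewrite (cF 0 i0).1.
- by split => //; rewrite cG.
- split.
  + by rewrite (cF 1 i1).2 cG// (cP 0 i0).1.
  + by rewrite (cP 0 i0).2 (cP 0 i0).1.
  + by rewrite (cP 1 i1).2 (cF 1 i1).1.
Qed.

Lemma inH_L2 y : inH y -> [/\ L2 (st_u y), L2 (wD (st_u y)), L2 (st_v y) & L2 (st_p y)].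
Proof. by move=> [[Hu _] Lv Lp]; have [Lu _] := Hu; have [Lw _] := wD_spec Hu. Qed.

Lemma aeq_lin k f f' g g' : f = f' %[ae lam] -> g = g' %[ae lam] ->
  (fun x => f x + k * g x) = (fun x => f' x + k * g' x) %[ae lam].
Proof. by move=> ff gg; apply: (ae01S2 ff gg) => x _ h1 h2 X; rewrite h1// h2. Qed.

Lemma ac_lin k F f G g : ac F f -> ac G g ->
  ac (fun x => F x + k * G x) (fun x => f x + k * g x).
Proof. by move=> aF aG; exact: acD aF (acZ k aG). Qed.

Lemma reps_lin k a b c d y F F1 f2 G g P P1 p2 z F' F1' f2' G' g' P' P1' p2' :
  reps a b c d y F F1 f2 G g P P1 p2 ->
  reps a b c d z F' F1' f2' G' g' P' P1' p2' ->
  reps a b c d (y + k *: z) (fun x => F x + k * F' x) (fun x => F1 x + k * F1' x)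
    (fun x => f2 x + k * f2' x) (fun x => G x + k * G' x) (fun x => g x + k * g' x)
    (fun x => P x + k * P' x) (fun x => P1 x + k * P1' x) (fun x => p2 x + k * p2' x).
Proof.
move=> [aF aF1 F0 aG G0 aP aP1 uF vG pP b1 b2 b3].
move=> [aF' aF1' F0' aG' G0' aP' aP1' uF' vG' pP' b1' b2' b3'].
split; try exact: ac_lin.
- by rewrite F0 F0' mulr0 addr0.
- by rewrite G0 G0' mulr0 addr0.
- exact: aeq_lin uF uF'.
- exact: aeq_lin vG vG'.
- exact: aeq_lin pP pP'.
- by rewrite b1 b1'; ring.
- by rewrite b2 b2'; ring.
- by rewrite b3 b3'; ring.
Qed.

Lemma H1L_lin k u v : H1L u -> H1L v -> H1L (fun x => u x + k * v x) /\
  wD (fun x => u x + k * v x) = (fun x => wD u x + k * wD v x) %[ae lam].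
Proof.
move=> Hu Hv; have [[[Lu _] _] [[Lv _] _]] := (Hu, Hv).
have [Lu1 _] := wD_spec Hu.1; have [Lv1 _] := wD_spec Hv.1.
have Lk := L2Z k Lv1.
apply: prim_wD; [exact: L2D Lu (L2Z k Lv)|exact: L2D|].
apply: aeq_trans (aeq_lin k (H1L_wD Hu) (H1L_wD Hv)) _.
by apply: ae01 => x _ _; rewrite primD// primZ.
Qed.

Lemma inH_lin k y z : inH y -> inH z -> inH (y + k *: z).
Proof.
move=> [Hu Lv Lp] [Hu' Lv' Lp']; split.
- exact: (H1L_lin k Hu Hu').1.
- exact: L2D Lv (L2Z k Lv').
- exact: L2D Lp (L2Z k Lp').
Qed.

Lemma inH0 : inH (0 : state R).
Proof.
split; try exact: (L2_cst 0).
apply: (prim_wD (L2_cst 0) (L2_cst 0) _).1.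
by apply: ae01 => x _ _; rewrite prim_cst0.
Qed.

Lemma reps0 a b c d : reps a b c d 0 (cst 0) (cst 0) (cst 0) (cst 0) (cst 0)
  (cst 0) (cst 0) (cst 0).
Proof. by split => //; try exact: ac_cst; try exact: ae01; rewrite /= ?(mulr0, addr0). Qed.

End domain.

(** * The energy space *)
Section energy_type.
Context {R : realType}.

Definition energy_pred : {pred state R} := fun y => `[< inH y >].

Lemma energy_predP (y : state R) : reflect (inH y) (y \in energy_pred).
Proof. by rewrite /energy_pred unfold_in; exact: asboolP. Qed.

Lemma energy_submod_closed : submod_closed energy_pred.
Proof.
split; first by apply/energy_predP; exact: inH0.
move=> k y z /energy_predP Hy /energy_predP Hz; apply/energy_predP.
by rewrite addrC; exact: inH_lin.
Qed.

HB.instance Definition _ :=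
  GRing.isSubmodClosed.Build R (state R) energy_pred energy_submod_closed.

Record energy_space := EnergySpace {
  hval :> state R; hvalP : hval \in energy_pred }.

HB.instance Definition _ := [isSub for hval].
HB.instance Definition _ := [Choice of energy_space by <:].
HB.instance Definition _ := [SubChoice_isSubLmodule of energy_space by <:].

Lemma hval_inH (y : energy_space) : inH (hval y).
Proof. exact/energy_predP/hvalP. Qed.

Definition mkE (y : state R) (Hy : inH y) : energy_space :=
  EnergySpace (introT (energy_predP y) Hy).

End energy_type.
Arguments energy_space R : clear implicits.

Section energy_form.
Context {R : realType}.
Variables (eps mu : R).
Hypotheses (eps0 : 0 < eps) (mu0 : 0 < mu).
Implicit Types (f g h : R -> R) (k : R) (y z w : energy_space R).
Local Notation lam := (@leb01 R).

Definition weight f := measurable_fun setT f /\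
  forall x, 0 < x < 1 -> expR (- mu) <= f x <= expR mu.

Definition wplus (x : R) := expR (mu * x).
Definition wminus (x : R) := expR (- mu * x).

Lemma weight_plus : weight wplus.
Proof.
split.
  apply: continuous_measurable_fun => x.
  apply: (continuous_comp (f := fun x => mu * x)); last exact: continuous_expR.
  by apply: cvgM; [exact: cvg_cst|exact: cvg_id].
move=> x /andP[x0 x1]; rewrite /wplus !ler_expR.
have : 0 <= mu * x by rewrite mulr_ge0 ?(ltW mu0) ?(ltW x0).
have : mu * x <= mu by rewrite ler_piMr ?(ltW mu0) ?(ltW x1).
by move=> h1 h2; apply/andP; split; lra.
Qed.

Lemma weight_minus : weight wminus.
Proof.
split.
  apply: continuous_measurable_fun => x.
  apply: (continuous_comp (f := fun x => - mu * x)); last exact: continuous_expR.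
  by apply: cvgM; [exact: cvg_cst|exact: cvg_id].
move=> x /andP[x0 x1]; rewrite /wminus !ler_expR mulNr.
have : 0 <= mu * x by rewrite mulr_ge0 ?(ltW mu0) ?(ltW x0).
have : mu * x <= mu by rewrite ler_piMr ?(ltW mu0) ?(ltW x1).
by move=> h1 h2; apply/andP; split; lra.
Qed.

Lemma weight_L2 f g : weight f -> L2 g -> L2 (fun x => f x * g x).
Proof.
move=> [mf hf] Lg; apply: (@L2Mbounded _ _ _ (expR mu)) => // x /hf /andP[h1 h2].
by rewrite ger0_norm// (le_trans _ h1)// expR_ge0.
Qed.

Lemma weight_le f g : weight f -> L2 g ->
  expR (- mu) * ip g g <= ip (fun x => f x * g x) g <= expR mu * ip g g.
Proof.
move=> wf Lg; have Lfg := weight_L2 wf Lg; have [mf hf] := wf.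
rewrite -!ipZl//; apply/andP; split.
  apply: le_ip => //; first exact: L2Z.
  by move=> x /hf /andP[h1 _]; rewrite -!mulrA ler_wpM2r// -expr2 sqr_ge0.
apply: le_ip => //; first exact: L2Z.
by move=> x /hf /andP[_ h1]; rewrite -!mulrA ler_wpM2r// -expr2 sqr_ge0.
Qed.

Lemma weight_aeq f g g' h h' : weight f -> L2 g -> L2 g' -> L2 h -> L2 h' ->
  g = g' %[ae lam] -> h = h' %[ae lam] ->
  ip (fun x => f x * g x) h = ip (fun x => f x * g' x) h'.
Proof.
move=> wf Lg Lg' Lh Lh' gg hh; apply: eq_ip => //; try exact: L2_measurable.
- exact: L2_measurable (weight_L2 wf Lg).
- exact: L2_measurable (weight_L2 wf Lg').
- by apply: (ae01S gg) => x _ E X; rewrite E.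
Qed.

Lemma weight_lin f k g g' h : weight f -> L2 g -> L2 g' -> L2 h ->
  ip (fun x => f x * (g x + k * g' x)) h =
  ip (fun x => f x * g x) h + k * ip (fun x => f x * g' x) h.
Proof.
move=> wf Lg Lg' Lh; have L1 := weight_L2 wf Lg; have L2 := weight_L2 wf Lg'.
rewrite -ipZl// -ipDl//; last exact: L2Z.
by apply: eq_Rintegral => x _; ring.
Qed.

(** The Riemann invariants of the wave equation; the first one travels to the
    left, the second one to the right. *)
Definition riemann_plus (y : state R) x := st_v y x + wD (st_u y) x.
Definition riemann_minus (y : state R) x := st_v y x - wD (st_u y) x.

(** Each weight decreases in the direction in which the invariant travels.  The
    factor [eps] compensates the speed of diffusion, and one half balances the
    heat equation against the wave equation in the estimate of the coupling. *)
Definition energy (y z : state R) : R :=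
  ip (fun x => wplus x * riemann_plus y x) (riemann_plus z) +
  ip (fun x => wminus x * riemann_minus y x) (riemann_minus z) +
  eps / 2 * ip (st_p y) (st_p z).

Lemma riemann_plus_L2 (y : state R) : inH y -> L2 (riemann_plus y).
Proof. by move=> /inH_L2[_ Lw Lv _]; exact: L2D. Qed.

Lemma riemann_minus_L2 (y : state R) : inH y -> L2 (riemann_minus y).
Proof. by move=> /inH_L2[_ Lw Lv _]; exact: L2B. Qed.

Lemma riemann_plus_lin k (y z : state R) : inH y -> inH z ->
  riemann_plus (y + k *: z) = (fun x => riemann_plus y x + k * riemann_plus z x) %[ae lam].
Proof.
move=> [Hy _ _] [Hz _ _]; have [_ E] := H1L_lin k Hy Hz.
apply: (ae01S E) => x _ e X; rewrite /riemann_plus.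
have -> : st_v (y + k *: z) x = st_v y x + k * st_v z x by [].
by rewrite [X in _ + X]e//; ring.
Qed.

Lemma riemann_minus_lin k (y z : state R) : inH y -> inH z ->
  riemann_minus (y + k *: z) = (fun x => riemann_minus y x + k * riemann_minus z x) %[ae lam].
Proof.
move=> [Hy _ _] [Hz _ _]; have [_ E] := H1L_lin k Hy Hz.
apply: (ae01S E) => x _ e X; rewrite /riemann_minus.
have -> : st_v (y + k *: z) x = st_v y x + k * st_v z x by [].
by rewrite [X in _ - X]e//; ring.
Qed.

Lemma energy_lin k (y z w : state R) : inH y -> inH z -> inH w ->
  energy (y + k *: z) w = energy y w + k * energy z w.
Proof.
move=> Hy Hz Hw; have Hyz := inH_lin k Hy Hz.
have [[ry rz] rw] := (riemann_plus_L2 Hy, riemann_plus_L2 Hz, riemann_plus_L2 Hw).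
have [[ly lz] lw] := (riemann_minus_L2 Hy, riemann_minus_L2 Hz, riemann_minus_L2 Hw).
have Lr := L2D ry (L2Z k rz); have Ll := L2D ly (L2Z k lz).
have [_ _ _ py] := inH_L2 Hy; have [_ _ _ pz] := inH_L2 Hz.
have [_ _ _ pw] := inH_L2 Hw.
rewrite /energy.
rewrite (weight_aeq weight_plus (riemann_plus_L2 Hyz) Lr rw rw (riemann_plus_lin k Hy Hz) (aeq_refl _)).
rewrite (weight_aeq weight_minus (riemann_minus_L2 Hyz) Ll lw lw (riemann_minus_lin k Hy Hz) (aeq_refl _)).
rewrite (weight_lin k weight_plus)// (weight_lin k weight_minus)//.
have -> : ip (st_p (y + k *: z)) (st_p w) = ip (st_p y) (st_p w) + k * ip (st_p z) (st_p w).
  by rewrite -ipZl// -ipDl//; exact: L2Z.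
by do 6 move: (ip _ _) => ?; ring.
Qed.

Lemma energyC (y z : state R) : energy y z = energy z y.
Proof.
have sw (f g h : R -> R) : ip (fun x => f x * g x) h = ip (fun x => f x * h x) g.
  by apply: eq_Rintegral => x _; rewrite mulrAC.
rewrite /energy (sw wplus (riemann_plus y) (riemann_plus z)).
by rewrite (sw wminus (riemann_minus y) (riemann_minus z)) (ipC (st_p y) (st_p z)).
Qed.

(** The energy without weights and parameters, to which it is equivalent; it
    determines [u] because [u] vanishes at 0. *)
Definition flat_energy (y : state R) : R :=
  ip (wD (st_u y)) (wD (st_u y)) + ip (st_v y) (st_v y) + ip (st_p y) (st_p y).

Lemma flat_energy_ge0 (y : state R) : 0 <= flat_energy y.
Proof. by rewrite !addr_ge0// ip_ge0. Qed.

Lemma energy_lower (y : state R) : inH y ->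
  Num.min (2 * expR (- mu)) (eps / 2) * flat_energy y <= energy y y.
Proof.
move=> Hy; have /andP[r1 _] := weight_le weight_plus (riemann_plus_L2 Hy).
have /andP[l1 _] := weight_le weight_minus (riemann_minus_L2 Hy).
have [_ Lw Lv _] := inH_L2 Hy; have E := parallelogram Lv Lw.
have [[n1 n2] n3] := (ip_ge0 (wD (st_u y)), ip_ge0 (st_v y), ip_ge0 (st_p y)).
rewrite /energy /flat_energy mulrDr; apply: lerD.
  apply: le_trans _ (lerD r1 l1); rewrite -mulrDr E mulrA (mulrC _ 2).
  by rewrite ler_wpM2r ?addr_ge0// ge_min lexx.
by rewrite ler_wpM2r// ge_min lexx orbT.
Qed.

Lemma energy_upper (y : state R) : inH y ->
  energy y y <= (2 * expR mu + eps / 2) * flat_energy y.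
Proof.
move=> Hy; have /andP[_ r1] := weight_le weight_plus (riemann_plus_L2 Hy).
have /andP[_ l1] := weight_le weight_minus (riemann_minus_L2 Hy).
have [_ Lw Lv _] := inH_L2 Hy; have E := parallelogram Lv Lw.
have [[n1 n2] n3] := (ip_ge0 (wD (st_u y)), ip_ge0 (st_v y), ip_ge0 (st_p y)).
rewrite /energy.
apply: le_trans (lerD (lerD r1 l1) (lexx _)) _.
rewrite -mulrDr E /flat_energy.
have e0 := expR_ge0 mu; have e1 : 0 <= eps / 2 by rewrite divr_ge0 ?ltW.
have h1 := mulr_ge0 e0 n3; have h2 := mulr_ge0 e1 (addr_ge0 n1 n2).
lra.
Qed.

Lemma energy_const_gt0 : 0 < Num.min (2 * expR (- mu)) (eps / 2).
Proof. by rewrite lt_min mulr_gt0 ?expR_gt0//= divr_gt0. Qed.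

Lemma energy_ge0 (y : state R) : inH y -> 0 <= energy y y.
Proof.
move=> Hy; apply: le_trans (energy_lower Hy).
by rewrite mulr_ge0 ?flat_energy_ge0// ltW// energy_const_gt0.
Qed.

Lemma inH_sub (y z : state R) : inH y -> inH z -> inH (y - z).
Proof. by move=> Hy Hz; rewrite -scaleN1r; exact: inH_lin. Qed.

Lemma flat_energyB (y z : state R) : inH y -> inH z -> flat_energy (y - z) =
  nrm (fun x => wD (st_u y) x - wD (st_u z) x) ^+ 2 +
  nrm (fun x => st_v y x - st_v z x) ^+ 2 + nrm (fun x => st_p y x - st_p z x) ^+ 2.
Proof.
move=> Hy Hz; rewrite !nrm_sqr /flat_energy; suff -> : ip (wD (st_u (y - z))) (wD (st_u (y - z))) =
    ip (fun x => wD (st_u y) x - wD (st_u z) x) (fun x => wD (st_u y) x - wD (st_u z) x) by [].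
have [_ L1 _ _] := inH_L2 Hy; have [_ L2 _ _] := inH_L2 Hz.
have [_ L3 _ _] := inH_L2 (inH_sub Hy Hz); have L4 := L2B L1 L2.
have [Hu _ _] := Hy; have [Hu' _ _] := Hz.
have [_ E] := H1L_lin (-1) Hu Hu'.
have E' : wD (st_u (y - z)) = (fun x => wD (st_u y) x - wD (st_u z) x) %[ae lam].
  rewrite (_ : st_u (y - z) = fun x => st_u y x + -1 * st_u z x).
    by apply: (ae01S E) => x _ e X; rewrite e// mulN1r.
  by apply/funext => x; rewrite mulN1r.
by apply: eq_ip => //; exact: L2_measurable.
Qed.

Lemma inH_prim g v p : L2 g -> L2 v -> L2 p ->
  inH (prim g, v, p) /\ wD (prim g) = g %[ae lam].
Proof.
move=> Lg Lv Lp; have [h1 h2] := prim_wD (L2_prim Lg) Lg (aeq_refl _).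
by split.
Qed.

(** The limit of [u] is the primitive of the limit of its derivatives. *)
Lemma energy_complete (y_ : nat -> energy_space R) (C : R) : 0 <= C ->
  (forall n, energy (y_ n.+1 - y_ n) (y_ n.+1 - y_ n) <= (C / 2 ^+ n) ^+ 2) ->
  exists (y : energy_space R) C', forall n, energy (y - y_ n) (y - y_ n) <= (C' / 2 ^+ n) ^+ 2.
Proof.
move=> C0 hC; set ka := Num.min (2 * expR (- mu)) (eps / 2).
have ka0 : 0 < ka := energy_const_gt0.
have [D DE] : exists D, D = Num.sqrt ka^-1 * C by exists (Num.sqrt ka^-1 * C).
have D0 : 0 <= D by rewrite DE mulr_ge0// sqrtr_ge0.
have Hy n := hval_inH (y_ n).
have D2 : D ^+ 2 = ka^-1 * C ^+ 2 by rewrite DE exprMn sqr_sqrtr// invr_ge0 ltW.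
have fl n : flat_energy (y_ n.+1 - y_ n) <= (D / 2 ^+ n) ^+ 2.
  have := le_trans (energy_lower (inH_sub (Hy n.+1) (Hy n))) (hC n).
  by rewrite -/ka -ler_pdivlMl// => /le_trans; apply; rewrite !exprMn D2 mulrA.
have nrm_le (f : R -> R) n q : 0 <= q -> nrm f ^+ 2 + q <= (D / 2 ^+ n) ^+ 2 -> nrm f <= D / 2 ^+ n.
  move=> q0 h; have p : 0 <= D / 2 ^+ n by rewrite divr_ge0 ?exprn_ge0.
  by rewrite -(@ler_pXn2r _ 2)// ?nnegrE ?nrm_ge0//; apply: le_trans h; rewrite lerDl.
have {}fl n : _ <= (D / 2 ^+ n) ^+ 2 := eq_ind _ (fun q => q <= _) (fl n) _ (flat_energyB (Hy n.+1) (Hy n)).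
have Lw n : L2 (wD (st_u (y_ n))) by case: (inH_L2 (Hy n)).
have Lv n : L2 (st_v (y_ n)) by case: (inH_L2 (Hy n)).
have Lp n : L2 (st_p (y_ n)) by case: (inH_L2 (Hy n)).
have [g Lg gE] : exists2 g, L2 g & forall n, nrm (fun x => g x - wD (st_u (y_ n)) x) <= 2 * D / 2 ^+ n.
  apply: L2_complete => // n; have := fl n; rewrite -addrA.
  by apply: nrm_le; rewrite addr_ge0 ?sqr_ge0.
have [v Lv' vE] : exists2 v, L2 v & forall n, nrm (fun x => v x - st_v (y_ n) x) <= 2 * D / 2 ^+ n.
  apply: L2_complete => // n; have := fl n; rewrite [X in X + _]addrC -addrA.
  by apply: nrm_le; rewrite addr_ge0 ?sqr_ge0.
have [p Lp' pE] : exists2 p, L2 p & forall n, nrm (fun x => p x - st_p (y_ n) x) <= 2 * D / 2 ^+ n.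
  apply: L2_complete => // n; have := fl n; rewrite addrC.
  by apply: nrm_le; rewrite addr_ge0 ?sqr_ge0.
have [Hl wl] := inH_prim Lg Lv' Lp'.
exists (mkE Hl), (Num.sqrt (2 * expR mu + eps / 2) * (4 * D)) => n /=.
have k0 : 0 <= 2 * expR mu + eps / 2.
  by rewrite addr_ge0 ?divr_ge0 ?mulr_ge0 ?expR_ge0 ?ltW.
apply: le_trans (energy_upper (inH_sub Hl (Hy n))) _.
rewrite (flat_energyB Hl (Hy n)) -[X in _ <= X ^+ 2]mulrA exprMn (sqr_sqrtr k0) ler_wpM2l//.
have sq (f : R -> R) : nrm f <= 2 * D / 2 ^+ n -> nrm f ^+ 2 <= (2 * D / 2 ^+ n) ^+ 2.
  by move=> h; rewrite ler_pXn2r// nnegrE ?nrm_ge0// (le_trans (nrm_ge0 _) h).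
have -> : nrm (fun x => wD (st_u (prim g, v, p)) x - wD (st_u (y_ n)) x) =
    nrm (fun x => g x - wD (st_u (y_ n)) x).
  have [_ L1 _ _] := inH_L2 Hl.
  congr Num.sqrt; apply: eq_ip; try exact: L2_measurable (L2B _ _).
  - by apply: (ae01S wl) => x _ e X; rewrite [X in X - _]e.
  - by apply: (ae01S wl) => x _ e X; rewrite [X in X - _]e.
have := lerD (lerD (sq _ (gE n)) (sq _ (vE n))) (sq _ (pE n)).
move=> /le_trans; apply.
rewrite (_ : 4 * D / 2 ^+ n = 2 * (2 * D / 2 ^+ n)); last by ring.
have := sqr_ge0 (2 * D / 2 ^+ n); rewrite [X in _ -> _ <= X]exprMn; lra.
Qed.

Definition energy_hilbert : semi_hilbert (energy_space R).
Proof.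
refine (@SemiHilbert R (energy_space R) (fun y z => energy (hval y) (hval z)) _ _ _ _ _).
- by move=> y z; exact: energyC.
- move=> x y z; have := energy_lin 1 (hval_inH x) (hval_inH y) (hval_inH z).
  by rewrite scale1r mul1r.
- move=> k x y; have := energy_lin k inH0 (hval_inH x) (hval_inH y).
  rewrite add0r => ->; have := energy_lin (-1) inH0 inH0 (hval_inH y).
  by rewrite scaleN1r oppr0 addr0 mulN1r subrr => ->; rewrite add0r.
- by move=> x; apply: energy_ge0; exact: hval_inH.
- by move=> x_ C C0 h; exact: energy_complete C0 h.
Defined.

End energy_form.

Section equality.
Context {R : realType}.
Variables (eps mu : R).
Hypotheses (eps0 : 0 < eps) (mu0 : 0 < mu).
Implicit Types (f g h F G : R -> R) (k : R) (y z w : state R).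
Local Notation lam := (@leb01 R).
Local Notation energy := (energy eps mu).
Local Notation sn := (sn (energy_hilbert eps0 mu0)).

Lemma eqH_refl y : eqH y y.
Proof. by split; exact: aeq_refl. Qed.

Lemma eqH_sym y z : eqH y z -> eqH z y.
Proof. by move=> [h1 h2 h3]; split; exact: aeq_sym. Qed.

Lemma eqH_trans y z w : eqH y z -> eqH z w -> eqH y w.
Proof.
move=> [h1 h2 h3] [h4 h5 h6].
by split; [exact: aeq_trans h1 h4|exact: aeq_trans h2 h5|exact: aeq_trans h3 h6].
Qed.

Lemma eqH_lin k y y' z z' : eqH y y' -> eqH z z' -> eqH (y + k *: z) (y' + k *: z').
Proof. move=> [h1 h2 h3] [h4 h5 h6].
by split; [exact: (aeq_lin k h1 h4)|exact: (aeq_lin k h2 h5)|exact: (aeq_lin k h3 h6)]. Qed.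

(** A function of [H1L] is the primitive of its derivative. *)
Lemma flat_energy_eqH y z : inH y -> inH z -> (flat_energy (y - z) = 0 <-> eqH y z).
Proof.
move=> Hy Hz; rewrite flat_energyB//.
have [Lu Lw Lv Lp] := inH_L2 Hy; have [Lu' Lw' Lv' Lp'] := inH_L2 Hz.
have [Hu _ _] := Hy; have [Hu' _ _] := Hz; split.
  move=> /eqP; rewrite paddr_eq0 ?addr_ge0 ?sqr_ge0// paddr_eq0 ?sqr_ge0//.
  rewrite !sqrf_eq0 => /andP[/andP[/eqP n1 /eqP n2] /eqP n3]; split.
  - have E := (nrm_aeq Lw Lw').1 n1.
    apply: aeq_trans (H1L_wD Hu) _; apply: aeq_trans _ (aeq_sym (H1L_wD Hu')).
    by apply: ae01 => x _ _; apply: eq_prim => //; exact: L2_measurable.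
  - exact: (nrm_aeq Lv Lv').1.
  - exact: (nrm_aeq Lp Lp').1.
move=> [h1 h2 h3].
have [_ h4 _] := H1_aeq Lu' Hu.1 h1.
rewrite (nrm_aeq Lw Lw').2; last exact: aeq_sym.
by rewrite (nrm_aeq Lv Lv').2// (nrm_aeq Lp Lp').2// expr0n !addr0.
Qed.

Lemma energy_eqH y z : inH y -> inH z -> (energy (y - z) (y - z) = 0 <-> eqH y z).
Proof.
move=> Hy Hz; rewrite -flat_energy_eqH//; have H := inH_sub Hy Hz.
have [l u] := (energy_lower eps mu0 H, energy_upper eps0 mu0 H).
have k0 := energy_const_gt0 mu eps0; split => E.
  move: l; rewrite E => l; apply/eqP; rewrite eq_le flat_energy_ge0 andbT.
  by rewrite -(@ler_pM2l _ (Num.min (2 * expR (- mu)) (eps / 2)))// mulr0.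
move: u; rewrite E mulr0 => u.
by apply/eqP; rewrite eq_le u energy_ge0.
Qed.

Lemma sn_eqH (y z : energy_space R) : sn (y - z) = 0 <-> eqH y z.
Proof.
have E : sn (y - z) ^+ 2 = energy (hval y - hval z) (hval y - hval z) := sn_sqr _ _.
rewrite -(energy_eqH (hval_inH y) (hval_inH z)) -E.
by split => [->|/eqP]; [rewrite expr0n|rewrite sqrf_eq0 => /eqP].
Qed.

End equality.

(** * Dissipation of the energy *)
Section generator.
Context {R : realType}.
Variables (eps a b c d mu : R).
Hypotheses (eps0 : 0 < eps) (mu0 : 0 < mu).
Implicit Types (f g h F G u v p : R -> R) (x k : R) (y z w : state R).
Local Notation lam := (@leb01 R).
Local Notation energy := (energy eps mu).
Local Notation sn := (sn (energy_hilbert eps0 mu0)).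
Local Notation domA := (domA a b c d).
Local Notation opA := (opA eps).

Lemma domA_L2 y : domA y -> [/\ inH y, L2 (st_u y), L2 (st_v y) & L2 (st_p y)].
Proof. by move=> [[_ Hu] [[Lv _] _] [[Lp _] _] _]; have [[Lu _] _] := Hu. Qed.

Lemma domA_lin k y z : domA y -> domA z ->
  domA (y + k *: z) /\ eqH (opA (y + k *: z)) (opA y + k *: opA z).
Proof.
move=> Dy Dz; have [Hy Lu Lv Lp] := domA_L2 Dy; have [Hz Lu' Lv' Lp'] := domA_L2 Dz.
have [F [F1 [G [P [P1 r]]]]] := domA_reps Dy.
have [F' [F1' [G' [P' [P1' r']]]]] := domA_reps Dz.
have [Lu'' _ Lv'' Lp''] := inH_L2 (inH_lin k Hy Hz).
have [D E1 E2] := reps_domA Lu'' Lv'' Lp'' (reps_lin k r r').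
split; first exact: D.
split.
- exact: aeq_refl.
- exact: E1.
- apply: (ae01S E2) => x _ h X; apply: etrans (congr1 ( *%R eps^-1) (h X)) _.
  exact: etrans (mulrDr _ _ _) (congr1 (+%R _) (mulrCA _ _ _)).
Qed.

(** An absolutely continuous function that vanishes almost everywhere has a null
    derivative. *)
Lemma domA_eq0 y : domA y -> eqH y 0 -> eqH (opA y) 0.
Proof.
move=> Dy [u0 v0 p0]; have [F [F1 [G [P [P1 r]]]]] := domA_reps Dy.
have z := ac_cst (0 : R).
have F0 := ac_aeq (acF r) z (aeq_trans (aeq_sym (u_F r)) u0).
have F10 := ac_aeq (acF1 r) z F0.
have P0 := ac_aeq (acP r) z (aeq_trans (aeq_sym (p_P r)) p0).
have P10 := ac_aeq (acP1 r) z P0.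
split; [exact: v0|exact: F10|].
by apply: (ae01S P10) => x _ h X; exact: etrans (congr1 ( *%R eps^-1) (h X)) (mulr0 _).
Qed.

Lemma opA_inH y : domA y -> inH (opA y).
Proof.
move=> [[[_ Hu] _] Hv [_ Hp] _]; have [Lu _] := wD_spec Hu; have [Lp _] := wD_spec Hp.
by split; [exact: Hv|exact: Lu|exact: L2Z].
Qed.

(** Use [(x + y)^2 <= 3/2 x^2 + 3 y^2] and [(z - y)^2 >= 1/2 z^2 - y^2]; the
    hypothesis on [a] is exactly that the squares of [x = (1 - a) v] and
    [z = (1 + a) v] then compensate. *)
Lemma boundary_terms_le (v be : R) : 3 * expR mu ^+ 2 * (1 - a) ^+ 2 <= (1 + a) ^+ 2 ->
  expR mu * ((1 - a) * v + be) ^+ 2 - expR (- mu) * ((1 + a) * v - be) ^+ 2 <=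
  (3 * expR mu + expR (- mu)) * be ^+ 2.
Proof.
move=> h; have EJ : expR mu * expR (- mu) = 1 by rewrite -expRD subrr expR0.
move: EJ h (expR_gt0 mu) (expR_gt0 (- mu)).
move: (expR mu) (expR (- mu)) => E J EJ h E0 J0.
have h1 : 3 * E * ((1 - a) * v) ^+ 2 <= J * ((1 + a) * v) ^+ 2.
  have := ler_wpM2l (ltW J0) (ler_wpM2r (sqr_ge0 v) h).
  rewrite [X in X <= _ -> _](_ : _ = (E * J) * (3 * E * ((1 - a) * v) ^+ 2)); last by ring.
  by rewrite EJ mul1r -exprMn.
have h2 := mulr_ge0 (ltW E0) (sqr_ge0 ((1 - a) * v - 2 * be)).
have h3 := mulr_ge0 (ltW J0) (sqr_ge0 ((1 + a) * v - 2 * be)).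
move: h1 h2 h3; move: ((1 - a) * v) ((1 + a) * v) => X Z h1 h2 h3; lra.
Qed.

Lemma riemann_lower f g : L2 f -> L2 g -> 2 * expR (- mu) * ip g g <=
  ip (fun x => wplus mu x * (f x + g x)) (fun x => f x + g x) +
  ip (fun x => wminus mu x * (f x - g x)) (fun x => f x - g x).
Proof.
move=> Lf Lg; have /andP[h1 _] := weight_le (weight_plus mu0) (L2D Lf Lg).
have /andP[h2 _] := weight_le (weight_minus mu0) (L2B Lf Lg).
apply: le_trans (lerD h1 h2); rewrite -mulrDr (parallelogram Lf Lg).
have := mulr_ge0 (expR_ge0 (- mu)) (ip_ge0 f); move: (ip g g) (ip f f) => A B; lra.
Qed.

(** All that the decay of the energy needs to know, in terms of six numbers: the
    part [W] of the energy carried by the wave, the integrals [n] of [p^2] and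
    [q] of [p_x^2], and the traces [u1] of [u] at 1, [p0] and [p1] of [p] at 0
    and 1. *)
Lemma dissipation_estimate y z : domA y -> inH z -> eqH (opA y) z ->
  3 * expR mu ^+ 2 * (1 - a) ^+ 2 <= (1 + a) ^+ 2 ->
  1 + (3 * expR mu + expR (- mu)) * b ^+ 2 <= c ->
  exists W n u1 p0 p1 q : R,
    [/\ energy y y = W + eps / 2 * n, 0 <= n <= 2 * p0 ^+ 2 + 2 * q,
      2 * expR (- mu) * u1 ^+ 2 <= W, p1 ^+ 2 <= 2 * p0 ^+ 2 + 2 * q &
      2 * energy y z <= - mu * W - p0 ^+ 2 - q + d * u1 * p1].
Proof.
move=> Dy Hz [vz uz pz] ha hc.
have [Hy Lu Lv Lp] := domA_L2 Dy; have [F [F1 [G [P [P1 r]]]]] := domA_reps Dy.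
have [aF aF1 F0 aG G0 aP aP1 uF vG pP b1 b2 b3] := r.
have S_ := acD aG aF1; have T_ := acB aG aF1.
have [_ LS _] := S_; have [_ LT _] := T_; have [_ _ FE] := aF; have [_ Lp2 _] := aP1.
have LS1 := ac_L2 S_; have LT1 := ac_L2 T_; have LF1 := ac_L2 aF1; have LG := ac_L2 aG.
have LP := ac_L2 aP; have LP1 := ac_L2 aP1.
have [Luz Lwz Lvz Lpz] := inH_L2 Hz.
have Hv : H1 (st_v y) by case: Dy => _ [].
have [_ wz _] := H1_aeq Luz Hv vz.
have uF1 : wD (st_u y) = F1 %[ae lam].
  by have [_ E _] := ac_H1 Lu aF uF.
have ry : riemann_plus y = (fun x => G x + F1 x) %[ae lam].
  by apply: (ae01S2 vG uF1) => x _ h1 h2 X; rewrite /riemann_plus h1// h2.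
have ly : riemann_minus y = (fun x => G x - F1 x) %[ae lam].
  by apply: (ae01S2 vG uF1) => x _ h1 h2 X; rewrite /riemann_minus h1// h2.
have rz : riemann_plus z = (fun x => wD (st_v y) x + wD (wD (st_u y)) x) %[ae lam].
  by apply: (ae01S2 uz wz) => x _ h1 h2 X; rewrite /riemann_plus h2// -[st_v z x]h1// addrC.
have lz : riemann_minus z = (fun x => -1 * (wD (st_v y) x - wD (wD (st_u y)) x)) %[ae lam].
  apply: (ae01S2 uz wz) => x _ h1 h2 X.
  by rewrite /riemann_minus h2// -[st_v z x]h1// mulN1r opprB.
have [wp wm] := (weight_plus mu0, weight_minus mu0).
have [Lry Lly] := (riemann_plus_L2 Hy, riemann_minus_L2 Hy); have [Lrz Llz] := (riemann_plus_L2 Hz, riemann_minus_L2 Hz).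
have E1 := weight_aeq wp Lry LS1 Lrz LS ry rz.
have E2 := weight_aeq wm Lly LT1 Llz (L2Z (-1) LT) ly lz.
have E3 := weight_aeq wp Lry LS1 Lry LS1 ry ry.
have E4 := weight_aeq wm Lly LT1 Lly LT1 ly ly.
have E5 : eps / 2 * ip (st_p y) (st_p z) = ip P (wD (wD (st_p y))) / 2.
  have -> : ip (st_p y) (st_p z) = eps^-1 * ip P (wD (wD (st_p y))).
    rewrite (ipC P) -(ipZl _ Lp2 LP) (ipC (st_p y)).
    apply: (eq_ip (L2_measurable Lpz) (L2_measurable (L2Z _ Lp2)) (L2_measurable Lp)
      (L2_measurable LP) _ pP); exact: aeq_sym pz.
  by move: (ip _ _) => q; field; rewrite gt_eqF.
have E6 : ip (st_p y) (st_p y) = ip P P.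
  exact: (eq_ip (L2_measurable Lp) (L2_measurable LP) (L2_measurable Lp) (L2_measurable LP) pP pP).
exists (ip (fun x => wplus mu x * (G x + F1 x)) (fun x => G x + F1 x) +
        ip (fun x => wminus mu x * (G x - F1 x)) (fun x => G x - F1 x)).
exists (ip P P), (F 1), (P 0), (P 1), (ip P1 P1).
have i1 : 0 <= (1 : R) <= 1 by rewrite lexx ler01.
split.
- by rewrite /energy E3 E4 E6.
- by rewrite ip_ge0 ac_poincare.
- apply: le_trans (riemann_lower LG LF1); rewrite (FE 1 i1) F0 add0r.
  by apply: ler_wpM2l (prim_sqr 1 LF1); rewrite mulr_ge0 ?expR_ge0.
- exact: ac_trace aP i1.
- have -> : energy y z = ip (fun x => wplus mu x * (G x + F1 x))
        (fun x => wD (st_v y) x + wD (wD (st_u y)) x) -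
      ip (fun x => wminus mu x * (G x - F1 x))
        (fun x => wD (st_v y) x - wD (wD (st_u y)) x) + ip P (wD (wD (st_p y))) / 2.
    rewrite /energy E1 E2 E5 [ip _ (fun x => -1 * _)]ipC.
    by rewrite (ipZl (-1) LT (weight_L2 wm LT1)) mulN1r (ipC _ (fun x => wminus _ _ * _)).
  have k1 : 2 * ip (fun x => wplus mu x * (G x + F1 x)) _ = _ := ip_exp mu S_.
  have k2 : 2 * ip (fun x => wminus mu x * (G x - F1 x)) _ = _ := ip_exp (- mu) T_.
  have k3 := ac_by_parts aP aP1; have k4 := boundary_terms_le (G 1) (b * P 0) ha.
  have k5 := ler_wpM2r (sqr_ge0 (P 0)) hc.
  rewrite -[fun x => expR (mu * x) * _]/(fun x => wplus mu x * (G x + F1 x)) in k1.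
  rewrite -[fun x => expR (- mu * x) * _]/(fun x => wminus mu x * (G x - F1 x)) in k2.
  move: k1 k2 k3 k4 k5; rewrite b1 b2 b3 G0.
  move: (ip _ _) (ip _ _) (ip _ _) (ip _ _) (ip _ _) (ip _ _) (expR _) (expR _).
  move: (F1 0) (P 0) (P 1) (F 1) (G 1).
  clear; move=> *; lra.
Qed.
(** The coupling is bounded by Young's inequality,
    [d * u1 * p1 <= 1/2 (d * u1)^2 + 1/2 p1^2], which uses up all the damping. *)
Lemma energy_dissipative y z : domA y -> inH z -> eqH (opA y) z ->
  3 * expR mu ^+ 2 * (1 - a) ^+ 2 <= (1 + a) ^+ 2 ->
  1 + (3 * expR mu + expR (- mu)) * b ^+ 2 <= c ->
  d ^+ 2 <= 4 * (mu * expR (- mu)) -> energy y z <= 0.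
Proof.
move=> Dy Hz yz ha hc hd.
have [W [n [u1 [p0 [p1 [q [_ _ h1 h2 h3]]]]]]] := dissipation_estimate Dy Hz yz ha hc.
have h4 := ler_wpM2r (sqr_ge0 u1) hd; have h5 := ler_wpM2l (ltW mu0) h1.
have h6 := sqr_ge0 (d * u1 - p1).
move: h1 h2 h3 h4 h5 h6; move: (energy y z) (expR _); clear; move=> *; lra.
Qed.

(** Here [d * u1 * p1 <= (d * u1)^2 + 1/4 p1^2] leaves half of the damping. *)
Lemma energy_strictly_dissipative y z om : domA y -> inH z -> eqH (opA y) z ->
  3 * expR mu ^+ 2 * (1 - a) ^+ 2 <= (1 + a) ^+ 2 ->
  1 + (3 * expR mu + expR (- mu)) * b ^+ 2 <= c ->
  d ^+ 2 <= mu * expR (- mu) -> 4 * om <= mu -> 4 * eps * om <= 1 ->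
  energy y z <= - om * energy y y.
Proof.
move=> Dy Hz yz ha hc hd o1 o2.
have [W [n [u1 [p0 [p1 [q [E /andP[n0 nq] h1 h2 h3]]]]]]] := dissipation_estimate Dy Hz yz ha hc.
have h4 := ler_wpM2r (sqr_ge0 u1) hd; have h5 := ler_wpM2l (ltW mu0) h1.
have h6 := sqr_ge0 (2 * d * u1 - p1).
have W0 : 0 <= W.
  by apply: le_trans h1; rewrite mulr_ge0 ?sqr_ge0// mulr_ge0 ?expR_ge0.
have h7 := ler_wpM2r W0 o1; have h8 := ler_wpM2r n0 o2; rewrite E.
move: h1 h2 h3 h4 h5 h6 h7 h8 nq; move: (energy y z) (expR _); clear; move=> *; lra.
Qed.
End generator.

(** * The resolvent equation *)
Section resolvent.
Context {R : realType}.
Implicit Types (f g h F G u v p : R -> R) (x k : R) (y z w : state R).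
Local Notation lam := (@leb01 R).

(** Duhamel's formula. *)
Lemma ac_first_order k g : L2 g ->
  exists2 E, ac E (fun x => k * E x + g x) & E 0 = 0.
Proof.
move=> Lg; have ae := ac_exp k; have Lk := ac_mul_L2 (ac_exp (- k)) Lg.
exists (fun x => expR (k * x) * prim (fun t => expR (- k * t) * g t) x).
  apply: acE (acM ae (ac_prim Lk)) _; apply/funext => x.
  rewrite mulrA -expRD mulNr subrr expR0 mul1r addrC; congr (_ + _).
  by rewrite mulrC -mulrA.
by rewrite prim0// mulr0.
Qed.

(** The operator [D^2 - k^2] factors as [(D - k) (D + k)], so that a particular
    solution is the half difference, divided by [k], of solutions of first-order
    equations.  The map from the Cauchy data at 0 to those at 1 is affine; [m]
    and [n] are the image of null data. *)
Lemma shooting k g : 0 < k -> L2 g -> exists m n : R, forall p0 p1 : R, exists P P1,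
  [/\ ac P P1, ac P1 (fun x => k ^+ 2 * P x + g x), P 0 = p0 /\ P1 0 = p1,
    P 1 = m + p0 * cosh k + p1 * (sinh k / k) &
    P1 1 = n + p0 * (k * sinh k) + p1 * cosh k].
Proof.
move=> k0 Lg; have kn0 : k != 0 by rewrite gt_eqF.
have [E aE E0] := ac_first_order k Lg; have [D aD D0] := ac_first_order (- k) Lg.
exists ((2 * k)^-1 * (E 1 - D 1)), (2^-1 * (E 1 + D 1)) => p0 p1.
have [al alE] : exists al, al = (p0 + p1 / k) / 2 by exists ((p0 + p1 / k) / 2).
have [be beE] : exists be, be = (p0 - p1 / k) / 2 by exists ((p0 - p1 / k) / 2).
exists (fun x => (2 * k)^-1 * (E x - D x) + (al * expR (k * x) + be * expR (- k * x))).
exists (fun x => 2^-1 * (E x + D x) + (al * k * expR (k * x) + - (be * k) * expR (- k * x))).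
split.
- apply: acE (acD (acZ _ (acB aE aD)) (acD (acZ _ (ac_exp _)) (acZ _ (ac_exp _)))) _.
  by apply/funext => x; field.
- apply: acE (acD (acZ _ (acD aE aD)) (acD (acZ _ (ac_exp _)) (acZ _ (ac_exp _)))) _.
  by apply/funext => x; field.
- by rewrite !mulr0 expR0 E0 D0 alE beE; split; field.
- by rewrite !mulr1 /cosh /sinh alE beE; field.
- by rewrite !mulr1 /cosh /sinh alE beE; field.
Qed.

Lemma cosh_ge1 k : 1 <= cosh k.
Proof. by rewrite /cosh; have := expR_ge1Dx k; have := expR_ge1Dx (- k); lra. Qed.

Lemma sinh_gt0 k : 0 < k -> 0 < sinh k.
Proof.
move=> k0; rewrite /sinh; have : expR (- k) < expR k by rewrite ltr_expR; lra.
by move=> ?; lra.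
Qed.

(** [sinh] is the integral of [cosh], which increases on the half-line. *)
Lemma sinh_le_cosh k : 0 < k -> sinh k / k <= cosh k.
Proof.
move=> k0; have [_ Lp pE] := ac_exp k; have [_ Lm mE] := ac_exp (- k).
have i1 : 0 <= (1 : R) <= 1 by rewrite lexx ler01.
have := pE 1 i1; have := mE 1 i1; rewrite !mulr1 !mulr0 expR0.
have L := L2B Lp Lm.
have : prim (fun x => k * expR (k * x) - - k * expR (- k * x)) 1 <=
    k * (expR k + expR (- k)).
  rewrite prim1// -[leRHS]mulr1 -[X in _ * X](@prim_cst1 R 1)// prim1; last exact: L2_cst.
  rewrite -ipZl; try exact: L2_cst.
  apply: le_ip => //; try exact: L2_cst; first exact: L2Z (L2_cst 1).
  move=> x /andP[x0 x1]; rewrite !mulr1 mulNr opprK -mulrDr ler_wpM2l ?(ltW k0)//.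
  have h1 : expR (k * x) <= expR k by rewrite ler_expR ler_piMr ?ltW.
  have h2 : expR (- k * x) <= 1 by rewrite -expR0 ler_expR mulNr oppr_le0 mulr_ge0 ?ltW.
  have h3 : expR (- k) <= 1 by rewrite -expR0 ler_expR oppr_le0 ltW.
  have e1 : expR k * expR (- k) = 1 by rewrite -expRD subrr expR0.
  have e2 : expR (k * x) * expR (- k * x) = 1 by rewrite -expRD mulNr subrr expR0.
  have p1 := expR_ge0 (- k); have p2 := expR_ge0 (- k * x).
  move: h1 h2 h3 e1 e2 p1 p2.
  move: (expR k) (expR (- k)) (expR (k * x)) (expR (- k * x)) => T S t s h1 h2 h3 e1 e2 p1 p2.
  have -> : s = S + s * S * (T - t) by rewrite mulrBr -mulrA [S * T]mulrC e1 mulrAC [s * t]mulrC e2; ring.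
  have h4 : s * S <= 1 by rewrite mulr_ile1.
  have : 0 <= (1 - s * S) * (T - t) by rewrite mulr_ge0 ?subr_ge0.
  by lra.
rewrite (primB _ Lp Lm) ler_pdivrMr// /sinh /cosh.
by move: (prim _ _) (prim _ _) (expR k) (expR (- k)) => A B E J h1 h2 h3; lra.
Qed.

Lemma cramer (M K b d s r1 r2 : R) : M * K - b * d * s != 0 ->
  exists al be, M * al - b * be = r1 /\ K * be - d * s * al = r2.
Proof.
move=> D0; exists ((K * r1 + b * r2) / (M * K - b * d * s)).
by exists ((M * r2 + d * s * r1) / (M * K - b * d * s)); split; field.
Qed.

Variables (eps a b c d : R).
Hypotheses (eps0 : 0 < eps) (a0 : 0 < a) (c0 : 0 < c) (bdc : `|b * d| <= c).

(** Eliminating [v] leaves [u'' = la^2 u - la^2 f1 - la f2] and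
    [p'' = ka^2 (p - f3)], with [la = 1 / h] and [ka^2 = eps la].  The unknown
    Cauchy data are the slope [al] of [u] and the value [be] of [p] at 0; the
    conditions at 1 are a linear system for them. *)
Lemma resolvent_solvable (h : R) z : 0 < h -> inH z ->
  exists2 y : state R, domA a b c d y & eqH (y - h *: opA eps y) z.
Proof.
move=> h0 Hz; have [Lu Lw Lv Lp] := inH_L2 Hz.
have [la laE] : exists la, la = h^-1 by exists h^-1.
have la0 : 0 < la by rewrite laE invr_gt0.
have [ka kaE] : exists ka, ka = Num.sqrt (eps * la) by exists (Num.sqrt (eps * la)).
have ka0 : 0 < ka by rewrite kaE sqrtr_gt0 mulr_gt0.
have ka2 : ka ^+ 2 = eps * la by rewrite kaE sqr_sqrtr// mulr_ge0// ltW.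
have [f1 f1E] : exists f1, f1 = prim (wD (st_u z)) by exists (prim (wD (st_u z))).
have af1 : ac f1 (wD (st_u z)) by rewrite f1E; exact: ac_prim.
have Lf1 := ac_L2 af1.
have zf1 : st_u z = f1 %[ae lam] by rewrite f1E; case: Hz => Hu _ _; exact: H1L_wD.
have Lq : L2 (fun x => - la ^+ 2 * f1 x + - la * st_v z x) by apply: L2D; exact: L2Z.
have Lg : L2 (fun x => - ka ^+ 2 * st_p z x) by exact: L2Z.
have [mu_ [nu_ shu]] := shooting la0 Lq; have [mp [np shp]] := shooting ka0 Lg.
have [s sE] : exists s, s = sinh la / la by exists (sinh la / la).
have s0 : 0 < s by rewrite sE divr_gt0// sinh_gt0.
have sC : s <= cosh la by rewrite sE sinh_le_cosh.
have [K KE] : exists K, K = ka * sinh ka + c * cosh ka by exists (ka * sinh ka + c * cosh ka).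
have Kc : c <= K.
  have := ler_wpM2l (ltW c0) (cosh_ge1 ka); have := mulr_gt0 ka0 (sinh_gt0 ka0).
  by rewrite KE; lra.
have [M ME] : exists M, M = cosh la + a * la * s by exists (cosh la + a * la * s).
have Ms : s < M.
  have : 0 < a * la * s by rewrite !mulr_gt0.
  by rewrite ME; lra.
(* The determinant: [b * d * s <= c * s < c * M <= K * M]. *)
have D0 : 0 < M * K - b * d * s.
  rewrite subr_gt0; apply: (@le_lt_trans _ _ (c * s)).
    by rewrite ler_wpM2r ?(ltW s0)// (le_trans (ler_norm _)).
  rewrite [M * K]mulrC; apply: (@lt_le_trans _ _ (c * M)); first by rewrite ltr_pM2l.
  by rewrite ler_wpM2r// (le_trans (ltW s0))// ltW.
have [al [be [eq1 eq2]]] := @cramer M K b d s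
  (- (a * la * (mu_ - f1 1)) - nu_) (d * mu_ - np) (lt0r_neq0 D0).
have [u [u1 [au au1 [u00 u10] uE u1E]]] := shu 0 al.
have [p [p1 [ap ap1 [p00 p10] pE p1E]]] := shp be (c * be).
pose v x := la * (u x - f1 x).
have av : ac v _ := acZ la (acB au af1).
have [Lyu Lyv Lyp] : [/\ L2 u, L2 v & L2 p] by split; [exact: ac_L2 au|exact: ac_L2 av|exact: ac_L2 ap].
have r : reps a b c d (u, v, p) u u1 (fun x => la ^+ 2 * u x + (- la ^+ 2 * f1 x + - la * st_v z x))
    v (fun x => la * (u1 x - wD (st_u z) x)) p p1 (fun x => ka ^+ 2 * p x + - ka ^+ 2 * st_p z x).
  split; try exact: aeq_refl; try assumption.
  - by rewrite /v u00 f1E prim0// subrr mulr0.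
  - rewrite p00 /v uE u1E -sE; move: eq1; rewrite ME; lra.
  - by rewrite p10 p00.
  - rewrite p1E uE -sE; move: eq2; rewrite KE; lra.
have [D E1 E2] := @reps_domA R a b c d (u, v, p) _ _ _ _ _ _ _ _ Lyu Lyv Lyp r.
exists (u, v, p); first exact: D.
have hla : h * la = 1 by rewrite laE divff// gt_eqF.
split.
- apply: (ae01S zf1) => x _ e X; rewrite e//.
  have -> : st_u ((u, v, p) - h *: opA eps (u, v, p)) x = u x - h * v x by [].
  by rewrite /v mulrA hla mul1r opprB addrC subrK.
- apply: (ae01S E1) => x _ e X.
  have -> : st_v ((u, v, p) - h *: opA eps (u, v, p)) x = v x - h * wD (wD u) x by [].
  rewrite [wD _ x]e// /v.
  have -> : la * (u x - f1 x) - h * (la ^+ 2 * u x + (- la ^+ 2 * f1 x + - la * st_v z x)) =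
    la * (u x - f1 x) * (1 - h * la) + h * la * st_v z x by ring.
  by rewrite hla; ring.
- apply: (ae01S E2) => x _ e X.
  have -> : st_p ((u, v, p) - h *: opA eps (u, v, p)) x = p x - h * (eps^-1 * wD (wD p) x) by [].
  rewrite [wD _ x]e// ka2.
  have -> : p x - h * (eps^-1 * (eps * la * p x + - (eps * la) * st_p z x)) =
    p x - h * la * (p x - st_p z x) by field; rewrite gt_eqF.
  by rewrite hla; ring.
Qed.

End resolvent.

(** * Mild solutions of the coupled system *)
Section system.
Context {R : realType}.
Variables (eps mu : R).
Hypotheses (eps0 : 0 < eps) (mu0 : 0 < mu).
Implicit Types (t k e : R) (y z w : state R) (Y : R -> state R).
Local Notation E := (energy_space R).
Local Notation HE := (energy_hilbert eps0 mu0).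
Local Notation sn := (sn HE).
Local Notation lam := (@leb01 R).

Lemma Hnorm_sqr y : inH y ->
  Hnorm y ^+ 2 = ip (st_u y) (st_u y) + flat_energy y.
Proof.
move=> Hy; have [Lu Lw Lv Lp] := inH_L2 Hy.
rewrite /Hnorm sqr_sqrtr ?addr_ge0 ?sqr_ge0// /H1norm sqr_sqrtr ?addr_ge0 ?sqr_ge0//.
by rewrite !L2norm_sqr// /flat_energy !addrA.
Qed.

Lemma Hnorm_ge0 y : 0 <= Hnorm y. Proof. exact: sqrtr_ge0. Qed.

(** The norm of [u] in [L2] is controlled by that of its derivative. *)
Lemma Hnorm_flat y : inH y -> flat_energy y <= Hnorm y ^+ 2 <= 3 * flat_energy y.
Proof.
move=> Hy; rewrite Hnorm_sqr//; have [Lu Lw Lv Lp] := inH_L2 Hy.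
rewrite lerDr ip_ge0/=; have [Hu _ _] := Hy.
have -> : ip (st_u y) (st_u y) = ip (prim (wD (st_u y))) (prim (wD (st_u y))).
  have m1 := L2_measurable Lu; have m2 := measurable_prim Lw.
  exact: (eq_ip m1 m2 m1 m2 (H1L_wD Hu) (H1L_wD Hu)).
have := ac_poincare (ac_prim Lw); rewrite prim0// /flat_energy.
have := ip_ge0 (st_v y); have := ip_ge0 (st_p y).
by do 4 move: (ip _ _) => ?; nra.
Qed.

Let K1 : R := Num.sqrt (3 / Num.min (2 * expR (- mu)) (eps / 2)).
Let K2 : R := Num.sqrt (2 * expR mu + eps / 2).

Lemma Hnorm_le_sn (y : E) : Hnorm y <= K1 * sn y.
Proof.
have k0 := energy_const_gt0 mu eps0; have Hy := hval_inH y.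
rewrite -(@ler_pXn2r _ 2)// ?nnegrE ?Hnorm_ge0 ?mulr_ge0 ?sqrtr_ge0 ?sn_ge0//.
have K1E : K1 ^+ 2 = 3 / Num.min (2 * expR (- mu)) (eps / 2).
  by rewrite sqr_sqrtr// divr_ge0// ltW.
rewrite exprMn K1E sn_sqr.
have /andP[_ h] := Hnorm_flat Hy; apply: le_trans h _.
by rewrite -mulrA ler_wpM2l// ler_pdivlMl//; exact: energy_lower.
Qed.

Lemma sn_le_Hnorm (y : E) : sn y <= K2 * Hnorm y.
Proof.
have Hy := hval_inH y.
have k0 : 0 <= 2 * expR mu + eps / 2.
  by rewrite addr_ge0 ?divr_ge0 ?mulr_ge0 ?expR_ge0 ?ltW.
have K2E : K2 ^+ 2 = 2 * expR mu + eps / 2 by rewrite sqr_sqrtr.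
rewrite -(@ler_pXn2r _ 2)// ?nnegrE ?Hnorm_ge0 ?mulr_ge0 ?sqrtr_ge0 ?sn_ge0// ?Hnorm_ge0//.
rewrite exprMn K2E sn_sqr; apply: le_trans (energy_upper eps0 mu0 Hy) _.
by rewrite ler_wpM2l//; have /andP[] := Hnorm_flat Hy.
Qed.

(** The identity on the states of finite energy. *)
Definition lift y : E := insubd 0 y.

Lemma liftK y : inH y -> hval (lift y) = y.
Proof. by move=> Hy; rewrite /lift; apply: insubdK; apply/energy_predP. Qed.

Lemma hval_sum n (F : nat -> E) (s : nat -> R) :
  hval (\sum_(i < n) s i *: F i) = \sum_(i < n) s i *: hval (F i).
Proof. exact: (big_morph hval). Qed.

Variables (a b c d om : R).
Hypotheses (om0 : 0 <= om) (a0 : 0 < a) (c0 : 0 < c) (bdc : `|b * d| <= c).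
Hypothesis diss : forall y z, domA a b c d y -> inH z -> eqH (opA eps y) z ->
  energy eps mu y z <= - om * energy eps mu y y.

Definition generator : m_dissipative HE om.
Proof.
refine (@MDissipative R E HE om
  (fun x f => domA a b c d (hval x) /\ eqH (opA eps (hval x)) (hval f)) _ _ _ _ _ _).
- have L0 := L2_cst (0 : R).
  have [D _ _] := @reps_domA R a b c d 0 _ _ _ _ _ _ _ _ L0 L0 L0 (reps0 a b c d).
  split; first exact: D.
  exact: domA_eq0 D (eqH_refl _).
- move=> k x f y g [Dx xf] [Dy yg]; have [D h] := domA_lin eps k Dx Dy.
  by split; [exact: D|exact: eqH_trans h (eqH_lin k xf yg)].
- move=> x f g [Dx xf] /sn_eqH fg; split; first exact: Dx.
  exact: eqH_trans xf fg.
- move=> x f [Dx xf] x0.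
  have x1 : eqH (hval x) (hval (0 : E)) by apply/(sn_eqH eps0 mu0); rewrite subr0.
  by rewrite -[f]subr0; apply/sn_eqH; exact: eqH_trans (eqH_sym xf) (domA_eq0 eps Dx x1).
- by move=> x f [Dx xf]; exact: diss Dx (hval_inH f) xf.
- move=> h f h0; have [y Dy yf] := resolvent_solvable eps0 a0 c0 bdc h0 (hval_inH f).
  have [Hy _ _ _] := domA_L2 Dy; have Ho := opA_inH eps Dy.
  exists (mkE Hy), (mkE Ho); split; first by split; [exact: Dy|exact: eqH_refl].
  by apply/sn_eqH; exact: yf.
Defined.

Lemma mild_lift y0 Y : inH y0 -> mild_solution eps a b c d y0 Y ->
  mild generator (lift y0) (fun t => lift (Y t)).
Proof.
move=> Hy0 [[YH cY] hY]; split.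
  move=> t t0 e e0; have K0 : 0 < K2 + 1 by rewrite ltr_wpDl ?sqrtr_ge0.
  have /cvgrPdist_lt /(_ (e / (K2 + 1))) := cY t t0.
  rewrite divr_gt0// => /(_ isT); rewrite near_withinE => -[r /= r0 hr].
  exists r => // s s0 st; have := hr s; rewrite /ball /= distrC => /(_ st).
  rewrite in_itv /= s0 andbT => /(_ isT).
  rewrite sub0r normrN ger0_norm ?Hnorm_ge0// => h.
  have E : hval (lift (Y s) - lift (Y t)) = Y s - Y t.
    by rewrite -[in RHS](liftK (YH s s0)) -[in RHS](liftK (YH t t0)).
  apply: le_trans (sn_le_Hnorm _) _; rewrite E.
  rewrite ltr_pdivlMr// mulrC in h; apply: le_trans _ (ltW h).
  by rewrite ler_wpM2r ?Hnorm_ge0// lerDl.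
move=> t t0; have [w [[Hw iw] Dw Yw]] := hY t t0.
have Ho := opA_inH eps Dw; exists (lift w), (lift (opA eps w)); split.
- move=> e e0; have K0 : 0 < K2 + 1 by rewrite ltr_wpDl ?sqrtr_ge0.
  have [dl dl0 h] := iw (e / (K2 + 1)) (divr_gt0 e0 K0).
  exists dl => // n s xi T; have [s0 sn_ hs] := T; have := h n s xi s0 sn_ hs.
  have -> : \sum_(i < n) (s i.+1 - s i) *: Y (xi i) - w =
      hval (\sum_(i < n) (s i.+1 - s i) *: lift (Y (xi i)) - lift w).
    rewrite -[in LHS](liftK Hw).
    have -> : \sum_(i < n) (s i.+1 - s i) *: Y (xi i) =
      \sum_(i < n) (s i.+1 - s i) *: hval (lift (Y (xi i))).
      apply: eq_bigr => i _; rewrite liftK//; apply: YH.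
      by have [h1 h2 _ _ _] := tagged_mem T (ltn_ord i); exact: le_trans h1 h2.
    by rewrite -(hval_sum n (fun i => lift (Y (xi i))) (fun i => s i.+1 - s i)).
  move=> hlt; apply: le_lt_trans (sn_le_Hnorm _) _.
  rewrite ltr_pdivlMr// mulrC in hlt; apply: le_lt_trans _ hlt.
  by rewrite ler_wpM2r ?Hnorm_ge0// lerDl.
- by split; rewrite !liftK//; exact: eqH_refl.
- have YHt := YH t t0; apply/sn_eqH.
  rewrite (liftK YHt).
  by have -> : hval (lift y0 + lift (opA eps w)) = y0 + opA eps w
    by rewrite -[in RHS](liftK Hy0) -[in RHS](liftK Ho).
Qed.

Lemma mild_hval (y0 : E) (Z : R -> E) : mild generator y0 Z ->
  mild_solution eps a b c d (hval y0) (fun t => hval (Z t)).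
Proof.
have K0 : 0 < K1 + 1 by rewrite ltr_wpDl ?sqrtr_ge0.
move=> [cZ hZ]; split.
  split=> [t _|t t0]; first exact: hval_inH.
  apply/cvgrPdist_le => e e0; rewrite near_withinE.
  have [r r0 hr] := cZ t t0 (e / (K1 + 1)) (divr_gt0 e0 K0).
  exists r => //= s; rewrite /ball /= distrC in_itv /= andbT => st s0.
  rewrite sub0r normrN ger0_norm ?Hnorm_ge0//.
  have E : hval (Z s) - hval (Z t) = hval (Z s - Z t) by [].
  rewrite E; apply: le_trans (Hnorm_le_sn _) _.
  have := hr s s0 st; rewrite ler_pdivlMr// mulrC; apply: le_trans.
  by rewrite ler_wpM2r ?sn_ge0// lerDl.
move=> t t0; have [w [g [iw [Dw wg] Zg]]] := hZ t t0; exists (hval w); split.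
- split; first exact: hval_inH.
  move=> e e0; have [dl dl0 h] := iw (e / (K1 + 1)) (divr_gt0 e0 K0).
  exists dl => // n s xi s0 sn_ hs; have := h n s xi (And3 s0 sn_ hs).
  have -> : \sum_(i < n) (s i.+1 - s i) *: hval (Z (xi i)) - hval w =
      hval (\sum_(i < n) (s i.+1 - s i) *: Z (xi i) - w).
    by rewrite -(hval_sum n (fun i => Z (xi i)) (fun i => s i.+1 - s i)).
  rewrite ltr_pdivlMr// mulrC => hlt; apply: le_lt_trans (Hnorm_le_sn _) _.
  apply: le_lt_trans _ hlt.
  by rewrite ler_wpM2r ?sn_ge0// lerDl.
- exact: Dw.
- move/sn_eqH: Zg => Zg; apply: eqH_trans Zg _.
  have := eqH_lin 1 (eqH_refl (hval y0)) (eqH_sym wg); rewrite !scale1r.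
  by apply.
Qed.

Lemma well_posed y0 : inH y0 ->
  (exists Y, mild_solution eps a b c d y0 Y) /\
  (forall Y Z, mild_solution eps a b c d y0 Y -> mild_solution eps a b c d y0 Z ->
     forall t, 0 <= t -> eqH (Y t) (Z t)).
Proof.
move=> Hy0; split.
  have [Z mZ] := mild_exists om0 generator (lift y0).
  by exists (fun t => hval (Z t)); rewrite -[y0](liftK Hy0); exact: mild_hval.
move=> Y Z mY mZ t t0; have [[HY _] _] := mY; have [[HZ _] _] := mZ.
have := mild_dist om0 (mild_lift Hy0 mY) (mild_lift Hy0 mZ) t0.
rewrite subrr sn0 => /sn_le0 /sn_eqH.
by rewrite (liftK (HY t t0)) (liftK (HZ t t0)).
Qed.

Lemma exponential_decay : 0 < om -> exponentially_stable eps a b c d.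
Proof.
(* One is added since the constant has to be positive. *)
move=> om1; exists (K1 * K2 + 1), om; split => //.
  by rewrite ltr_wpDl ?mulr_ge0 ?sqrtr_ge0.
move=> y0 Y Hy0 mY t t0; have [[HY _] _] := mY.
have h := mild_decay om0 (mild_lift Hy0 mY) t0.
have h1 := Hnorm_le_sn (lift (Y t)); have h2 := sn_le_Hnorm (lift y0).
rewrite (liftK (HY t t0)) in h1; rewrite (liftK Hy0) in h2.
apply: le_trans h1 _.
have h3 : sn (lift (Y t)) <= expR (- om * t) * (K2 * Hnorm y0).
  by apply: le_trans h _; rewrite ler_wpM2l ?expR_ge0.
apply: le_trans (ler_wpM2l (sqrtr_ge0 _) h3) _.
have -> : K1 * (expR (- om * t) * (K2 * Hnorm y0)) =
  K1 * K2 * expR (- om * t) * Hnorm y0 by ring.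
by rewrite ler_wpM2r ?Hnorm_ge0// ler_wpM2r ?expR_ge0// lerDl.
Qed.

End system.

(** * Well-posedness and stability *)
Theorem theorem1 (R : realType) (eps a b c d mu : R) :
  let eta : R := (Num.sqrt 3 + 1) / (Num.sqrt 3 - 1) in
  let mustar : R := ln (`|1 + a| / (Num.sqrt 3 * `|1 - a|)) in
  0 < eps ->
  eta^-1 <= a <= eta -> a != 1 ->
  `|b * d / c| <= 1 ->
  pi ^+ 2 / 8 <= c ->
  0 < mu <= mustar ->
  1 + 2 * (sinh mu + 2 * cosh mu) * b ^+ 2 <= c ->
  `|d| <= 2 * Num.sqrt (mu * expR (- mu)) ->
  (forall y0 : state R, inH y0 ->
     (exists Y : R -> state R, mild_solution eps a b c d y0 Y) /\
     (forall Y Z : R -> state R,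
        mild_solution eps a b c d y0 Y -> mild_solution eps a b c d y0 Z ->
        forall t : R, 0 <= t -> eqH (Y t) (Z t))) /\
  (pi ^+ 2 / 4 <= c ->
   `|d| <= Num.sqrt (mu * expR (- mu)) ->
   exponentially_stable eps a b c d).
Proof.
move=> eta mustar eps0 /andP[a_eta _] a1 bdc _ /andP[mu0 mu1] hb hd.
have s3 : 1 < Num.sqrt (3 : R).
  by rewrite -[ltLHS]sqrtr1 ltr_sqrt// ltr1n.
have a0 : 0 < a.
  by apply: lt_le_trans a_eta; rewrite invr_gt0 divr_gt0// ?subr_gt0// addr_gt0 ?sqrtr_gt0.
have c1 : 1 <= c.
  apply: le_trans hb; rewrite lerDl mulr_ge0 ?sqr_ge0// mulr_ge0// addr_ge0//.
    exact: ltW (sinh_gt0 mu0).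
  by rewrite mulr_ge0// (le_trans ler01) ?cosh_ge1.
have c0 : 0 < c := lt_le_trans ltr01 c1.
have bd : `|b * d| <= c by move: bdc; rewrite normrM normfV (gtr0_norm c0) ler_pdivrMr// mul1r.
have ha : 3 * expR mu ^+ 2 * (1 - a) ^+ 2 <= (1 + a) ^+ 2.
  have q0 : 0 < Num.sqrt 3 * `|1 - a|.
    by rewrite mulr_gt0 ?sqrtr_gt0// normr_gt0 subr_eq0 eq_sym.
  have n0 : 0 < `|1 + a| by rewrite normr_gt0 gt_eqF// addr_gt0.
  have := mu1; rewrite -ler_expR /mustar lnK ?posrE ?divr_gt0//.
  rewrite ler_pdivlMr// => h.
  rewrite -[leRHS]real_normK ?num_real//.
  have -> : 3 * expR mu ^+ 2 * (1 - a) ^+ 2 = (expR mu * (Num.sqrt 3 * `|1 - a|)) ^+ 2.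
    rewrite !exprMn sqr_sqrtr// real_normK ?num_real//; ring.
  by rewrite ler_pXn2r// nnegrE ?mulr_ge0 ?expR_ge0 ?sqrtr_ge0.
have hc : 1 + (3 * expR mu + expR (- mu)) * b ^+ 2 <= c.
  by apply: le_trans hb; rewrite /sinh /cosh le_eqVlt; apply/orP; left; apply/eqP; field.
have m0 : 0 <= mu * expR (- mu) by rewrite mulr_ge0 ?expR_ge0 ?ltW.
have sqrd (k : R) : 0 <= k -> `|d| <= k * Num.sqrt (mu * expR (- mu)) ->
    d ^+ 2 <= k ^+ 2 * (mu * expR (- mu)).
  move=> k0 h; rewrite -[d ^+ 2]real_normK ?num_real// -(sqr_sqrtr m0) -exprMn.
  by rewrite ler_pXn2r// nnegrE ?mulr_ge0 ?sqrtr_ge0.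
split.
  move=> y0 Hy0; apply: (well_posed eps0 mu0 (lexx 0) a0 c0 bd _ Hy0) => y z Dy Hz yz.
  rewrite oppr0 mul0r; apply: energy_dissipative Dy Hz yz ha hc _ => //.
  have -> : 4 * (mu * expR (- mu)) = 2 ^+ 2 * (mu * expR (- mu)) by ring.
  exact: sqrd.
move=> _ hd'; set om := Num.min (mu / 4) (4 * eps)^-1.
have om0 : 0 < om by rewrite lt_min divr_gt0//= invr_gt0 mulr_gt0.
apply: (exponential_decay eps0 mu0 (ltW om0) a0 c0 bd _ om0) => y z Dy Hz yz.
apply: energy_strictly_dissipative Dy Hz yz ha hc _ _ _ => //.
- by have := sqrd 1 ler01; rewrite expr1n !mul1r; apply.
- by rewrite mulrC -ler_pdivlMr// ge_min lexx.
- by rewrite mulrC -ler_pdivlMr ?mulr_gt0// div1r ge_min lexx orbT.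
Qed.
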